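(* Assume (A1) and (A2) (recalled in the context). If $W\in L^{\widehat u}_+$ satisfies $$\sup_{k\in K^W}E[u(x+k)]<u(\infty)\quad\text{for some } x>a,$$ then $\mathcal{N}^W$ is not empty and, for all $x>a$: 1. $$U^W(x)=U^W_\Phi(x)=E[u(f_x)]=\min_{\lambda>0,\;Q\in\mathcal{N}^W}\left\{\lambda\,(x+\|Q_s\|)+E\left[\Phi\left(\lambda\frac{dQ_r}{dP}\right)\right]\right\};$$ 2. there exists a unique solution to $U^W_\Phi(x)=\sup\{E[u(f)]: f\in K^W_\Phi(x)\}$ and it is given by $$f_x:=-\Phi'\left(\lambda^*\frac{dQ^*_r}{dP}\right)\in K^W_\Phi(x),$$ where $\lambda^*$ (unique) and $Q^*$ (unique in the regular part $Q^*_r$) are solutions to the dual problem (the minimization problem in item 1); 3. $E_{Q^*_r}[f_x]=x+\|Q^*_s\|$.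
   Context: Market: $T\in(0,\infty]$; $S$ is an $\mathbb{R}^d$-valued càdlàg semimartingale (not necessarily locally bounded) on a filtered probability space $(\Omega,\mathcal{F},(\mathcal{F}_t)_{t\in[0,T]},P)$ satisfying the usual conditions, with $\mathcal{F}_0$ trivial; if $T=\infty$, every process $Y$ considered is assumed to have a limit $Y_\infty=\lim_{t\uparrow\infty}Y_t$. $L(S)$ is the set of $\mathbb{R}^d$-valued predictable $S$-integrable processes and $H\cdot S$ is the stochastic integral. For $W\in L^0_+$, $\mathcal{H}^W=\{H\in L(S): \exists c>0,\ (H\cdot S)_t\ge -cW\ \forall t\le T\}$ and $K^W=\{(H\cdot S)_T: H\in\mathcal{H}^W\}$. Utility: $u:\mathbb{R}\to\mathbb{R}\cup\{-\infty\}$ is increasing, concave on the interior $(a,\infty)$, $a\in[-\infty,0)$, of its effective domain, with $\lim_{x\to-\infty}u(x)=-\infty$ (and $u(x)=-\infty$ for $x<a$ if $a$ is finite); $u(\infty)=\lim_{x\to\infty}u(x)$. $\Phi(y)=\sup_{x\in\mathbb{R}}\{u(x)-xy\}$ for $y\ge0$, $\Phi(0)=u(\infty)$. (A1): $u$ is increasing, strictly concave and continuously differentiable on $(a,\infty)$ and $u'(a):=\lim_{x\downarrow a}u'(x)=+\infty$, $\lim_{x\uparrow\infty}u'(x)=0$. (A2): for every $\lambda>0$, $\mathbb{P}_\Phi=\mathbb{P}_{\Phi_\lambda}$, where $\Phi_\lambda(y)=\Phi(\lambda y)$ and, for a function $\Psi$, $\mathbb{P}_\Psi$ is the set of probabilities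 $Q\ll P$ with $E[\Psi(dQ/dP)]<\infty$. Expectations $E[u(\cdot)]$ are set to $-\infty$ whenever the negative part has infinite expectation. Orlicz spaces: $\widehat u(x)=-u(-|x|)+u(0)$, $L^{\widehat u}=\{f\in L^0:\exists\alpha>0,\ E[\widehat u(\alpha f)]<\infty\}$ with the Luxemburg norm $N_{\widehat u}(f)=\inf\{c>0: E[\widehat u(f/c)]\le1\}$ (a Banach lattice); $\widehat\Phi(y)=\sup_{x}\{xy-\widehat u(x)\}$ and $L^{\widehat\Phi}$ is the corresponding Orlicz space. The norm dual decomposes as $(L^{\widehat u})^*=\mathcal{A}\oplus\mathcal{A}^d$, where $\mathcal{A}$ is the band of order-continuous functionals and $\mathcal{A}^d$ is the band of singular functionals, i.e. those lattice-disjoint from $\mathcal{A}$. Each $z$ is uniquely $z=z_r+z_s$ with $z_r\in\mathcal{A}$ (regular part), $z_s\in\mathcal{A}^d$ (singular part). The functional $z_r$ is identified with a density $\frac{dz_r}{dP}\in L^{\widehat\Phi}$ via $z_r(f)=E_{z_r}[f]=E[f\frac{dz_r}{dP}]$. $\|\cdot\|$ is the dual norm on $(L^{\widehat u})^*$. Primal and dual sets: $C^W=(K^W-L^0_+)\cap L^{\widehat u}$; $(C^W)^0=\{z\in(L^{\widehat u})^*: z(f)\le0\ \forall f\in C^W\}$; $\mathcal{M}^W=\{Q\in(C^W)^0: Q(I_\Omega)=1\}$; $\mathcal{L}_\Phi=\{f\in L^0_+: E[\Phi(f)]<\infty\}$; $\mathcal{N}^W=\{Q\in\mathcal{M}^W: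 Q_r\neq0,\ \frac{dQ_r}{dP}\in\mathcal{L}_\Phi\}$; $$K^W_\Phi(x)=\{f\in L^0: f\in L^1(Q_r),\ E_{Q_r}[f]\le x+\|Q_s\|\ \ \forall Q\in\mathcal{N}^W\};$$ $U^W(x)=\sup_{k\in K^W}E[u(x+k)]$ and $U^W_\Phi(x)=\sup_{f\in K^W_\Phi(x)}E[u(f)]$. Convention: $\Phi'(0)=\Phi'(0^+)=-\infty$, so $f_x=+\infty$ on $\{dQ_r^*/dP=0\}$; accordingly elements of $K^W_\Phi(x)$ are allowed to take the value $+\infty$, with $u(+\infty)=u(\infty)$. *)

(* Defs.v *)
From HB Require Import structures.
From mathcomp Require Import all_boot all_order all_algebra.
From mathcomp Require Import all_classical all_reals all_analysis.
From mathcomp Require Import measurable_realfun.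

Set Implicit Arguments.
Unset Strict Implicit.
Unset Printing Implicit Defensive.

Import Order.TTheory GRing.Theory Num.Theory.
Import numFieldNormedType.Exports.

Local Open Scope classical_set_scope.
Local Open Scope ring_scope.

(** * Stochastic basis, semimartingales, stochastic integral

   The horizon is [T : \bar R].  Times are real numbers ranging over
   [timeset T]; when [T = +oo] the value of a process at infinity is its almost
   sure limit, see [terminal].  Processes are functions on all of [R], but only
   their values on [timeset T] are ever used. *)

Section Stochastic.
Context {R : realType} {dd : measure_display} {Omega : measurableType dd}.
Variables (P : probability Omega R) (T : \bar R) (F : R -> set (set Omega)).

Definition timeset : set R := [set t | 0 <= t /\ (t%:E <= T)%E].

Record usual_filtration : Prop := UsualFiltration {
  filt_sigma : forall t, timeset t -> sigma_algebra setT (F t);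
  filt_sub : forall t, timeset t -> F t `<=` measurable;
  filt_homo : forall s t, timeset s -> timeset t -> s <= t -> F s `<=` F t;
  filt_rcont : forall t, timeset t -> (t%:E < T)%E ->
    F t = [set A | forall s, timeset s -> t < s -> F s A];
  filt_complete : forall A, P.-negligible A -> F 0 A;
  filt_trivial : forall A, F 0 A -> P A = 0%E \/ P A = 1%E }.

Definition process := R -> Omega -> R.

Definition adapted (X : process) :=
  forall t, timeset t -> forall B, measurable B -> F t (X t @^-1` B).

Definition cadlag (X : process) := forall w t, timeset t ->
  ((t%:E < T)%E -> X s w @[s --> t^'+] --> X t w) /\
  (0 < t -> cvg (X s w @[s --> t^'-])).

Definition martingale (X : process) :=
  [/\ adapted X,
      (forall t, timeset t -> P.-integrable setT (EFin \o X t)) &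
      forall s t, timeset s -> timeset t -> s <= t -> forall A, F s A ->
        (\int[P]_(w in A) (X t w)%:E = \int[P]_(w in A) (X s w)%:E)%E].

Definition stopping_time (tau : Omega -> \bar R) :=
  (forall w, (0 <= tau w)%E) /\
  (forall t, timeset t -> F t [set w | (tau w <= t%:E)%E]).

Definition stopped (X : process) (tau : Omega -> \bar R) : process :=
  fun t w => X (fine (Order.min t%:E (tau w))) w.

Definition local_martingale (X : process) :=
  [/\ adapted X, cadlag X &
      exists tau : nat -> Omega -> \bar R,
      [/\ forall n, stopping_time (tau n),
          forall n w, (tau n w <= tau n.+1 w)%E,
          {ae P, forall w, forall t, timeset t ->
                   exists n, (t%:E <= tau n w)%E} &
          forall n, martingale (fun t w => stopped X (tau n) t w - X 0 w)]].

Definition finite_variation (X : process) :=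
  [/\ adapted X, cadlag X &
      forall w t, timeset t -> bounded_variation 0 t (fun s => X s w)].

Definition semimartingale1 (X : process) :=
  [/\ adapted X, cadlag X &
  exists M A : process,
    [/\ local_martingale M, finite_variation A &
        forall t w, timeset t -> X t w = M t w + A t w]].

Definition terminal (X : process) (f : Omega -> R) :=
  match T with
  | t%:E => {ae P, forall w, f w = X t w}
  | _ => {ae P, forall w, X s w @[s --> +oo] --> f w}
  end.

(** Convergence uniform on compacts in probability. *)
Definition ucp_cvg (Xn : nat -> process) (X : process) :=
  forall t eps : R, timeset t -> 0 < eps ->
  P [set w | exists s : R, 0 <= s <= t /\ eps < `|Xn n s w - X s w|]
    @[n --> \oo] --> 0%E.

(** [Block s t A c] stands for the process [c 1_{]s, t] x A}]; an elementary
   predictable process is a finite sum of these. *)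
Record block := Block
  { bl_s : R ; bl_t : R ; bl_A : set Omega ; bl_c : R }.

Definition elementary (K : seq block) :=
  forall n b0, (n < size K)%N -> let b := nth b0 K n in
  [/\ timeset (bl_s b), timeset (bl_t b), bl_s b <= bl_t b
    & F (bl_s b) (bl_A b)].

Definition elem_val (K : seq block) : process := fun r w =>
  \sum_(b <- K) bl_c b * \1_(bl_A b) w * (bl_s b < r <= bl_t b)%R%:R.

Definition elem_int (K : seq block) (X : process) : process := fun r w =>
  \sum_(b <- K) bl_c b * \1_(bl_A b) w *
    (X (Order.min (bl_t b) r) w - X (Order.min (bl_s b) r) w).

(** Convergence in the semimartingale (Emery) topology: ucp convergence,
   uniformly over the elementary integrals with integrand bounded by 1. *)
Definition emery_cvg (Xn : nat -> process) (X : process) :=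
  ucp_cvg Xn X /\
  forall t eps del : R, timeset t -> 0 < eps -> 0 < del ->
  \forall n \near \oo, forall K, elementary K ->
    (forall r w, timeset r -> `|elem_val K r w| <= 1) ->
    (P [set w | exists s : R, (0 <= s <= t)%R /\
        (eps < `|elem_int K (fun r v => Xn n r v - X r v) s w|)%R]
      <= del%:E)%E.

Section VectorIntegral.
Context {d : nat}.

Definition vprocess := R -> Omega -> 'rV[R]_d.

Definition coordinate (X : vprocess) (i : 'I_d) : process :=
  fun t w => X t w ord0 i.

Definition semimartingale (S : vprocess) :=
  forall i, semimartingale1 (coordinate S i).

Definition has_limit_at_infinity (S : vprocess) :=
  T = +oo%E -> forall i, {ae P, forall w, cvg (coordinate S i s w @[s --> +oo])}.

Definition predictable_domain : set (R * Omega) := [set p | timeset p.1].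

Definition predictable_rectangles : set (set (R * Omega)) :=
  [set B | (exists2 A, F 0 A & B = [set 0] `*` A) \/
           (exists (s t : R) A, [/\ timeset s, timeset t, F s A &
              B = [set r : R | s < r <= t] `*` A])].

Definition predictable (H : vprocess) := forall i (B : set R), measurable B ->
  <<s predictable_domain, predictable_rectangles >>
    (predictable_domain `&` [set p | B (coordinate H i p.1 p.2)]).

(** Integrals are taken over ]0, t], so that values of integrands at time 0 play
   no role. *)
Definition pointwise_cvg (Hn : nat -> vprocess) (H : vprocess) :=
  forall t w i, timeset t -> 0 < t ->
    coordinate (Hn n) i t w @[n --> \oo] --> coordinate H i t w.

(** [bounded_integral S H X]: [X] is (a version of) the integral of the bounded
   predictable process [H].  This integral is the unique extension of the
   elementary integral satisfying the bounded convergence theorem (bounded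
   pointwise convergence of integrands implies ucp convergence of integrals);
   for a semimartingale [S] the closure below is its graph, by a monotone class
   argument. *)
Inductive bounded_integral (S : vprocess) : vprocess -> process -> Prop :=
| bounded_integral_elem (K : 'I_d -> seq block) :
    (forall i, elementary (K i)) ->
    bounded_integral S
      (fun t w => \row_i elem_val (K i) t w)
      (fun t w => \sum_i elem_int (K i) (coordinate S i) t w)
| bounded_integral_lim (Hn : nat -> vprocess) (Xn : nat -> process)
    (H : vprocess) (X : process) (c : R) :
    (forall n, bounded_integral S (Hn n) (Xn n)) ->
    (forall n t w i, timeset t -> 0 < t -> `|coordinate (Hn n) i t w| <= c) ->
    pointwise_cvg Hn H ->
    adapted X -> cadlag X -> ucp_cvg Xn X ->
    bounded_integral S H X.

(** [stochastic_integral S H X]: [H] belongs to L(S) and [X = H . S] (vector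
   stochastic integral).  A predictable [H] is S-integrable iff it is a pointwise
   limit of bounded predictable processes whose integrals converge in the
   semimartingale topology, and the limit of the integrals is then [H . S].
   The truncations [H 1_{|H| <= n}] are always an admissible choice for [H] in
   L(S), and by Memin's closedness theorem the limit does not depend on the
   approximating sequence. *)
Definition stochastic_integral (S H : vprocess) (X : process) :=
  [/\ predictable H, adapted X, cadlag X &
  exists (Hn : nat -> vprocess) (Xn : nat -> process),
  [/\ forall n, bounded_integral S (Hn n) (Xn n),
      pointwise_cvg Hn H & emery_cvg Xn X]].

Definition admissible (W : Omega -> R) (X : process) :=
  exists2 c : R, 0 < c &
    {ae P, forall w, forall t, timeset t -> - (c * W w) <= X t w}.

Definition KW (S : vprocess) (W : Omega -> R) : set (Omega -> R) :=
  [set k | measurable_fun setT k /\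
     exists H X, [/\ stochastic_integral S H X, admissible W X & terminal X k]].

End VectorIntegral.
End Stochastic.

Arguments vprocess R {dd} Omega d.
Arguments KW {R dd Omega} P T F {d} S W.

(** * Utility functions *)

Section Utility.
Context {R : realType}.
Variables (u : R -> \bar R) (a : \bar R).

Definition ufin : R -> R := fun x => fine (u x).

(** ]a, +oo[ is the interior of the effective domain. *)
Record utility : Prop := Utility {
  util_a : (a < 0)%E;
  util_ltpinfty : forall x, (u x < +oo)%E;
  util_homo : forall x y, x <= y -> (u x <= u y)%E;
  util_dom : forall x, (a < x%:E)%E -> (-oo < u x)%E;
  util_out : forall x, (x%:E < a)%E -> u x = -oo%E;
  util_concave : forall x y t : R, (a < x%:E)%E -> (a < y%:E)%E -> 0 <= t <= 1 ->
    t * ufin x + (1 - t) * ufin y <= ufin (t * x + (1 - t) * y);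
  util_lim : u x @[x --> -oo] --> -oo%E }.

Definition uinfty : \bar R := lim (u x @[x --> +oo]).

Definition Phi (y : R) : \bar R :=
  ereal_sup (range (fun x => u x - (x * y)%R%:E)%E).

(** The derivative of [Phi] with the convention [Phi' 0 = -oo]; negative
   arguments are irrelevant as it is applied to densities of nonnegative
   functionals. *)
Definition dPhi (y : R) : \bar R :=
  if y <= 0 then -oo%E else (derive1 (fun z => fine (Phi z)) y)%:E.

Record A1 : Prop := MkA1 {
  A1_mono : forall x y, (a < x%:E)%E -> x < y -> (u x < u y)%E;
  A1_strict : forall x y t : R, (a < x%:E)%E -> (a < y%:E)%E -> x != y ->
    0 < t < 1 ->
    t * ufin x + (1 - t) * ufin y < ufin (t * x + (1 - t) * y);
  A1_derivable : forall x, (a < x%:E)%E -> derivable ufin x 1;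
  A1_continuous : forall x, (a < x%:E)%E -> {for x, continuous (derive1 ufin)};
  A1_at_a : forall M : R, exists2 b : R, (a < b%:E)%E &
    forall x, (a < x%:E)%E -> x < b -> M <= derive1 ufin x;
  A1_at_infty : derive1 ufin x @[x --> +oo] --> 0 }.

(** [u] on extended-valued arguments; the value at [-oo] is never used. *)
Definition uext (x : \bar R) : \bar R :=
  match x with
  | r%:E => u r
  | +oo%E => uinfty
  | -oo%E => -oo%E
  end.

Definition hatu (x : R) : \bar R := (u 0 - u (- `|x|)%R)%E.

Definition hatPhi (y : R) : \bar R :=
  ereal_sup (range (fun x => (x * y)%R%:E - hatu x)%E).

End Utility.

Section UtilityMaximization.
Context {R : realType} {dd : measure_display} {Omega : measurableType dd}.
Variables (P : probability Omega R).

Definition finite_entropy (Psi : R -> \bar R) : set (probability Omega R) :=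
  [set Q : probability Omega R | Q `<< P /\
    (\int[P]_w
       Psi (fine (Radon_Nikodym (charge_of_finite_measure Q) P w)) < +oo)%E].

Definition A2 (u : R -> \bar R) := forall lam : R, 0 < lam ->
  finite_entropy (Phi u) = finite_entropy (fun y => Phi u (lam * y)).

(** * Orlicz spaces and their norm duals

   Random variables are functions, identified when almost surely equal. *)

Definition orlicz (Psi : R -> \bar R) : set (Omega -> R) :=
  [set f : Omega -> R | measurable_fun setT f /\
    exists2 alpha : R, 0 < alpha & (\int[P]_w Psi (alpha * f w)%R < +oo)%E].

Variable u : R -> \bar R.

Local Notation L := (orlicz (hatu u)).

Definition luxemburg (f : Omega -> R) : R :=
  inf [set c : R | 0 < c /\ (\int[P]_w hatu u (f w / c)%R <= 1)%E].

(** Functionals are total functions on [Omega -> R]; only their restriction to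
   the Orlicz space matters.  The norm bound makes them compatible with almost
   sure equality. *)
Definition functional := (Omega -> R) -> R.

Definition dual (z : functional) :=
  (forall (c : R) f g, L f -> L g ->
     z (fun w => c * f w + g w) = c * z f + z g) /\
  (exists C : R, forall f, L f -> `|z f| <= C * luxemburg f).

Definition dual_norm (z : functional) : R :=
  sup [set `|z f| | f in [set f | L f /\ luxemburg f <= 1]].

Definition le_as (f g : Omega -> R) := {ae P, forall w, f w <= g w}.

(** [D] is nonempty and directed downwards, with infimum 0 in the Orlicz space. *)
Definition decreases_to0 (D : set (Omega -> R)) :=
  [/\ D !=set0, D `<=` L,
      forall f g, D f -> D g -> exists h, [/\ D h, le_as h f & le_as h g],
      forall f, D f -> le_as (cst 0) f &
      forall g, L g -> (forall f, D f -> le_as g f) -> le_as g (cst 0)].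

Definition order_continuous (z : functional) :=
  dual z /\
  forall D, decreases_to0 D -> forall eps : R, 0 < eps ->
    exists2 f0, D f0 & forall f, D f -> le_as f f0 -> `|z f| < eps.

(** Riesz-Kantorovich formulas, on nonnegative [f]:
   [|z| f = sup {z g : |g| <= f}] and
   [(|z| /\ |z'|) f = inf {|z| g + |z'| (f - g) : 0 <= g <= f}]. *)
Definition dual_abs (z : functional) (f : Omega -> R) : R :=
  sup [set z g | g in [set g | L g /\ le_as (fun w => `|g w|) f]].

Definition disjoint_functionals (z z' : functional) :=
  forall f, L f -> le_as (cst 0) f ->
  inf [set dual_abs z g + dual_abs z' (fun w => f w - g w) |
        g in [set g | [/\ L g, le_as (cst 0) g & le_as g f]]] = 0.

Definition singular (z : functional) :=
  dual z /\ forall z', order_continuous z' -> disjoint_functionals z z'.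

(** Regular and singular part of a functional and density of its regular part:
   definite descriptions, unique on the Orlicz space, resp. almost surely. *)
Definition reg (z : functional) : functional :=
  get [set zr : functional | order_continuous zr /\
                             singular (fun f => z f - zr f)].

Definition sing (z : functional) : functional := fun f => z f - reg z f.

Definition dens_reg (z : functional) : Omega -> R :=
  get [set g : Omega -> R | orlicz (hatPhi u) g /\
    forall f, L f ->
      P.-integrable setT (fun w => (f w * g w)%:E) /\
      (reg z f)%:E = (\int[P]_w (f w * g w)%R%:E)%E].

(** * Primal and dual problems, for an arbitrary set [K] of terminal gains *)

Definition expected_utility (f : Omega -> \bar R) : \bar R :=
  let g := fun w => uext u (f w) in
  if (\int[P]_w (g ^\- w))%E == +oo%E then -oo%E else (\int[P]_w g w)%E.

Variable K : set (Omega -> R).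

Definition CW : set (Omega -> R) :=
  [set f | L f /\ exists k g,
     [/\ K k, measurable_fun setT g, le_as (cst 0) g &
         {ae P, forall w, f w = k w - g w}]].

Definition MW : set functional :=
  [set Q | [/\ dual Q, (forall f, CW f -> Q f <= 0) & Q (cst 1) = 1]].

Definition LPhi : set (Omega -> R) :=
  [set f : Omega -> R |
   [/\ measurable_fun setT f, le_as (cst 0) f &
               (\int[P]_w Phi u (f w) < +oo)%E]].

Definition NW : set functional :=
  [set Q | [/\ MW Q, (exists2 f, L f & reg Q f != 0) & LPhi (dens_reg Q)]].

(** [+oo * 0 = 0] in [\bar R], so that [f] may be infinite where the density
   vanishes. *)
Definition KPhi (x : R) : set (Omega -> \bar R) :=
  [set f : Omega -> \bar R |
   [/\ measurable_fun setT f, (forall w, f w != -oo%E) &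
    forall Q, NW Q ->
      P.-integrable setT (fun w => f w * (dens_reg Q w)%:E)%E /\
      (\int[P]_w (f w * (dens_reg Q w)%:E)
         <= (x + dual_norm (sing Q))%R%:E)%E]].

Definition UW (x : R) : \bar R :=
  ereal_sup [set expected_utility (fun w => (x + k w)%:E) | k in K].

Definition UPhi (x : R) : \bar R :=
  ereal_sup [set expected_utility f | f in KPhi x].

Definition dual_value (x lam : R) (Q : functional) : \bar R :=
  ((lam * (x + dual_norm (sing Q)))%:E +
   \int[P]_w Phi u (lam * dens_reg Q w)%R)%E.

Definition dual_solution (x lam : R) (Q : functional) :=
  [/\ 0 < lam, NW Q &
      forall lam' Q', 0 < lam' -> NW Q' ->
        (dual_value x lam Q <= dual_value x lam' Q')%E].

End UtilityMaximization.

(* Main.v *)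
(* The cone of terminal gains is convex, so the primal value is concave and a
   Hahn-Banach argument yields a supergradient [z] of it, a positive functional
   on the Orlicz space with [z <= 0] on [C^W].  The countably additive part of
   [A |-> z \1_A] gives the density [g] of the regular part, and the singular
   part lives on events decreasing to a null event.  Testing the supergradient
   inequality with a near maximizer of [u x - x g] off these events and with a
   near maximizer of the norm of the singular part on them shows that
   [E (Phi g) + ||z_s|| + x z(1)] is at most the primal value; by (A2) the
   normalization of [z] is in [N^W], and Fenchel's inequality gives the converse.
   Fatou's lemma along segments of dual variables then shows that
   [f_x = - Phi'(lambda g)] lies in [K^W_Phi(x)] and saturates its constraint, and
   the equality cases of Fenchel's inequality give uniqueness. *)

Require Import Defs.
From HB Require Import structures.
From mathcomp Require Import all_boot all_order all_algebra.
From mathcomp Require Import all_classical all_reals all_analysis.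
From mathcomp Require Import measurable_realfun ring lra.

Set Implicit Arguments.
Unset Strict Implicit.
Unset Printing Implicit Defensive.

Import Order.TTheory GRing.Theory Num.Theory.
Import numFieldNormedType.Exports.

Local Open Scope classical_set_scope.
Local Open Scope ring_scope.

(** The norm of the Orlicz space is in general not order continuous, so a dual variable may keep a
    singular part [z_s], which no density describes. It is tractable because it ignores what a
    function does off arbitrarily small events: a function of finite modular can be cut down to an
    event where its modular is at most 1, so [||z_s||] bounds [z_s] on the whole domain of the
    modular and not only on the unit ball. For the same reason the mass [z_s(1)] is 0 if [a] is
    infinite, and [||z_s|| = - a z_s(1)] otherwise, which is what pins down the multiplier.

    A second obstacle is that [reg] and [dens_reg] are chosen by description. Before anything can be
    computed, an explicit decomposition has to be built, its regular part shown to be order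
    continuous along arbitrary directed families, and the decomposition shown to be unique; even
    linearity of the regular part is read off explicit decompositions.

    Finally, the strict inequality is assumed at one [x] only. It spreads to all [x] through the
    dual problem: as [Phi'(0) = -oo], each element of [N^W] has dual value below [u(oo)] for some
    multiplier, whatever [x] is. *)

Section RealDerivative.
Context {R : realType}.

Lemma derive1_increment (f : R -> R) x : derivable f x 1 ->
  forall e, 0 < e -> exists2 d, 0 < d &
    forall h, `|h| < d -> `|f (x + h) - f x - derive1 f x * h| <= e * `|h|.
Proof.
move=> df e e0.
have /cvgrPdist_le/(_ e e0) := df.
rewrite near_withinE; case/nbhs_ballP => d /= d0 Hd.
exists d => // h hd; have [->|h0] := eqVneq h 0.
  by rewrite addr0 subrr mulr0 subrr !normr0 mulr0.
have := Hd h; rewrite /ball/= sub0r normrN => /(_ hd h0).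
rewrite derive1E /derive; set l := lim _ => H.
have -> : f (x + h) - f x - l * h =
   - (h * (l - h^-1 *: (f (h%:A + x) - f x))).
  by rewrite mulrBr /GRing.scale/= mulr1 mulVKf// (addrC h); ring.
by rewrite normrN normrM mulrC ler_wpM2r.
Qed.

Lemma increment_derive1 (f : R -> R) x l :
  (forall e, 0 < e -> exists2 d, 0 < d &
    forall h, `|h| < d -> `|f (x + h) - f x - l * h| <= e * `|h|) ->
  derive1 f x = l.
Proof.
move=> H; rewrite /derive1; apply: cvg_lim => //.
apply/cvgrPdist_le => e e0; have [d d0 Hd] := H e e0.
rewrite near_withinE; apply/nbhs_ballP; exists d => //= h.
rewrite /ball/= sub0r normrN => hd h0.
have := Hd h hd.
have -> : f (x + h) - f x - l * h = - (h * (l - h^-1 * (f (h + x) - f x))).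
  by rewrite mulrBr mulVKf// (addrC h); ring.
by rewrite normrN normrM mulrC ler_pM2r// normr_gt0.
Qed.

End RealDerivative.

(** * Concave utilities, inverse marginal utility and the conjugate *)

Section UtilityFacts.
Context {R : realType}.
Variables (u : R -> \bar R) (a : \bar R).
Hypotheses (hu : utility u a) (hA1 : A1 u a).

Local Notation v := (ufin u).
Local Notation v' := (derive1 (ufin u)).

Lemma ufinE (x : R) : (a < x%:E)%E -> u x = (v x)%:E.
Proof.
move=> ax; rewrite /ufin fineK// fin_numE.
by rewrite -ltNye (util_dom hu ax) -ltey (util_ltpinfty hu).
Qed.

Lemma ufinE_gtNy (x : R) : (-oo < u x)%E -> u x = (v x)%:E.
Proof. by move=> ux; rewrite /ufin fineK// fin_numE -ltNye ux -ltey (util_ltpinfty hu). Qed.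

Lemma gtNy_le_a (x : R) : (-oo < u x)%E -> (a <= x%:E)%E.
Proof. by move=> ux; rewrite leNgt; apply/negP => /(util_out hu) E; rewrite E in ux. Qed.

Lemma a_lt0 : (a < 0%:E)%E. Proof. exact: util_a hu. Qed.

Lemma u0E : u 0 = (v 0)%:E. Proof. exact: ufinE a_lt0. Qed.

Lemma a_ltW (x y : R) : (a < x%:E)%E -> x <= y -> (a < y%:E)%E.
Proof. by move=> ax xy; rewrite (lt_le_trans ax)// lee_fin. Qed.

Lemma a_leW (x y : R) : (a <= x%:E)%E -> x < y -> (a < y%:E)%E.
Proof. by move=> ax xy; rewrite (le_lt_trans ax)// lte_fin. Qed.

Lemma a_conv (x y t : R) : (a < x%:E)%E -> (a <= y%:E)%E -> 0 < t -> t <= 1 ->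
  (a < (t * x + (1 - t) * y)%:E)%E.
Proof.
move=> ax ay t0 t1; case: (a) a_lt0 ax ay => [b||] // _; last first.
  by move=> _ _; exact: ltNyr.
rewrite !lte_fin !lee_fin => bx byy; nra.
Qed.

Lemma v_incr (x y : R) : (a < x%:E)%E -> x < y -> v x < v y.
Proof.
move=> ax xy; have := A1_mono hA1 ax xy.
by rewrite (ufinE ax) (ufinE (a_ltW ax (ltW xy))) lte_fin.
Qed.

Lemma v_tangent (x y : R) : (a < x%:E)%E -> (a < y%:E)%E ->
  v y <= v x + v' x * (y - x).
Proof.
move=> ax ay; rewrite leNgt; apply/negP => H.
have [xy|xy] := eqVneq x y; first by move: H; rewrite xy subrr mulr0 addr0 ltxx.
set g := v y - (v x + v' x * (y - x)).
have g0 : 0 < g by rewrite /g subr_gt0.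
have n0 : 0 < `|y - x| by rewrite normr_gt0 subr_eq0 eq_sym.
set n := `|y - x| in n0.
(* With this error the first-order expansion at distance [t * n] is off by [g * t / 2], half of the
   excess [g * t] that concavity forces along the segment. *)
have e0 : 0 < g / (2 * n) by rewrite divr_gt0// mulr_gt0.
have [d d0 Hd] := derive1_increment (A1_derivable hA1 ax) e0.
set t := Num.min (2^-1) (d / (2 * n)).
have t0 : 0 < t by rewrite lt_min invr_gt0 ltr0n/= divr_gt0// mulr_gt0.
have t1 : t <= 2^-1 by rewrite ge_min lexx.
have td : t * n < d.
  have : t <= d / (2 * n) by rewrite ge_min lexx orbT.
  rewrite ler_pdivlMr ?mulr_gt0//; nra.
have := Hd (t * (y - x)); rewrite normrM (gtr0_norm t0) -/n => /(_ td).
rewrite ler_norml => /andP[_ H1].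
have : t * v y + (1 - t) * v x <= v (t * y + (1 - t) * x).
  apply: (util_concave hu) => //; apply/andP; split; lra.
have -> : t * y + (1 - t) * x = x + t * (y - x) by ring.
have E : g / (2 * n) * (t * n) = g * t / 2 by field; rewrite gt_eqF.
move: H1; rewrite E => H1 H2.
have : g * t <= g * t / 2 by rewrite /g in H1 H2 *; nra.
have : 0 < g * t by rewrite mulr_gt0.
lra.
Qed.

(** Strictness costs one midpoint: the tangent bounds [v] there, while strict concavity puts [v]
    above the chord. *)
Lemma v_tangent_lt (x y : R) : (a < x%:E)%E -> (a < y%:E)%E -> x != y ->
  v y < v x + v' x * (y - x).
Proof.
move=> ax ay xy; have h : 0 < (2^-1 : R) < 1 by apply/andP; split; lra.
have H := A1_strict hA1 ax ay xy h.
have am : (a < (2^-1 * x + (1 - 2^-1) * y)%:E)%E.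
  by apply: a_conv => //; [exact: ltW|lra].
have := v_tangent ax am; nra.
Qed.

Lemma v'_decr (x y : R) : (a < x%:E)%E -> x < y -> v' y < v' x.
Proof.
move=> ax xy; have ay := a_ltW ax (ltW xy).
have H1 := v_tangent_lt ax ay (negbT (lt_eqF xy)).
have H2 := v_tangent_lt ay ax (negbT (gt_eqF xy)).
nra.
Qed.

Lemma v'_gt0 (x : R) : (a < x%:E)%E -> 0 < v' x.
Proof.
move=> ax; have xy : x < x + 1 by lra.
have H1 := v_tangent ax (a_ltW ax (ltW xy)).
have := v_incr ax xy; lra.
Qed.

(* The utility may jump down at a finite left end point [a], hence the detour through points [x' > x]. *)
Lemma v_conc (x y t : R) : (-oo < u x)%E -> (-oo < u y)%E -> 0 < t < 1 ->
  (-oo < u (t * x + (1 - t) * y))%E /\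
  t * v x + (1 - t) * v y <= v (t * x + (1 - t) * y).
Proof.
wlog xy : x y t / x <= y => [hw|] ux uy t01.
  have [|yx] := leP x y; first by move=> /hw; apply.
  have [] := hw y x (1 - t) (ltW yx) uy ux; first by move: t01 => /andP[]; lra.
  have -> : 1 - (1 - t) = t by ring.
  by rewrite ![(1 - t) * _ + _]addrC.
have /andP[t0 t1] := t01.
have [xy'|xy'] := eqVneq x y.
  rewrite -xy'; have -> : t * x + (1 - t) * x = x by ring.
  split=> //; rewrite (_ : t * v x + (1 - t) * v x = v x)//; ring.
have {xy'} xy : x < y by rewrite lt_neqAle xy'.
have aLx := gtNy_le_a ux.
have ay : (a < y%:E)%E by exact: a_leW aLx xy.
set z := t * x + (1 - t) * y.
have xz : x < z by rewrite /z; nra.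
have az := a_leW aLx xz.
split; first exact: (util_dom hu).
rewrite leNgt; apply/negP => H.
set c := t * v x + (1 - t) * v y in H.
have v'z := v'_gt0 az.
(* Shifting the left point by [e > 0] brings it into the open domain; by the tangent at [z] this
   raises [v] at the combination by at most [t * (c - v z) / 2], too little to close the gap. *)
set e := (c - v z) / (2 * v' z).
have e0 : 0 < e by rewrite divr_gt0 ?mulr_gt0// subr_gt0.
have axe : (a < (x + e)%:E)%E by apply: a_leW aLx _; lra.
have aze : (a < (z + t * e)%:E)%E by apply: a_ltW az _; nra.
have h1 : t * v (x + e) + (1 - t) * v y <= v (t * (x + e) + (1 - t) * y).
  by apply: (util_concave hu) => //; rewrite !ltW.
have E1 : t * (x + e) + (1 - t) * y = z + t * e by rewrite /z; ring.
rewrite E1 in h1.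
have h2 := v_tangent az aze.
have E2 : z + t * e - z = t * e by ring.
rewrite E2 in h2.
have E3 : v' z * e = (c - v z) / 2 by rewrite /e; field; rewrite gt_eqF.
have h3 : v x <= v (x + e).
  have : (u x <= u (x + e))%E by apply: (util_homo hu); lra.
  by rewrite (ufinE_gtNy ux) (ufinE axe) lee_fin.
have E4 : v' z * (t * e) = t * ((c - v z) / 2) by rewrite mulrCA E3.
rewrite {}E4 in h2; clear axe aze ay az aLx ux uy E1 E2 E3.
have h4 : t * v x <= t * v (x + e) by rewrite ler_pM2l.
have h5 : t * ((c - v z) / 2) <= 1 * ((c - v z) / 2).
  by rewrite ler_wpM2r ?(ltW t1)// divr_ge0// subr_ge0 ltW.
by move: H h1 h2 h4 h5; rewrite /c; lra.
Qed.

(** * The function [hatu] *)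

Local Notation hu_ := (hatu u).

Lemma hatuE_fin (x : R) : (-oo < u (- `|x|))%E -> hu_ x = (v 0 - v (- `|x|))%:E.
Proof. by move=> ux; rewrite /hatu u0E (ufinE_gtNy ux). Qed.

Lemma hatuE_y (x : R) : ~~ (-oo < u (- `|x|))%E -> hu_ x = +oo%E.
Proof. by rewrite ltNye negbK /hatu => /eqP ->; rewrite u0E. Qed.

Lemma hatu0 : hu_ 0 = 0%E.
Proof. by rewrite /hatu normr0 oppr0 u0E subee. Qed.

Lemma hatu_le (x y : R) : `|x| <= `|y| -> (hu_ x <= hu_ y)%E.
Proof. by move=> xy; rewrite /hatu leeB// (util_homo hu)// lerN2. Qed.

Lemma hatu_ge0 (x : R) : (0 <= hu_ x)%E.
Proof. by rewrite -hatu0 hatu_le// normr0. Qed.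

Lemma hatu_norm (x : R) : hu_ `|x| = hu_ x.
Proof. by rewrite /hatu normr_id. Qed.

Lemma hatuN (x : R) : hu_ (- x) = hu_ x.
Proof. by rewrite /hatu normrN. Qed.

Lemma hatu_conv (x y t : R) : 0 < t < 1 ->
  (hu_ (t * x + (1 - t) * y) <= t%:E * hu_ x + (1 - t)%:E * hu_ y)%E.
Proof.
move=> /[dup] t01 /andP[t0 t1].
have t'0 : 0 < 1 - t by lra.
have [ux|ux] := boolP (-oo < u (- `|x|))%E; last first.
  rewrite (hatuE_y ux) gt0_muley ?lte_fin// addye ?leey//.
  by rewrite -ltNye (lt_le_trans _ (mule_ge0 _ (hatu_ge0 _)))// ?lee_fin ?ltW.
have [uy|uy] := boolP (-oo < u (- `|y|))%E; last first.
  rewrite (hatuE_y uy) gt0_muley ?lte_fin// addey ?leey//.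
  by rewrite -ltNye (lt_le_trans _ (mule_ge0 _ (hatu_ge0 _)))// ?lee_fin ?ltW.
have [h1 h2] := v_conc ux uy t01.
have hn : `|t * x + (1 - t) * y| <= `|t * `|x| + (1 - t) * `|y| |.
  rewrite (le_trans (ler_normD _ _))// !normrM (gtr0_norm t0) (gtr0_norm t'0).
  by rewrite ler_norm.
apply: (le_trans (hatu_le hn)).
have E : - `|t * `|x| + (1 - t) * `|y| | = t * - `|x| + (1 - t) * - `|y|.
  rewrite ger0_norm; first by ring.
  by rewrite addr_ge0// mulr_ge0// ltW.
rewrite -E in h1 h2.
rewrite (hatuE_fin h1) (hatuE_fin ux) (hatuE_fin uy).
by rewrite -!EFinM -EFinD lee_fin; nra.
Qed.

Lemma hatu_scale (x t : R) : 0 <= t <= 1 -> (hu_ (t * x) <= t%:E * hu_ x)%E.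
Proof.
move=> /andP[t0 t1].
have [->|tn0] := eqVneq t 0; first by rewrite mul0r hatu0 mul0e.
have [->|tn1] := eqVneq t 1; first by rewrite mul1r mul1e.
have t01 : 0 < t < 1 by rewrite !lt_neqAle tn1 t1 eq_sym tn0 t0.
by have := hatu_conv x 0 t01; rewrite mulr0 addr0 hatu0 mule0 adde0.
Qed.

Lemma hatu_fin (c : R) : (a < (- `|c|)%:E)%E -> hu_ c = (v 0 - v (- `|c|))%:E.
Proof. by move=> ac; rewrite hatuE_fin// (util_dom hu). Qed.

Lemma ex_a_c0 : exists2 c : R, 0 < c & (a < (- c)%:E)%E.
Proof.
case: (a) a_lt0 => [b||] //; last by exists 1 => //; exact: ltNyr.
rewrite lte_fin => b0; exists (- b / 2); first lra.
by rewrite lte_fin; lra.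
Qed.

(** By convexity and [hatu u 0 = 0], beyond [c] the function lies above the line through 0 and its
    value at [c], so a finite modular implies integrability. The point [c] has [- c] in the domain,
    which makes the slope [k / c] finite. *)
Lemma hatu_growth : exists2 c : R, 0 < c &
  forall x, (`|x|%:E <= c%:E * (1 + hu_ x))%E.
Proof.
have [c c0 ac] := ex_a_c0.
have hc : (hu_ c = (v 0 - v (- c))%:E).
  by rewrite hatu_fin gtr0_norm.
set k := v 0 - v (- c).
have k0 : 0 < k by rewrite subr_gt0; apply: v_incr => //; lra.
exists (c + c / k) => [|x]; first by rewrite addr_gt0// divr_gt0.
have ck : 0 < c + c / k by rewrite addr_gt0// divr_gt0.
have [xc|cx] := leP `|x| c.
  apply: (@le_trans _ _ ((c + c / k)%:E * 1)%E).
    by rewrite mule1 lee_fin (le_trans xc)// lerDl divr_ge0 ?ltW.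
  by rewrite lee_pmul2l ?fin_numE ?lte_fin// leeDl// hatu_ge0.
have x0 : 0 < `|x| by exact: lt_trans cx.
have : (hu_ (c / `|x| * `|x|) <= (c / `|x|)%:E * hu_ `|x|)%E.
  by apply: hatu_scale; rewrite divr_ge0 ?(ltW c0) ?normr_ge0//= ler_pdivrMr// mul1r ltW.
rewrite divfK ?gt_eqF// hatu_norm hc -/k.
case: (hu_ x) (hatu_ge0 x) => [h||] //= h0; last first.
  by rewrite addey// (gt0_muley (x := (c + c / k)%:E)) ?lte_fin ?leey.
rewrite -EFinM -EFinD -EFinM !lee_fin => H.
have {}H : k * `|x| <= c * h.
  by move: H; rewrite mulrAC ler_pdivlMr.
have : `|x| <= c / k * h by rewrite mulrAC ler_pdivlMr// mulrC.
rewrite lee_fin in h0.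
have : 0 <= c / k by rewrite divr_ge0 ?ltW.
nra.
Qed.

(** * Inverse marginal utility and the conjugate function *)

Definition inv_marginal (y : R) : R := get [set x : R | (a < x%:E)%E /\ v' x = y].
Local Notation II := inv_marginal.

(** The conditions on [u'] at the two ends of the domain enclose [y] between two values of [v'];
    continuity does the rest. *)
Lemma inv_marginalP (y : R) : 0 < y -> (a < (II y)%:E)%E /\ v' (II y) = y.
Proof.
move=> y0; apply: (@getPex _ [set x : R | (a < x%:E)%E /\ v' x = y]) => /=.
have [b ab Hb] := A1_at_a hA1 y.
have [b1 [ab1 hb1]] : exists b1 : R, (a < b1%:E)%E /\ y <= v' b1.
  case: (a) ab Hb => [r||] //.
  - rewrite lte_fin => rb Hb; exists ((r + b) / 2); split.
      by rewrite lte_fin; lra.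
    by apply: Hb; rewrite ?lte_fin; lra.
  - move=> _ Hb; exists (b - 1); split; first exact: ltNyr.
    by apply: Hb; [exact: ltNyr|lra].
have [b2 hb12 hb2] : exists2 b2, b1 < b2 & v' b2 < y.
  have /cvgrPdist_lt/(_ y y0) := A1_at_infty hA1.
  case => M [_ HM]; exists (Num.max M b1 + 1).
    by rewrite ltr_pwDr// le_max lexx orbT.
  have := HM (Num.max M b1 + 1); rewrite sub0r normrN => H.
  apply: (le_lt_trans (ler_norm _)); apply: H.
  by rewrite ltr_pwDr// le_max lexx.
have ab2 := a_ltW ab1 (ltW hb12).
have [x /andP[]] : exists2 x, x \in `[b1, b2] & v' x = y.
  apply: IVT; first exact: ltW.
    apply: continuous_in_subspaceT => x /set_mem /=; rewrite in_itv/= => /andP[bx _].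
    exact: (A1_continuous hA1 (a_ltW ab1 bx)).
  by rewrite ge_min le_max hb1 (ltW hb2) orbT.
by rewrite bnd_simp => bx _ xy; exists x; split => //; exact: a_ltW ab1 bx.
Qed.

Lemma inv_marginal_a (y : R) : 0 < y -> (a < (II y)%:E)%E.
Proof. by move=> /inv_marginalP[]. Qed.

Lemma lt_inv_marginal (y c : R) : 0 < y -> (a < c%:E)%E -> (c < II y) = (y < v' c).
Proof.
move=> y0 ac; have [aI vI] := inv_marginalP y0.
apply/idP/idP => [/(v'_decr ac)|]; first by rewrite vI.
rewrite ltNge => H; rewrite ltNge; apply: contra H => H.
rewrite -vI; have [->//|n] := eqVneq (II y) c.
by rewrite ltW// v'_decr// lt_neqAle n.
Qed.

Lemma inv_marginal_gt (y c : R) : 0 < y -> (a < c%:E)%E -> (II y < c) = (v' c < y).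
Proof.
move=> y0 ac; have [aI vI] := inv_marginalP y0.
apply/idP/idP => [/(v'_decr aI)|]; first by rewrite vI.
rewrite ltNge => H; rewrite ltNge; apply: contra H => H.
rewrite -vI; have [->//|n] := eqVneq (II y) c.
by rewrite ltW// v'_decr// lt_neqAle eq_sym n.
Qed.

Lemma Phi_ub (x y : R) : (u x - (x * y)%:E <= Phi u y)%E.
Proof. by apply: ereal_sup_ubound; exists x. Qed.

Lemma Phi_ub_fin (x y : R) : (a < x%:E)%E -> ((v x - x * y)%:E <= Phi u y)%E.
Proof. by move=> ax; rewrite (le_trans _ (Phi_ub x y))// (ufinE ax). Qed.

Lemma Phi_ge (y : R) : ((v 0)%:E <= Phi u y)%E.
Proof. by rewrite (le_trans _ (Phi_ub_fin y a_lt0))// mul0r subr0. Qed.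

Lemma Phi_gtNy (y : R) : (-oo < Phi u y)%E.
Proof. by rewrite (lt_le_trans _ (Phi_ge y))// ltNyr. Qed.

(** Extends the tangent inequality to [x = a], where [u] may be finite and jump: the midpoint with
    [II y] is inside the domain, and concavity carries the bound back to [x]. *)
Lemma v_le_tangent (x y : R) : 0 < y -> (-oo < u x)%E ->
  v x <= v (II y) + y * (x - II y).
Proof.
move=> y0 ux; have [aI vI] := inv_marginalP y0.
have [ax|xa] := ltP a x%:E; first by have := v_tangent aI ax; rewrite vI.
have uI : (-oo < u (II y))%E by exact: (util_dom hu).
have [] := @v_conc x (II y) (2^-1) ux uI; first by apply/andP; split; lra.
set z := _ + _ * II y.
have az : (a < z%:E)%E by apply: a_leW (gtNy_le_a ux) _; rewrite /z;
  have := le_lt_trans xa aI; rewrite lte_fin; lra.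
by have := v_tangent aI az; rewrite vI /z; nra.
Qed.

Lemma v_lt_tangent (x y : R) : 0 < y -> (-oo < u x)%E -> x != II y ->
  v x < v (II y) + y * (x - II y).
Proof.
move=> y0 ux xI; have [aI vI] := inv_marginalP y0.
have uI : (-oo < u (II y))%E by exact: (util_dom hu).
have [] := @v_conc x (II y) (2^-1) ux uI; first by apply/andP; split; lra.
set z := _ + _ * II y => uz Hz.
have zI : II y != z.
  rewrite -subr_eq0 (_ : II y - z = (II y - x) / 2); last by rewrite /z; field.
  by rewrite mulf_neq0// ?subr_eq0 1?eq_sym// invr_eq0 pnatr_eq0.
have [az|za] := ltP a z%:E.
  by have := v_tangent_lt aI az zI; rewrite vI; rewrite /z in Hz *; nra.
have zIl : z < II y by rewrite -lte_fin (le_lt_trans za).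
have xz : x < z by move: zIl; rewrite /z; lra.
by have := a_leW (gtNy_le_a ux) xz; rewrite ltNge za.
Qed.

Lemma PhiE (y : R) : 0 < y -> Phi u y = (v (II y) - II y * y)%:E.
Proof.
move=> y0; have [aI vI] := inv_marginalP y0.
apply/eqP; rewrite eq_le Phi_ub_fin// andbT.
apply: ge_ereal_sup => _ [x _ <-].
have [ux|] := boolP (-oo < u x)%E; last first.
  by rewrite ltNye negbK => /eqP ->; rewrite leNye.
rewrite (ufinE_gtNy ux) -EFinB lee_fin.
have := v_le_tangent y0 ux; lra.
Qed.

Definition phi (y : R) : R := fine (Phi u y).

Lemma phiE (y : R) : 0 < y -> phi y = v (II y) - II y * y.
Proof. by move=> y0; rewrite /phi PhiE. Qed.

Lemma PhiEfin (y : R) : (Phi u y < +oo)%E -> Phi u y = (phi y)%:E.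
Proof. by move=> h; rewrite /phi fineK// fin_numE -ltNye Phi_gtNy -ltey h. Qed.

Lemma phi_subgrad (y1 y2 : R) : 0 < y2 -> (Phi u y1 < +oo)%E ->
  phi y2 - II y2 * (y1 - y2) <= phi y1.
Proof.
move=> y20 y1f; rewrite phiE//.
have := Phi_ub_fin y1 (inv_marginal_a y20); rewrite (PhiEfin y1f) lee_fin; lra.
Qed.

Lemma Phi_fin (y : R) : 0 < y -> (Phi u y < +oo)%E.
Proof. by move=> y0; rewrite PhiE// ltry. Qed.

(** The subgradient inequalities at [y] and at [y + h] trap the error between 0 and
    [(II y - II (y + h)) * h]. Differentiability thus amounts to continuity of [II], which is read
    off the strict monotonicity of [v']. *)
Lemma phi_increment (y : R) : 0 < y -> forall e : R, 0 < e -> exists2 d : R, 0 < d &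
  forall h, `|h| < d -> `|phi (y + h) - phi y - - II y * h| <= e * `|h|.
Proof.
move=> y0 e e0.
have [aI vI] := inv_marginalP y0.
(* The point [II y - e] may leave the domain if [a] is finite, hence the maximum with the midpoint
   of [a] and [II y]. *)
have [c1 [c1I ac1 c1e]] : exists c1, [/\ c1 < II y, (a < c1%:E)%E & II y - e <= c1].
  case: (a) aI => [r||] //; last first.
    by exists (II y - e); split; [lra|exact: ltNyr|lra].
  rewrite lte_fin => rI; exists (Num.max ((r + II y) / 2) (II y - e)); split.
  - by rewrite gt_max; apply/andP; split; lra.
  - by rewrite lte_fin lt_max; apply/orP; left; lra.
  - by rewrite le_max lexx orbT.
have c2I : II y < II y + e by lra.
have ac2 := a_ltW aI (ltW c2I).
have h1 : y < v' c1 by rewrite -lt_inv_marginal.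
have h2 : v' (II y + e) < y by rewrite -inv_marginal_gt.
exists (Num.min y (Num.min (v' c1 - y) (y - v' (II y + e)))) => [|h].
  by rewrite !lt_min y0 !subr_gt0 h1 h2.
rewrite !lt_min => /and3P[]; rewrite !ltr_norml => /andP[l1 r1] /andP[l2 r2] /andP[l3 r3].
have yh0 : 0 < y + h by lra.
have := phi_subgrad y0 (Phi_fin yh0).
have := phi_subgrad yh0 (Phi_fin y0).
have b1 : c1 < II (y + h) by rewrite lt_inv_marginal//; lra.
have b2 : II (y + h) < II y + e by rewrite inv_marginal_gt//; lra.
have -> : y - (y + h) = - h by ring.
have -> : y + h - y = h by ring.
rewrite mulNr mulrN !opprK => H1 H2.
have H3 : 0 <= phi (y + h) - phi y + II y * h by lra.
rewrite (ger0_norm H3).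
apply: (@le_trans _ _ ((II y - II (y + h)) * h)); first by rewrite mulrBl; lra.
rewrite (le_trans (ler_norm _))// normrM ler_wpM2r// ler_norml.
by apply/andP; split; lra.
Qed.

Lemma phi_derive (y : R) : 0 < y -> derive1 phi y = - II y.
Proof. by move=> y0; apply: increment_derive1; exact: phi_increment. Qed.

Lemma dPhiE (y : R) : 0 < y -> (- dPhi u y)%E = (II y)%:E.
Proof.
move=> y0; have -> : dPhi u y = (- II y)%:E; last by rewrite -EFinN opprK.
by rewrite /dPhi leNgt y0 /=; congr EFin; exact: phi_derive.
Qed.

Lemma dPhiE0 (y : R) : y <= 0 -> (- dPhi u y)%E = +oo%E.
Proof. by move=> y0; rewrite /dPhi y0. Qed.

Lemma uinftyE : uinfty u = ereal_sup (range u).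
Proof.
by apply: cvg_lim => //; apply: nondecreasing_cvge => x y; exact: (util_homo hu).
Qed.

Lemma u_le_uinfty (x : R) : (u x <= uinfty u)%E.
Proof. by rewrite uinftyE; apply: ereal_sup_ubound; exists x. Qed.

Lemma u_lt_uinfty (x : R) : (u x < uinfty u)%E.
Proof.
set y := Num.max x 1.
have ay : (a < y%:E)%E by apply: a_ltW a_lt0 _; rewrite le_max ler01 orbT.
have xy : x <= y by rewrite le_max lexx.
apply: (le_lt_trans (util_homo hu xy)).
apply: (lt_le_trans _ (u_le_uinfty (y + 1))).
by apply: (A1_mono hA1) => //; lra.
Qed.

Lemma Phi0 : Phi u 0 = uinfty u.
Proof.
rewrite uinftyE /Phi; congr ereal_sup; apply: eq_imagel => x _.
by rewrite mulr0 sube0.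
Qed.

Lemma inv_marginal_large (M : R) : exists2 d, 0 < d & forall y, 0 < y -> y < d -> M <= II y.
Proof.
set c := Num.max M 1.
have ac : (a < c%:E)%E by apply: a_ltW a_lt0 _; rewrite le_max ler01 orbT.
exists (v' c) => [|y y0 yc]; first exact: v'_gt0.
have : c < II y by rewrite lt_inv_marginal.
by move=> /ltW; apply: le_trans; rewrite le_max lexx.
Qed.

Lemma phi_conv (y1 y2 t : R) : 0 <= t <= 1 ->
  (Phi u y1 < +oo)%E -> (Phi u y2 < +oo)%E ->
  (Phi u (t * y1 + (1 - t) * y2) <= (t * phi y1 + (1 - t) * phi y2)%:E)%E.
Proof.
move=> /andP[t0 t1] f1 f2; apply: ge_ereal_sup => _ [x _ <-].
have [ux|] := boolP (-oo < u x)%E; last first.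
  by rewrite ltNye negbK => /eqP ->; rewrite leNye.
have := Phi_ub x y1; have := Phi_ub x y2.
rewrite (ufinE_gtNy ux) (PhiEfin f1) (PhiEfin f2) -!EFinB !lee_fin; nra.
Qed.

(* The right-hand side [- dPhi y * D] is [+oo] when [y = 0 < D] and [0] when [y = D = 0]. *)
Lemma phi_quotient (y D M : R) : 0 <= y -> 0 <= y + D ->
  (Phi u y < +oo)%E -> (Phi u (y + D) < +oo)%E ->
  (M%:E < (- dPhi u y) * D%:E)%E ->
  exists2 d, 0 < d & forall t, 0 < t -> t < d -> M <= (phi y - phi (y + t * D)) / t.
Proof.
move=> y0 yD0 f1 f2.
have [yE|yn0] := eqVneq y 0.
  move: yD0 f1 f2; rewrite yE add0r => D0 f1 f2.
  have [DE|Dn0] := eqVneq D 0.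
    rewrite DE mule0 lte_fin => M0; exists 1 => // t t0 _.
    by rewrite mulr0 addr0 subrr mul0r ltW.
  have {Dn0 D0} D0 : 0 < D by rewrite lt_neqAle eq_sym Dn0.
  have [d d0 Hd] := inv_marginal_large (M / D).
  exists (d / D); rewrite ?divr_gt0// => t t0 td.
  have tD0 : 0 < t * D by rewrite mulr_gt0.
  have := Hd (t * D) tD0; rewrite -ltr_pdivlMr// => /(_ td); rewrite ler_pdivrMr// => H3.
  have := phi_subgrad tD0 f1; rewrite add0r mulrN opprK => H2.
  by rewrite add0r ler_pdivlMr//; nra.
have {yn0 y0} y0 : 0 < y by rewrite lt_neqAle eq_sym yn0.
rewrite dPhiE// -EFinM lte_fin => MD.
set e := (II y * D - M) / (`|D| + 1).
have D1 : 0 < `|D| + 1 by rewrite ltr_wpDl.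
have e0 : 0 < e by rewrite divr_gt0// subr_gt0.
have [d d0 Hd] := phi_increment y0 e0.
exists (d / (`|D| + 1)) => [|t t0]; first by rewrite divr_gt0.
rewrite ltr_pdivlMr// => td.
have tDd : `|t * D| < d.
  by rewrite normrM (gtr0_norm t0) (le_lt_trans _ td)// ler_pM2l// lerDl.
have := Hd _ tDd; rewrite normrM (gtr0_norm t0) ler_norml => /andP[_ H].
rewrite ler_pdivlMr//.
have : e * `|D| <= II y * D - M.
  rewrite /e mulrAC ler_pdivrMr// ler_pM2l ?subr_gt0// lerDl//.
nra.
Qed.

Lemma Fenchel_eq (y : R) : 0 < y -> v (II y) = phi y + II y * y.
Proof. by move=> y0; rewrite phiE// subrK. Qed.

Lemma Fenchel_eq_unique (x y : R) : 0 < y -> (phi y + x * y)%:E = u x -> x = II y.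
Proof.
move=> y0 E; apply/eqP/negPn/negP => xI.
have ux : (-oo < u x)%E by rewrite -E ltNyr.
have := v_lt_tangent y0 ux xI.
move: E; rewrite (ufinE_gtNy ux) => -[<-]; rewrite phiE//; lra.
Qed.

Lemma measurable_u : measurable_fun setT u.
Proof.
apply: (measurability _ (ErealGenOInfty.measurableE R)) => //.
move=> /= _ [_ [c ->]] <-; apply: measurableI => //.
apply: is_interval_measurable => x y /=; rewrite !in_itv/= !andbT => cx cy z /andP[xz zy].
by rewrite in_itv/= andbT (lt_le_trans cx)// (util_homo hu).
Qed.

Lemma measurable_dPhi : measurable_fun setT (fun y => - dPhi u y)%E.
Proof.
apply: (measurability _ (ErealGenOInfty.measurableE R)) => //.
move=> /= _ [_ [c ->]] <-; apply: measurableI => //.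
have [ac|ca] := ltP a c%:E.
  rewrite (_ : _ @^-1` _ = `]-oo, (v' c)[%classic); first exact: measurable_itv.
  apply/seteqP; split => y /=; rewrite !in_itv/= ?andbT.
    have [y0|y0] := leP y 0; first by rewrite dPhiE0// => _; apply: (le_lt_trans y0); exact: v'_gt0.
    by rewrite dPhiE// lte_fin lt_inv_marginal.
  have [y0|y0] := leP y 0; first by rewrite dPhiE0// ltry.
  by rewrite dPhiE// lte_fin lt_inv_marginal.
rewrite (_ : _ @^-1` _ = setT); first exact: measurableT.
apply/seteqP; split => y //= _; rewrite in_itv/= andbT.
have [y0|y0] := leP y 0; first by rewrite dPhiE0// ltry.
by rewrite dPhiE// (le_lt_trans ca)//; exact: inv_marginal_a.
Qed.

(* [sel n y] maximizes [u x - x * y] over [x] among [0, q 0, ..., q (n - 1)]. *)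
Section Selection.
Variable q : nat -> R.
Hypothesis aq : forall n, (a < (q n)%:E)%E.

Fixpoint sel n y : R :=
  if n is n'.+1 then
    if v (sel n' y) - sel n' y * y < v (q n') - q n' * y then q n' else sel n' y
  else 0.

Lemma sel_a n y : (a < (sel n y)%:E)%E.
Proof. by elim: n => [|n IH] /=; [exact: a_lt0|case: ifP]. Qed.

Lemma sel_homo n y :
  v (sel n y) - sel n y * y <= v (sel n.+1 y) - sel n.+1 y * y.
Proof. by rewrite /=; case: ifPn => [/ltW//|_]. Qed.

Lemma sel_homo_le m n y : (m <= n)%N ->
  v (sel m y) - sel m y * y <= v (sel n y) - sel n y * y.
Proof.
move=> /subnK <-; elim: (n - m)%N => [|k IH]; first by rewrite add0n.
by rewrite addSn (le_trans IH)// sel_homo.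
Qed.

Lemma sel_ge n y : v (q n) - q n * y <= v (sel n.+1 y) - sel n.+1 y * y.
Proof. by rewrite /=; case: ifPn => [//|]; rewrite -leNgt. Qed.

(** Composed with any measurable density, [sel n] is therefore bounded, hence in the Orlicz space,
    and so is its utility. *)
Lemma sel_bounded n : exists B : R, forall y, `|sel n y| <= B /\ `|v (sel n y)| <= B.
Proof.
elim: n => [|n [B HB]] /=.
  by exists `|v 0| => y; rewrite normr0 lexx normr_ge0.
exists (Num.max B (Num.max `|q n| `|v (q n)|)) => y.
have [b1 b2] := HB y.
by case: ifP => _; rewrite !le_max ?b1 ?b2 ?lexx ?orbT.
Qed.

Lemma measurable_sel n :
  measurable_fun setT (sel n) /\ measurable_fun setT (v \o sel n).
Proof.
elim: n => [|n [m1 m2]]; first by split; [exact: (@measurable_cst _ _ _ _ setT (0 : R))|exact: (@measurable_cst _ _ _ _ setT (v 0 : R))].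
have mb : measurable_fun setT (fun y : R =>
    v (sel n y) - sel n y * y < v (q n) - q n * y).
  by apply: measurable_fun_ltr; apply: measurable_funB => //; apply: measurable_funM.
split; first exact: measurable_fun_ifT.
rewrite (_ : _ \o _ = fun y => if v (sel n y) - sel n y * y < v (q n) - q n * y
    then v (q n) else v (sel n y)); first exact: measurable_fun_ifT.
by apply/funext => y /=; case: ifP.
Qed.

(** The limit [A] is abstract because it is [Phi] for one enumeration and [hatPhi + v 0] for
    another. *)
Lemma sel_cvg (A : R -> \bar R) y :
  (forall n, (v (sel n y) - sel n y * y)%:E <= A y)%E ->
  (forall M : R, (M%:E < A y)%E -> exists n, M < v (q n) - q n * y) ->
  (v (sel n y) - sel n y * y)%:E @[n --> \oo] --> A y.
Proof.
move=> ub HA.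
have -> : A y = ereal_sup (range (fun n => (v (sel n y) - sel n y * y)%:E)).
  apply/eqP; rewrite eq_le; apply/andP; split; last first.
    by apply: ge_ereal_sup => _ [n _ <-].
  rewrite leNgt; apply/negP => H.
  set s := ereal_sup _ in H.
  have s0 : ((v (sel 0 y) - sel 0 y * y)%:E <= s)%E.
    by apply: ereal_sup_ubound; exists 0%N.
  case sE : s => [r||]; [rewrite sE in H|by move: H; rewrite sE ltNge leey|by move: s0; rewrite sE].
  have [n Hn] := HA _ H.
  have : ((v (sel n.+1 y) - sel n.+1 y * y)%:E <= s)%E.
    by apply: ereal_sup_ubound; exists n.+1.
  by rewrite sE lee_fin leNgt (lt_le_trans Hn (sel_ge n y)).
apply: ereal_nondecreasing_cvgn => m n mn; rewrite lee_fin; exact: sel_homo_le.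
Qed.

End Selection.

(** The filler 0 lies in the domain because [a < 0], and it satisfies both predicates [Q] in use. *)
Definition rat_seq (Q : R -> Prop) (n : nat) : R :=
  if unpickle n is Some r then
    if `[< (a < (ratr r : R)%:E)%E /\ Q (ratr r) >] then ratr r else 0
  else 0.

Lemma rat_seq_a Q n : (a < (rat_seq Q n)%:E)%E.
Proof.
rewrite /rat_seq; case: unpickle => [r|]; last exact: a_lt0.
by case: asboolP => [[]//|_]; exact: a_lt0.
Qed.

Lemma rat_seqP (Q : R -> Prop) (r : rat) : (a < (ratr r : R)%:E)%E -> Q (ratr r) ->
  exists n, rat_seq Q n = ratr r.
Proof.
move=> ar Qr; exists (pickle r); rewrite /rat_seq pickleK.
by case: asboolP => // -[].
Qed.

Lemma rat_seq_in (Q : R -> Prop) n : Q 0 -> Q (rat_seq Q n).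
Proof.
by move=> Q0; rewrite /rat_seq; case: unpickle => [r|]//; case: asboolP => // -[].
Qed.

Definition qPhi := rat_seq (fun _ => True).

Lemma qPhi_a n : (a < (qPhi n)%:E)%E. Proof. exact: rat_seq_a. Qed.

(** The rational is sought to the right of [x]: there [u] does not decrease, whether or not it is
    continuous at [x], and only the linear term has to be controlled. *)
Lemma rat_right (x y M : R) : (M%:E < u x - (x * y)%:E)%E ->
  forall b, x < b -> exists r : rat, [/\ x < ratr r, ratr r < b,
    (a < (ratr r : R)%:E)%E & M < v (ratr r) - ratr r * y].
Proof.
move=> H b xb.
have ux : (-oo < u x)%E.
  rewrite ltNye; apply/negP => /eqP ux; move: H; rewrite ux.
  by rewrite addNye.
move: H; rewrite (ufinE_gtNy ux) -EFinB lte_fin => H.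
set e := (v x - x * y - M) / (2 * (`|y| + 1)).
have y1 : 0 < `|y| + 1 by rewrite ltr_wpDl.
have e0 : 0 < e by rewrite divr_gt0 ?mulr_gt0// subr_gt0.
have xb' : x < Num.min b (x + e) by rewrite lt_min xb/=; lra.
have [r] := rat_in_itvoo xb'.
rewrite in_itv/= lt_min => /and3P[xr rb re].
exists r; have ar := a_leW (gtNy_le_a ux) xr; split => //.
have vr : v x <= v (ratr r).
  have : (u x <= u (ratr r))%E by apply: (util_homo hu); exact: ltW.
  by rewrite (ufinE_gtNy ux) (ufinE ar) lee_fin.
have E : e * (`|y| + 1) = (v x - x * y - M) / 2 by rewrite /e; field; rewrite gt_eqF.
have h : (ratr r - x) * y <= e * (`|y| + 1).
  rewrite (le_trans (ler_norm _))// normrM ler_pM//; last lra.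
  by rewrite gtr0_norm ?subr_gt0//; lra.
nra.
Qed.

Lemma Phi_sel_cvg y :
  (v (sel qPhi n y) - sel qPhi n y * y)%:E @[n --> \oo] --> Phi u y.
Proof.
apply: (sel_cvg (A := Phi u)) => [n|M MA].
  by rewrite Phi_ub_fin// sel_a//; exact: qPhi_a.
have [_ [x _ <-] xM] := ereal_sup_gt MA.
have xx1 : x < x + 1 by lra.
have [r [_ _ ar Mr]] := rat_right xM xx1.
by have [n nE] := rat_seqP (Q := fun _ => True) ar I; exists n; rewrite /qPhi nE.
Qed.

Lemma measurable_sel_val q n : measurable_fun setT (fun y => (v (sel q n y) - sel q n y * y)%:E).
Proof.
have [m1 m2] := measurable_sel q n.
by apply/measurable_EFinP; apply: measurable_funB => //; apply: measurable_funM.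
Qed.

Lemma measurable_Phi : measurable_fun setT (Phi u).
Proof.
apply: (emeasurable_fun_cvg _ _ (fun n => measurable_sel_val qPhi n)) => y _.
exact: Phi_sel_cvg.
Qed.

Definition qhatPhi := rat_seq (fun r => r <= 0).

Lemma qhatPhi_a n : (a < (qhatPhi n)%:E)%E. Proof. exact: rat_seq_a. Qed.

Lemma qhatPhi_le0 n : qhatPhi n <= 0. Proof. exact: (rat_seq_in (Q := fun r => r <= 0)). Qed.

Lemma sel_le0 n y : sel qhatPhi n y <= 0.
Proof. by elim: n => [|n IH] //=; case: ifP => // _; exact: qhatPhi_le0. Qed.

(** For [y >= 0], [hatPhi y + v 0] is the supremum of [u x - x * y] over [x <= 0]: the problem that
    defines [Phi], restricted to nonpositive points. *)
Lemma hatPhi_sel_cvg y : 0 <= y ->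
  (v (sel qhatPhi n y) - sel qhatPhi n y * y)%:E @[n --> \oo] --> (hatPhi u y + (v 0)%:E)%E.
Proof.
move=> y0; apply: (sel_cvg (A := fun y => hatPhi u y + (v 0)%:E)%E) => [n|M].
  set s := sel _ _ _.
  have as_ : (a < s%:E)%E by rewrite sel_a//; exact: qhatPhi_a.
  rewrite -leeBlDr// -EFinB; apply: ereal_sup_ubound; exists (- s) => //.
  rewrite hatu_fin normrN ler0_norm ?sel_le0// ?opprK//.
  by rewrite -EFinB; congr EFin; ring.
rewrite -lteBlDr// -EFinB => MA.
have [_ [x _ <-] xM] := ereal_sup_gt MA.
have [ux|] := boolP (-oo < u (- `|x|))%E; last first.
  by move=> ux; move: xM; rewrite (hatuE_y ux).
move: xM; rewrite (hatuE_fin ux) -EFinB lte_fin => H.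
(* At 0 there is no room on the right among nonpositive numbers, but 0 itself is enumerated. *)
have [x0|x0] := eqVneq x 0.
  have [n nE] := @rat_seqP (fun r => r <= 0) 0 ltac:(by rewrite rmorph0; exact: a_lt0) ltac:(by rewrite rmorph0).
  exists n; rewrite /qhatPhi nE rmorph0; move: H; rewrite x0 normr0 oppr0; lra.
have H' : (M%:E < u (- `|x|) - (- `|x| * y)%:E)%E.
  rewrite (ufinE_gtNy ux) -EFinB lte_fin.
  have : x * y <= `|x| * y by rewrite ler_wpM2r// ler_norm.
  lra.
have xl0 : - `|x| < 0 by rewrite oppr_lt0 normr_gt0.
have [r [_ r0 ar Mr]] := rat_right H' xl0.
by have [n nE] := @rat_seqP (fun r => r <= 0) r ar (ltW r0); exists n; rewrite /qhatPhi nE.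
Qed.

End UtilityFacts.

(** * Lower limits of extended real sequences *)

Section LimitInferior.
Context {R : realType}.
Implicit Types (x : nat -> \bar R) (M : \bar R).

Lemma limn_einfE x : limn_einf x = ereal_sup (range (einfs x)).
Proof. by rewrite limn_einf_lim; apply: cvg_lim => //; exact: cvg_einfs_sup. Qed.

Lemma limn_einf_le x M : (forall n, x n <= M)%E -> (limn_einf x <= M)%E.
Proof.
move=> xM; rewrite limn_einfE; apply: ge_ereal_sup => _ [n _ <-].
by apply: le_trans (xM n); apply: ereal_inf_lbound; exists n => /=.
Qed.

Lemma le_limn_einf x M : (exists N, forall n, (N <= n)%N -> M <= x n)%E ->
  (M <= limn_einf x)%E.
Proof.
move=> [N HN]; rewrite limn_einfE.
apply: (@le_trans _ _ (einfs x N)); last by apply: ereal_sup_ubound; exists N.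
by apply: le_ereal_inf_tmp => _ [n /= Nn <-]; exact: HN.
Qed.

Lemma ex_lt_between (p q : \bar R) : (p < q)%E -> exists M : R, (p < M%:E < q)%E.
Proof.
case: p q => [p||] [q||] //=.
- rewrite lte_fin => pq; exists ((p + q) / 2); rewrite !lte_fin; apply/andP; split; lra.
- by move=> _; exists (p + 1); rewrite ltry lte_fin; apply/andP; split=> //; lra.
- by move=> _; exists (q - 1); rewrite ltNyr lte_fin /=; lra.
- by move=> _; exists 0; rewrite ltNyr ltry.
Qed.

End LimitInferior.

(** * Expectations under almost sure hypotheses, vanishing events and Fatou's lemma *)

Section Expectation.
Context {R : realType} {dd : measure_display} {Omega : measurableType dd}.
Variable P : probability Omega R.

Local Notation LI f := (P.-integrable setT (EFin \o f)).

Lemma ae_mono (A B : Omega -> Prop) : (forall w, A w -> B w) ->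
  {ae P, forall w, A w} -> {ae P, forall w, B w}.
Proof. by move=> AB; apply: filterS. Qed.

Lemma ae_mono2 (A B C : Omega -> Prop) : (forall w, A w -> B w -> C w) ->
  {ae P, forall w, A w} -> {ae P, forall w, B w} -> {ae P, forall w, C w}.
Proof. by move=> ABC; apply: filterS2. Qed.

Lemma ae_all (A : Omega -> Prop) : (forall w, A w) -> {ae P, forall w, A w}.
Proof. by move=> h; apply: filterS filterT => w _. Qed.

Lemma int_meas (f : Omega -> R) : LI f -> measurable_fun setT f.
Proof. by move=> /measurable_int /measurable_EFinP. Qed.

Lemma int_dom (f g : Omega -> R) : measurable_fun setT f ->
  {ae P, forall w, `|f w| <= g w} -> LI g -> LI f.
Proof.
move=> mf fg ig; apply/integrableP; split; first exact/measurable_EFinP.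
have /integrableP[mg] := ig; apply: le_lt_trans.
apply: ae_ge0_le_integral => //.
- by apply/measurable_EFinP; exact: measurableT_comp.
- by apply/measurableT_comp.
- apply: ae_mono fg => w fg _ /=; rewrite lee_fin.
  by rewrite (le_trans fg)// ler_norm.
Qed.

Lemma int_D (f g : Omega -> R) : LI f -> LI g -> LI (fun w => f w + g w).
Proof. by move=> i1 i2; exact: (integrableD measurableT i1 i2). Qed.

Lemma int_Z (c : R) (f : Omega -> R) : LI f -> LI (fun w => c * f w).
Proof. by move=> i1; exact: (integrableZl measurableT c i1). Qed.

Lemma int_N (f : Omega -> R) : LI f -> LI (fun w => - f w).
Proof.
move=> /(int_Z (-1)); congr (_.-integrable _ _).
by apply/funext => w /=; rewrite mulN1r.
Qed.

Lemma int_B (f g : Omega -> R) : LI f -> LI g -> LI (fun w => f w - g w).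
Proof. by move=> i1 /int_N; exact: int_D. Qed.

Lemma int_cst (c : R) : LI (fun=> c).
Proof. by apply: finite_measure_integrable_cst. Qed.

Lemma int_abs (f : Omega -> R) : LI f -> LI (fun w => `|f w|).
Proof. exact: integrable_norm. Qed.

Lemma int_ae (f g : Omega -> R) : measurable_fun setT g ->
  {ae P, forall w, f w = g w} -> LI f -> LI g.
Proof.
move=> mg fg i; apply: (int_dom mg (g := fun w => `|f w|)); last exact: int_abs.
by apply: ae_mono fg => w ->.
Qed.

Lemma int_ind (f : Omega -> R) (A : set Omega) : measurable A -> LI f ->
  LI (fun w => f w * \1_A w).
Proof.
move=> mA i; apply: (int_dom (g := fun w => `|f w|)); last exact: int_abs.
  by apply: measurable_funM; [exact: int_meas|exact: measurable_indic].
apply: ae_all => w; rewrite normrM ler_piMr// indicE.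
by case: (_ \in _); rewrite ?normr1 ?normr0.
Qed.

Lemma exp_D (f g : Omega -> R) : LI f -> LI g ->
  \int[P]_w (f w + g w) = \int[P]_w f w + \int[P]_w g w.
Proof. by move=> i1 i2; apply: RintegralD. Qed.

Lemma exp_B (f g : Omega -> R) : LI f -> LI g ->
  \int[P]_w (f w - g w) = \int[P]_w f w - \int[P]_w g w.
Proof. by move=> i1 i2; apply: RintegralB. Qed.

Lemma exp_Z (c : R) (f : Omega -> R) : LI f ->
  \int[P]_w (c * f w) = c * \int[P]_w f w.
Proof. by move=> i1; apply: RintegralZl. Qed.

Lemma exp_cst (c : R) : \int[P]_w c = c.
Proof.
by rewrite Rintegral_cst// [X in fine X](_ : _ = 1%E) ?mulr1//; exact: probability_setT.
Qed.

Lemma exp_ae (f g : Omega -> R) : measurable_fun setT f -> measurable_fun setT g ->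
  {ae P, forall w, f w = g w} -> \int[P]_w f w = \int[P]_w g w.
Proof.
move=> mf mg fg; congr fine; apply: ae_eq_integral => //.
- exact/measurable_EFinP.
- exact/measurable_EFinP.
- by apply: ae_mono fg => w -> _.
Qed.

Lemma exp_le (f g : Omega -> R) : LI f -> LI g ->
  {ae P, forall w, f w <= g w} -> \int[P]_w f w <= \int[P]_w g w.
Proof.
move=> i1 i2 fg; pose g' w : R := Num.max (f w) (g w).
have mg' : measurable_fun setT g' by apply: measurable_maxr; exact: int_meas.
have gg' : {ae P, forall w, g w = g' w} by apply: ae_mono fg => w h; rewrite /g' max_r.
have i3 : LI g' by exact: int_ae gg' i2.
rewrite (exp_ae (int_meas i2) mg' gg'); apply: le_Rintegral => // w _.
by rewrite le_max lexx.
Qed.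

Lemma exp_ge0 (f : Omega -> R) : LI f ->
  {ae P, forall w, 0 <= f w} -> 0 <= \int[P]_w f w.
Proof.
by move=> i1 f0; rewrite -[leLHS](exp_cst 0); apply: exp_le => //; exact: int_cst.
Qed.

Lemma exp_fin (f : Omega -> R) : LI f -> (\int[P]_w (f w)%:E)%E = (\int[P]_w f w)%:E.
Proof. by move=> i1; rewrite fineK//; exact: (integrable_fin_num measurableT i1). Qed.

Lemma exp_eq0 (f : Omega -> R) : LI f -> {ae P, forall w, 0 <= f w} ->
  \int[P]_w f w <= 0 -> {ae P, forall w, f w = 0}.
Proof.
move=> i1 f0 E0.
have mf := int_meas i1.
have mf' : measurable_fun setT (EFin \o f) by exact/measurable_EFinP.
have : (\int[P]_w `|(EFin \o f) w| = 0)%E.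
  have -> : (\int[P]_w `|(EFin \o f) w| = \int[P]_w (f w)%:E)%E.
    apply: ae_eq_integral => //; first by apply/measurableT_comp.
    by apply: ae_mono f0 => w h _ /=; rewrite ger0_norm.
  rewrite (exp_fin i1); congr EFin; apply/eqP; rewrite eq_le E0/=.
  exact: exp_ge0.
move/(ae_eq_integral_abs P measurableT mf'); apply: ae_mono => w /(_ I) /= [].
by [].
Qed.

Definition vanishing (A : nat -> set Omega) :=
  [/\ forall n, measurable (A n), forall m n, (m <= n)%N -> A n `<=` A m &
      {ae P, forall w, exists n, ~ A n w}].

Lemma vanishing_tail (A : nat -> set Omega) (f : Omega -> R) :
  vanishing A -> LI f -> forall e : R, 0 < e ->
  exists N, forall n, (N <= n)%N -> `|\int[P]_w (f w * \1_(A n) w)| < e.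
Proof.
move=> [mA dA A0] i e e0.
have mi n : measurable_fun setT (fun w => (f w * \1_(A n) w)%:E).
  by apply/measurable_EFinP; exact: int_meas (int_ind (mA n) i).
have [_ _ H] := @dominated_convergence _ _ _ P setT measurableT
  (fun n w => (f w * \1_(A n) w)%:E) (cst 0%E) (fun w => `|f w|%:E) mi
  ltac:(exact: measurable_cst)
  ltac:(apply: ae_mono A0 => w [n nA] _; apply: cvg_near_cst; exists n => // m /= nm;
    rewrite indicE memNset ?mulr0// => /(dA _ _ nm)//)
  (int_abs i)
  ltac:(apply: ae_all => w n _; rewrite lee_fin normrM ler_piMr// indicE;
    case: (_ \in _); rewrite ?normr1 ?normr0//).
move: H; rewrite integral0 => /fine_cvgP[_ /cvgrPdist_lt/(_ e e0)[N _ HN]].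
exists N => n Nn; have := HN n Nn.
by rewrite sub0r normrN.
Qed.

(** The lower limit is expressed by real thresholds [M], so [F] may be infinite and the [h n] need
    not converge. Their signs are only almost sure, so the proof works with the absolute values. *)
Lemma exp_fatou (h : nat -> Omega -> R) (F : Omega -> \bar R) (C : R) :
  (forall n, LI (h n)) -> (forall n, {ae P, forall w, 0 <= h n w}) ->
  measurable_fun setT F -> (forall w, 0 <= F w)%E ->
  (forall n, \int[P]_w h n w <= C) ->
  {ae P, forall w, forall M : R, (M%:E < F w)%E -> exists N, forall n, (N <= n)%N -> M <= h n w} ->
  (\int[P]_w F w <= C%:E)%E.
Proof.
move=> ih h0 mF F0 hC hF.
pose h' n w : R := `|h n w|.
have ih' n : LI (h' n) by exact: int_abs.
have mh' n : measurable_fun setT (fun w => (h' n w)%:E) by have /measurable_int := ih' n.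
have Eh' n : (\int[P]_w (h' n w)%:E <= C%:E)%E.
  rewrite exp_fin// lee_fin (le_trans _ (hC n))//; apply: exp_le => //.
  by apply: ae_mono (h0 n) => w; rewrite /h' => /ger0_norm ->.
have := @fatou _ _ _ P setT measurableT (fun n w => (h' n w)%:E) mh' ltac:(by move=> n w _; rewrite lee_fin normr_ge0).
move=> H; apply: (@le_trans _ _ (\int[P]_w limn_einf (fun n => (h' n w)%:E))%E).
  apply: ae_ge0_le_integral => //.
  - by move=> w _; apply: le_limn_einf; exists 0%N => n _; rewrite lee_fin normr_ge0.
  - apply: measurableT_comp => //; apply: measurable_fun_limn_esup => n.
    exact: measurableT_comp.
  - have h0' : {ae P, forall w, forall n, 0 <= h n w} by exact/ae_foralln.
    apply: (ae_mono2 _ h0' hF) => w hw0 hw _.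
    rewrite leNgt; apply/negP => lt.
    have [M /andP[FM MF]] : exists M : R, (limn_einf (fun n => (h' n w)%:E) < M%:E < F w)%E.
      exact/ex_lt_between.
    have [N HN] := hw M MF.
    move: FM; rewrite ltNge => /negP; apply.
    apply: le_limn_einf; exists N => n Nn.
    by rewrite lee_fin (le_trans (HN n Nn))// ler_norm.
apply: (le_trans H); exact: limn_einf_le.
Qed.

End Expectation.

(** * The Orlicz space, its modular and its Luxemburg norm *)

Section OrliczSpace.
Context {R : realType} {dd : measure_display} {Omega : measurableType dd}.
Variables (P : probability Omega R) (u : R -> \bar R) (a : \bar R).
Hypotheses (hu : utility u a) (hA1 : A1 u a).

Local Notation L := (orlicz P (hatu u)).
Local Notation N := (luxemburg P u).
Local Notation LI f := (P.-integrable setT (EFin \o f)).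
Implicit Types f g h : Omega -> R.

Definition modular f : \bar R := (\int[P]_w hatu u (f w))%E.

Lemma measurable_hatu : measurable_fun setT (hatu u).
Proof.
rewrite /hatu; apply: emeasurable_funB; first exact: measurable_cst.
apply: (measurableT_comp (measurable_u hu)).
by apply: measurableT_comp => //; exact: normr_measurable.
Qed.

Lemma measurable_hatu_comp f : measurable_fun setT f ->
  measurable_fun setT (fun w => hatu u (f w)).
Proof. by move=> mf; exact: (measurableT_comp measurable_hatu mf). Qed.

Lemma modular_ge0 f : (0 <= modular f)%E.
Proof. by apply: integral_ge0 => w _; exact: hatu_ge0 hu _. Qed.

Lemma modular_le f g : measurable_fun setT f -> measurable_fun setT g ->
  {ae P, forall w, `|f w| <= `|g w|} -> (modular f <= modular g)%E.
Proof.
move=> mf mg fg; apply: ae_ge0_le_integral => //.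
- by move=> w _; exact: hatu_ge0 hu _.
- exact: measurable_hatu_comp.
- by move=> w _; exact: hatu_ge0 hu _.
- exact: measurable_hatu_comp.
- by apply: ae_mono fg => w h _; exact: hatu_le hu _ _ h.
Qed.

Lemma modularZ f (k : R) : 0 <= k -> measurable_fun setT f ->
  (k%:E * modular f = \int[P]_w (k%:E * hatu u (f w)))%E.
Proof.
move=> k0 mf; rewrite ge0_integralZl//; first exact: measurable_hatu_comp.
by move=> w _; exact: hatu_ge0 hu _.
Qed.

Lemma modular_scale f (t : R) : 0 <= t <= 1 -> measurable_fun setT f ->
  (modular (fun w => t * f w)%R <= t%:E * modular f)%E.
Proof.
move=> t01 mf; have /andP[t0 _] := t01; rewrite /modular -ge0_integralZl//; last 2 first.
- exact: measurable_hatu_comp.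
- by move=> w _; exact: hatu_ge0 hu _.
apply: ge0_le_integral => //.
- by move=> w _; exact: hatu_ge0 hu _.
- by apply: measurable_hatu_comp; exact: measurable_funM.
- apply: emeasurable_funM; [exact: measurable_cst|exact: measurable_hatu_comp].
- by move=> w _; exact: hatu_scale hu hA1 _ _ t01.
Qed.

Lemma orlicz_meas f : L f -> measurable_fun setT f.
Proof. by case. Qed.

Lemma orlicz_dom f g : measurable_fun setT f ->
  {ae P, forall w, `|f w| <= `|g w|} -> L g -> L f.
Proof.
move=> mf fg [mg [al al0 hal]]; split=> //; exists al => //.
apply: le_lt_trans hal; apply: (@modular_le (fun w => al * f w) (fun w => al * g w)).
- exact: measurable_funM.
- exact: measurable_funM.
- by apply: ae_mono fg => w h; rewrite !normrM ler_wpM2l.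
Qed.

Lemma orlicz_modular f : measurable_fun setT f -> (modular f < +oo)%E -> L f.
Proof.
move=> mf hf; split=> //; exists 1 => //.
by rewrite (eq_integral (fun w => hatu u (f w)))// => w _; rewrite mul1r.
Qed.

Lemma orlicz_Z (c : R) f : L f -> L (fun w => c * f w).
Proof.
move=> [mf [al al0 hal]].
have mcf : measurable_fun setT (fun w => c * f w) by exact: measurable_funM.
split=> //; exists (al / (`|c| + 1)); first by rewrite divr_gt0// ltr_wpDl.
apply: le_lt_trans hal.
apply: (@modular_le (fun w => al / (`|c| + 1) * (c * f w)) (fun w => al * f w)).
- exact: measurable_funM.
- exact: measurable_funM.
- apply: ae_all => w; rewrite !normrM mulrA ler_wpM2r// -mulrA ler_piMr//.
  rewrite ger0_norm ?invr_ge0 ?addr_ge0// mulrC ler_pdivrMr ?ltr_wpDl//.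
  by rewrite mul1r lerDl.
Qed.

Lemma orlicz_D f g : L f -> L g -> L (fun w => f w + g w).
Proof.
move=> [mf [al al0 hal]] [mg [be be0 hbe]]; split; first exact: measurable_funD.
set c := Num.min al be.
have c0 : 0 < c by rewrite lt_min al0 be0.
have ca : c <= al by rewrite ge_min lexx.
have cb : c <= be by rewrite ge_min lexx orbT.
exists (c / 2); first by rewrite divr_gt0.
have h1 : 0 < (2^-1 : R) < 1 by apply/andP; split; lra.
apply: (@le_lt_trans _ _ ((2^-1)%:E * modular (fun w => al * f w)%R +
    (1 - 2^-1)%:E * modular (fun w => be * g w)%R)%E).
  rewrite !modularZ//; [|lra|exact: measurable_funM|exact: measurable_funM].
  have m1 : measurable_fun setT (fun w => ((2^-1)%:E * hatu u (al * f w))%E).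
    by apply: emeasurable_funM => //; apply: measurable_hatu_comp; exact: measurable_funM.
  have m2 : measurable_fun setT (fun w => ((1 - 2^-1)%:E * hatu u (be * g w))%E).
    by apply: emeasurable_funM => //; apply: measurable_hatu_comp; exact: measurable_funM.
  rewrite -ge0_integralD//; last 2 first.
  - by move=> w _; rewrite mule_ge0 ?lee_fin ?invr_ge0// (hatu_ge0 hu).
  - by move=> w _; rewrite mule_ge0 ?lee_fin// ?(hatu_ge0 hu)//; lra.
  apply: ge0_le_integral => //.
  - by move=> w _; exact: hatu_ge0 hu _.
  - by apply: measurable_hatu_comp; apply: measurable_funM => //; exact: measurable_funD.
  - exact: emeasurable_funD.
  move=> w _; apply: (le_trans (hatu_le hu (y := 2^-1 * `|al * f w| + (1 - 2^-1) * `|be * g w|) _)).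
    rewrite [leRHS]ger0_norm; last by rewrite addr_ge0// mulr_ge0// ?invr_ge0//; lra.
    rewrite !normrM (gtr0_norm al0) (gtr0_norm be0) (gtr0_norm c0) (@gtr0_norm _ (2^-1)) ?invr_gt0//.
    have := ler_normD (f w) (g w).
    have := ler_wpM2r (normr_ge0 (f w)) ca.
    have := ler_wpM2r (normr_ge0 (g w)) cb.
    move=> h2 h3 /(ler_wpM2l (ltW c0)); rewrite mulrDr; lra.
  apply: (le_trans (hatu_conv hu hA1 _ _ h1)).
  by rewrite !hatu_norm.
by apply: lte_add_pinfty; apply: lte_mul_pinfty; rewrite ?lee_fin//; lra.
Qed.

Lemma orlicz_B f g : L f -> L g -> L (fun w => f w - g w).
Proof.
move=> lf /(orlicz_Z (-1)) lg; have := orlicz_D lf lg.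
by congr (orlicz _ _); apply/funext => w; rewrite mulN1r.
Qed.

Lemma orlicz_N f : L f -> L (fun w => - f w).
Proof.
by move=> /(orlicz_Z (-1)); congr (orlicz _ _); apply/funext => w; rewrite mulN1r.
Qed.

Lemma orlicz_lin (c d : R) f g : L f -> L g -> L (fun w => c * f w + d * g w).
Proof. by move=> lf lg; apply: orlicz_D; exact: orlicz_Z. Qed.

Lemma orlicz_cst (c : R) : L (fun=> c).
Proof.
have [c0 c00 ac0] := ex_a_c0 hu.
suff : L (fun=> c0).
  move=> /(orlicz_Z (c / c0)); congr (orlicz _ _); apply/funext => w.
  by rewrite divfK// gt_eqF.
apply: orlicz_modular => //.
rewrite /modular (eq_integral (cst (ufin u 0 - ufin u (- c0))%:E)); last first.
  by move=> w _; rewrite (hatu_fin hu) gtr0_norm.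
rewrite integral_cst// [X in (_ * X)%E](_ : _ = 1%E) ?mule1 ?ltry//.
exact: probability_setT.
Qed.

Lemma orlicz_abs f : L f -> L (fun w => `|f w|).
Proof.
move=> lf; apply: (orlicz_dom _ _ lf); last by apply: ae_all => w; rewrite normr_id.
by apply: measurableT_comp => //; exact: orlicz_meas.
Qed.

Lemma orlicz_bounded f (c : R) : measurable_fun setT f ->
  {ae P, forall w, `|f w| <= c} -> L f.
Proof.
move=> mf fc; apply: (orlicz_dom mf _ (orlicz_cst c)).
by apply: ae_mono fc => w /le_trans; apply; exact: ler_norm.
Qed.

Lemma orlicz_ind f (A : set Omega) : measurable A -> L f -> L (fun w => f w * \1_A w).
Proof.
move=> mA lf; apply: (orlicz_dom _ _ lf).
  by apply: measurable_funM; [exact: orlicz_meas|exact: measurable_indic].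
apply: ae_all => w; rewrite normrM ler_piMr// indicE.
by case: (_ \in _); rewrite ?normr1 ?normr0.
Qed.

Lemma orlicz_indic (A : set Omega) : measurable A -> L (\1_A : Omega -> R).
Proof.
move=> mA; apply: (@orlicz_bounded _ 1); first exact: measurable_indic.
by apply: ae_all => w; rewrite indicE; case: (_ \in _); rewrite ?normr1 ?normr0.
Qed.

Lemma modular_int f : measurable_fun setT f -> (modular f < +oo)%E -> LI f.
Proof.
move=> mf hf; have [c c0 hc] := hatu_growth hu hA1.
apply/integrableP; split; first exact/measurable_EFinP.
apply: (@le_lt_trans _ _ (c%:E * (1 + modular f))%E); last first.
  by apply: lte_mul_pinfty; rewrite ?lee_fin ?(ltW c0)// lte_add_pinfty// ltry.
have -> : (1 + modular f = \int[P]_w (1 + hatu u (f w)))%E.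
  rewrite ge0_integralD//; [|by move=> w _; exact: hatu_ge0 hu _|exact: measurable_hatu_comp].
  rewrite integral_cst// mul1e; congr (_ + _)%E; symmetry; exact: probability_setT.
rewrite -ge0_integralZl//; last 3 first.
- by apply: emeasurable_funD => //; exact: measurable_hatu_comp.
- by move=> w _; rewrite adde_ge0// (hatu_ge0 hu).
- by rewrite lee_fin ltW.
apply: ge0_le_integral => //.
- by apply: measurableT_comp => //; exact/measurable_EFinP.
- by apply: emeasurable_funM => //; apply: emeasurable_funD => //; exact: measurable_hatu_comp.
- by move=> w _; exact: hc.
Qed.

Lemma orlicz_int f : L f -> LI f.
Proof.
move=> [mf [al al0 hal]].
have := @modular_int (fun w => al * f w) (measurable_funM (measurable_cst _) mf) hal.
move=> /(int_Z al^-1); congr (_.-integrable _ _).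
by apply/funext => w /=; rewrite mulKf// gt_eqF.
Qed.

(** ** Luxemburg norm *)

Lemma lux_has_inf f : L f ->
  has_inf [set c : R | 0 < c /\ (\int[P]_w hatu u (f w / c)%R <= 1)%E].
Proof.
move=> [mf [al al0 hal]]; split; last by exists 0 => c [/ltW].
have mal : measurable_fun setT (fun w => al * f w) by exact: measurable_funM.
have hfin : modular (fun w => al * f w) \is a fin_num.
  by rewrite ge0_fin_numE// modular_ge0.
set m := fine (modular (fun w => al * f w)%R).
have m0 : 0 <= m by rewrite fine_ge0// modular_ge0.
(* By convexity, dividing [al * f] by [m + 1] brings its modular down to at most [m / (m + 1)]. *)
exists ((m + 1) / al); split; first by rewrite divr_gt0// ltr_wpDl.
have t01 : 0 <= (m + 1)^-1 <= 1.
  by rewrite invr_ge0 addr_ge0//= invf_le1 ?lerDr// ltr_wpDl.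
have := modular_scale t01 mal; rewrite -(fineK hfin) -/m -EFinM => H.
apply: (@le_trans _ _ ((m + 1)^-1 * m)%:E); last first.
  by rewrite lee_fin mulrC ler_pdivrMr ?ltr_wpDl// mul1r lerDl.
apply: le_trans H; rewrite /modular (eq_integral (fun w => hatu u ((m + 1)^-1 * (al * f w))%R))//.
move=> w _; congr hatu; field.
by rewrite !gt_eqF// ltr_wpDl.
Qed.

Lemma lux_ge0 f : 0 <= N f.
Proof.
rewrite /luxemburg; set S := [set c : R | _].
have [->|/set0P S0] := eqVneq S set0; first by rewrite inf0.
by apply: lb_le_inf => // c [/ltW].
Qed.

Lemma lux_le f (c : R) : L f -> 0 < c -> (modular (fun w => f w / c)%R <= 1)%E -> N f <= c.
Proof. by move=> lf c0 h; apply: ge_inf => //; case: (lux_has_inf lf). Qed.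

Lemma lux_le1 f : measurable_fun setT f -> (modular f <= 1)%E -> N f <= 1.
Proof.
move=> mf h; have lf : L f by apply: orlicz_modular => //; rewrite (le_lt_trans h)// ltry.
apply: lux_le => //; apply: le_trans h; rewrite /modular.
by rewrite (eq_integral (fun w => hatu u (f w)))// => w _; rewrite divr1.
Qed.

Lemma lux_lt f (c : R) : L f -> N f < c -> (modular (fun w => f w / c)%R <= 1)%E.
Proof.
move=> lf Nc; have mf := orlicz_meas lf.
have [|c' [c'0 hc'] c'c] := inf_lt _ Nc; first by case: (lux_has_inf lf).
apply: le_trans hc'; apply: (@modular_le (fun w => f w / c) (fun w => f w / c')).
- exact: measurable_funM.
- exact: measurable_funM.
- apply: ae_all => w; rewrite !normrM ler_wpM2l// !ger0_norm ?invr_ge0 ?(ltW c'0)//.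
    by rewrite lef_pV2 ?posrE// ?(ltW c'c)// (lt_trans c'0).
  by rewrite ltW// (lt_trans c'0).
Qed.

Lemma lux_le_max f : L f -> (modular f < +oo)%E -> N f <= Num.max 1 (fine (modular f)).
Proof.
move=> lf hf; have mf := orlicz_meas lf.
have fin : modular f \is a fin_num by rewrite ge0_fin_numE// modular_ge0.
set m := fine (modular f); set c := Num.max 1 m.
have c1 : 1 <= c by rewrite le_max lexx.
have c0 : 0 < c by rewrite (lt_le_trans ltr01).
apply: lux_le => //.
have t01 : 0 <= c^-1 <= 1 by rewrite invr_ge0 (ltW c0) invf_le1.
have := modular_scale t01 mf; rewrite -(fineK fin) -/m -EFinM => H.
apply: (@le_trans _ _ (c^-1 * m)%:E); last first.
  by rewrite lee_fin mulrC ler_pdivrMr// mul1r le_max lexx orbT.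
apply: le_trans H; rewrite /modular (eq_integral (fun w => hatu u (c^-1 * f w)%R))//.
by move=> w _; rewrite mulrC.
Qed.

Lemma lux_le_dom f g : measurable_fun setT f -> {ae P, forall w, `|f w| <= `|g w|} ->
  L g -> N f <= N g.
Proof.
move=> mf fg lg; have lf := orlicz_dom mf fg lg.
apply: lb_le_inf; first by case: (lux_has_inf lg).
move=> c [c0 hc]; apply: lux_le => //; apply: le_trans hc.
apply: (@modular_le (fun w => f w / c) (fun w => g w / c)).
- exact: measurable_funM.
- by apply: measurable_funM => //; exact: orlicz_meas.
- by apply: ae_mono fg => w h; rewrite !normrM ler_wpM2r.
Qed.

Lemma lux_ae0 f : L f -> {ae P, forall w, f w = 0} -> N f = 0.
Proof.
move=> lf f0; apply/eqP; rewrite eq_le lux_ge0 andbT.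
apply/ler_addgt0Pl => e e0; rewrite addr0; apply: lux_le => //.
have mf := orlicz_meas lf.
apply: (@le_trans _ _ (modular (fun=> 0))).
  apply: modular_le => //; first exact: measurable_funM.
  by apply: ae_mono f0 => w ->; rewrite mul0r.
by rewrite /modular (hatu0 hu) integral0.
Qed.

(** Boundedness is tested on functions of modular at most 1, which is how it arises for
    supergradients. A one-sided bound suffices because the modular is even. *)
Lemma bounded_by_modular (z : functional) (C : R) :
  (forall (c : R) f, L f -> z (fun w => c * f w) = c * z f) ->
  (forall f, L f -> (modular f <= 1)%E -> z f <= C) ->
  forall f, L f -> `|z f| <= C * N f.
Proof.
move=> zZ zC f lf.
suff key g : L g -> z g <= C * N g.
  rewrite ler_norml key// andbT lerNl -mulN1r -zZ//.
  have lNf := orlicz_Z (-1) lf.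
  apply: (le_trans (key _ lNf)); rewrite ler_wpM2l//.
    have := zC _ (orlicz_cst 0); rewrite (_ : (fun=> 0) = fun w => 0 * f w); last first.
      by apply/funext => w; rewrite mul0r.
    rewrite zZ// mul0r; apply; rewrite /modular (eq_integral (cst 0%E)) ?integral0//.
    by move=> w _; rewrite mul0r (hatu0 hu).
  apply: lux_le_dom => //; first exact: orlicz_meas.
  by apply: ae_all => w; rewrite mulN1r normrN.
move=> lg.
have C0 : 0 <= C.
  have := zC _ (orlicz_cst 0); rewrite (_ : (fun=> 0) = fun w => 0 * g w); last first.
    by apply/funext => w; rewrite mul0r.
  rewrite zZ// mul0r; apply; rewrite /modular (eq_integral (cst 0%E)) ?integral0//.
  by move=> w _; rewrite mul0r (hatu0 hu).
apply/ler_addgt0Pr => e e0.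
(* The divisor in [lux_lt] must exceed the norm strictly; this slack costs [C * d <= e]. *)
set d := e / (C + 1).
have C1 : 0 < C + 1 by rewrite ltr_wpDl.
have d0 : 0 < d by rewrite divr_gt0.
have c0 : 0 < N g + d by rewrite ltr_wpDl// lux_ge0.
have Nc : N g < N g + d by rewrite ltrDl.
have := zC (fun w => (N g + d)^-1 * g w) (orlicz_Z _ lg).
have -> : modular (fun w => (N g + d)^-1 * g w) = modular (fun w => g w / (N g + d)).
  by apply: eq_integral => w _; rewrite mulrC.
move=> /(_ (lux_lt lg Nc)); rewrite zZ// mulrC ler_pdivrMr// => /le_trans; apply.
rewrite mulrDr lerD2l /d mulrA ler_pdivrMr// mulrC ler_wpM2l ?(ltW e0)//.
by rewrite lerDl.
Qed.

End OrliczSpace.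

(** * Bounded functionals, their modulus and disjointness *)

Section Functionals.
Context {R : realType} {dd : measure_display} {Omega : measurableType dd}.
Variables (P : probability Omega R) (u : R -> \bar R) (a : \bar R).
Hypotheses (hu : utility u a) (hA1 : A1 u a).

Local Notation L := (orlicz P (hatu u)).
Local Notation N := (luxemburg P u).
Local Notation oB := (orlicz_B hu hA1).
Local Notation oZ := (orlicz_Z hu).
Local Notation oN := (orlicz_N hu).
Local Notation ocst := (orlicz_cst P hu).
Local Notation oabs := (orlicz_abs hu).
Local Notation omeas := (@orlicz_meas _ _ _ P u).
Local Notation dual := (@dual R dd Omega P u).
Local Notation le0 f := (le_as P (cst 0) f).
Implicit Types f g h : Omega -> R.
Implicit Types z : @functional R dd Omega.

Lemma dual_cst0 z : dual z -> z (fun=> 0) = 0.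
Proof.
move=> [zl _]; have := zl 1 _ _ (ocst 0) (ocst 0).
rewrite (_ : (fun w => 1 * 0 + 0) = (fun=> 0)); last by apply/funext => w; rewrite mulr0 addr0.
rewrite mul1r; lra.
Qed.

Lemma dual_Z z (c : R) f : dual z -> L f -> z (fun w => c * f w) = c * z f.
Proof.
move=> dz lf; have [zl _] := dz; have := zl c _ _ lf (ocst 0).
rewrite dual_cst0// addr0 => <-; congr z; apply/funext => w; rewrite addr0//.
Qed.

Lemma dual_lin z (c d : R) f g : dual z -> L f -> L g ->
  z (fun w => c * f w + d * g w) = c * z f + d * z g.
Proof. by move=> dz lf lg; have [zl _] := dz; rewrite (zl c f) ?dual_Z//; exact: oZ. Qed.

Lemma dual_D z f g : dual z -> L f -> L g -> z (fun w => f w + g w) = z f + z g.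
Proof.
move=> dz lf lg; have := dual_lin 1 1 dz lf lg; rewrite !mul1r => <-.
by congr z; apply/funext => w; rewrite !mul1r.
Qed.

Lemma dual_B z f g : dual z -> L f -> L g -> z (fun w => f w - g w) = z f - z g.
Proof.
move=> dz lf lg; have := dual_lin 1 (-1) dz lf lg; rewrite !mul1r mulN1r => <-.
by congr z; apply/funext => w; rewrite mul1r mulN1r.
Qed.

Lemma dual_N z f : dual z -> L f -> z (fun w => - f w) = - z f.
Proof.
move=> dz lf; have := dual_Z (-1) dz lf; rewrite mulN1r => <-.
by congr z; apply/funext => w; rewrite mulN1r.
Qed.

Lemma dual_ae z f g : dual z -> L f -> L g -> {ae P, forall w, f w = g w} -> z f = z g.
Proof.
move=> dz lf lg fg; apply/eqP; rewrite -subr_eq0 -dual_B//; have [_ [C zC]] := dz.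
rewrite -normr_le0 (le_trans (zC _ (oB lf lg)))// (lux_ae0 hu hA1) ?mulr0//; first exact: oB.
by apply: ae_mono fg => w ->; rewrite subrr.
Qed.

Lemma dual_comb z1 z2 (c d : R) : dual z1 -> dual z2 ->
  dual (fun f => c * z1 f + d * z2 f).
Proof.
move=> [l1 [C1 h1]] [l2 [C2 h2]]; split.
  by move=> k f g lf lg; rewrite l1// l2//; ring.
exists (`|c| * C1 + `|d| * C2) => f lf.
rewrite (le_trans (ler_normD _ _))// !normrM mulrDl -!mulrA.
by rewrite lerD// ler_wpM2l// ?h1 ?h2.
Qed.

Lemma dual_sub z1 z2 : dual z1 -> dual z2 -> dual (fun f => z1 f - z2 f).
Proof.
move=> d1 d2; have := dual_comb 1 (-1) d1 d2.
by congr Defs.dual; apply/funext => f; rewrite mul1r mulN1r.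
Qed.

Definition positive z := forall f, L f -> le0 f -> 0 <= z f.

Lemma pos_mono z f g : dual z -> positive z -> L f -> L g -> le_as P f g -> z f <= z g.
Proof.
move=> dz pz lf lg fg; rewrite -subr_ge0 -dual_B//; apply: pz; first exact: oB.
by apply: ae_mono fg => w /=; rewrite subr_ge0.
Qed.

Lemma pos_abs z f : dual z -> positive z -> L f -> `|z f| <= z (fun w => `|f w|).
Proof.
move=> dz pz lf; have la := oabs lf; rewrite ler_norml -dual_N//.
apply/andP; split; apply: pos_mono => //; first exact: oN.
  by apply: ae_all => w; rewrite lerNl -normrN ler_norm.
by apply: ae_all => w; rewrite ler_norm.
Qed.

Lemma dual_norm_has_sup z : dual z ->
  has_sup [set `|z f| | f in [set f | L f /\ N f <= 1]].
Proof.
move=> dz; split.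
  exists `|z (fun=> 0)|, (fun=> 0) => //; split; first exact: ocst.
  by rewrite (lux_ae0 hu hA1)//; [exact: ocst|exact: ae_all].
have [_ [C zC]] := dz; exists `|C| => _ [f [lf Nf] <-].
rewrite (le_trans (zC _ lf))// (le_trans (ler_norm _))// normrM.
by rewrite ler_piMr// ger0_norm// lux_ge0.
Qed.

Lemma dual_norm_ub z f : dual z -> L f -> N f <= 1 -> `|z f| <= dual_norm P u z.
Proof. by move=> dz lf Nf; apply: ub_le_sup; [case: (dual_norm_has_sup dz)|exists f]. Qed.

Lemma dual_norm_le z (c : R) : dual z -> (forall f, L f -> N f <= 1 -> `|z f| <= c) ->
  dual_norm P u z <= c.
Proof.
move=> dz H; apply: sup_le_ub; first by case: (dual_norm_has_sup dz).
by move=> _ [f [lf Nf] <-]; exact: H.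
Qed.

Lemma dual_norm_ge0 z : dual z -> 0 <= dual_norm P u z.
Proof.
move=> dz; apply: le_trans (dual_norm_ub dz (ocst 0) _) => //.
by rewrite (lux_ae0 hu hA1)//; [exact: ocst|exact: ae_all].
Qed.

Lemma dual_norm_ext z1 z2 : (forall f, L f -> z1 f = z2 f) ->
  dual_norm P u z1 = dual_norm P u z2.
Proof.
move=> h; congr sup; apply/seteqP; split => _ [f [lf Nf] <-]; exists f => //;
  by rewrite h.
Qed.

Lemma dual_abs_has_sup z f : dual z -> L f -> le0 f ->
  has_sup [set z g | g in [set g | L g /\ le_as P (fun w => `|g w|) f]].
Proof.
move=> dz lf f0; split.
  exists (z (fun=> 0)), (fun=> 0) => //; split; first exact: ocst.
  by apply: ae_mono f0 => w; rewrite normr0.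
have [_ [C zC]] := dz; exists (`|C| * N f) => _ [g [lg gf] <-].
apply: (le_trans (ler_norm _)); apply: (le_trans (zC _ lg)).
apply: (@le_trans _ _ (`|C| * N g)).
  by apply: ler_wpM2r; [exact: lux_ge0|exact: ler_norm].
apply: ler_wpM2l => //; apply: (lux_le_dom hu hA1) => //; first exact: omeas lg.
by apply: ae_mono gf => w /le_trans; apply; exact: ler_norm.
Qed.

Lemma dual_abs_ub z f g : dual z -> L f -> le0 f -> L g ->
  le_as P (fun w => `|g w|) f -> `|z g| <= dual_abs P u z f.
Proof.
move=> dz lf f0 lg gf; have [_ ub] := dual_abs_has_sup dz lf f0.
rewrite ler_norml lerNl -dual_N//; apply/andP; split; apply: ub_le_sup => //.
  exists (fun w => - g w) => //; split; first exact: oN.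
  by apply: ae_mono gf => w; rewrite normrN.
by exists g.
Qed.

Lemma dual_abs_le z f (c : R) : dual z -> L f -> le0 f ->
  (forall g, L g -> le_as P (fun w => `|g w|) f -> z g <= c) -> dual_abs P u z f <= c.
Proof.
move=> dz lf f0 H; apply: sup_le_ub; first by case: (dual_abs_has_sup dz lf f0).
by move=> _ [g [lg gf] <-]; exact: H.
Qed.

Lemma dual_abs_ge0 z f : dual z -> L f -> le0 f -> 0 <= dual_abs P u z f.
Proof.
move=> dz lf f0; apply: le_trans (dual_abs_ub dz lf f0 (ocst 0) _) => //.
by apply: ae_mono f0 => w; rewrite normr0.
Qed.

Lemma dual_abs_pos z f : dual z -> positive z -> L f -> le0 f -> dual_abs P u z f <= z f.
Proof.
move=> dz pz lf f0; apply: dual_abs_le => // g lg gf.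
rewrite (le_trans (ler_norm _))// (le_trans (pos_abs dz pz lg))//.
by apply: pos_mono => //; exact: oabs.
Qed.

Lemma disjoint_approx z z' f : dual z -> dual z' -> disjoint_functionals P u z z' ->
  L f -> le0 f -> forall e : R, 0 < e -> exists g, [/\ L g, le0 g, le_as P g f &
    dual_abs P u z g + dual_abs P u z' (fun w => f w - g w) < e].
Proof.
move=> dz dz' dis lf f0 e e0.
have := dis f lf f0; set A := [set _ | _ in _] => iA.
have lbA : has_lbound A.
  exists 0 => _ [g [lg g0 gf] <-]; rewrite addr_ge0//; apply: dual_abs_ge0 => //.
    exact: oB.
  by apply: ae_mono gf => w; rewrite subr_ge0.
have A0 : A !=set0.
  exists (dual_abs P u z f + dual_abs P u z' (fun w => f w - f w)), f => //.
  by split=> //; apply: ae_all.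
have [|_ [g [lg g0 gf] <-] ge] := inf_lt A0 (x := e); first by rewrite iA.
by exists g; split.
Qed.

Lemma disjointI z z' : dual z -> dual z' ->
  (forall f, L f -> le0 f -> forall e : R, 0 < e -> exists g,
    [/\ L g, le0 g, le_as P g f &
        dual_abs P u z g + dual_abs P u z' (fun w => f w - g w) < e]) ->
  disjoint_functionals P u z z'.
Proof.
move=> dz dz' H f lf f0; apply/eqP; rewrite eq_le; apply/andP; split.
  apply/ler_addgt0Pl => e e0; rewrite addr0.
  have [g [lg g0 gf ge]] := H f lf f0 e e0.
  apply: le_trans (ltW ge); apply: ge_inf; last by exists g.
  exists 0 => _ [h [lh h0 hf] <-]; rewrite addr_ge0//; apply: dual_abs_ge0 => //.
    exact: oB.
  by apply: ae_mono hf => w; rewrite subr_ge0.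
apply: lb_le_inf.
  exists (dual_abs P u z f + dual_abs P u z' (fun w => f w - f w)), f => //.
  by split=> //; apply: ae_all.
move=> _ [h [lh h0 hf] <-]; rewrite addr_ge0//; apply: dual_abs_ge0 => //.
  exact: oB.
by apply: ae_mono hf => w; rewrite subr_ge0.
Qed.

End Functionals.

(** * Regular and singular parts of positive functionals *)

(* The countably additive part of the finitely additive set function [A |-> z \1_A] is the
   outer measure it generates; near-optimal covers show that the rest lives on small sets. *)
Section CountablyAdditivePart.
Context {R : realType} {dd : measure_display} {Omega : measurableType dd}.
Variables (P : probability Omega R) (u : R -> \bar R) (a : \bar R).
Hypotheses (hu : utility u a) (hA1 : A1 u a).

Local Notation L := (orlicz P (hatu u)).
Local Notation N := (luxemburg P u).
Local Notation LI f := (P.-integrable setT (EFin \o f)).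
Local Notation oD := (orlicz_D hu hA1).
Local Notation oZ := (orlicz_Z hu).
Local Notation ocst := (orlicz_cst P hu).
Local Notation o1 := (orlicz_indic P hu).
Local Notation omeas := (@orlicz_meas _ _ _ P u).
Variable z : @functional R dd Omega.
Hypotheses (dz : dual P u z) (pz : positive P u z).

(** The absolute value is there for nonmeasurable sets, since [mu_ext] expects a function that is
    nonnegative on all sets; on measurable ones it is harmless by positivity of [z]. *)
Definition set_functional (A : set Omega) : \bar R := (`|z \1_A|)%:E.
Local Notation nu := set_functional.

Lemma pos_indic (A : set Omega) : measurable A -> 0 <= z \1_A.
Proof. by move=> mA; apply: pz; [exact: o1|apply: ae_all => w; rewrite indicE]. Qed.

Lemma set_functionalE (A : set Omega) : measurable A -> nu A = (z \1_A)%:E.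
Proof. by move=> mA; rewrite /nu ger0_norm// pos_indic. Qed.

Lemma z_indicI (A B : set Omega) : measurable A -> measurable B ->
  z \1_A = z \1_(A `&` B) + z \1_(A `&` ~` B).
Proof.
move=> mA mB; have mAB := measurableI _ _ mA mB.
have mAB' := measurableI _ _ mA (measurableC mB).
rewrite -(dual_D hu dz (o1 mAB) (o1 mAB')); congr z; apply/funext => w.
rewrite !indicE !in_setI in_setC.
by case: (w \in A); case: (w \in B); rewrite /= ?addr0 ?add0r.
Qed.

Lemma set_functional0 : nu set0 = 0%E.
Proof.
rewrite /nu (_ : \1_set0 = fun=> 0); first by rewrite (dual_cst0 hu dz) normr0.
by apply/funext => w; rewrite indicE in_set0.
Qed.

Lemma set_functional_ge0 A : (0 <= nu A)%E.
Proof. by rewrite lee_fin. Qed.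

Definition ca_part (A : set Omega) : \bar R := mu_ext set_functional A.
Local Notation m := ca_part.

HB.instance Definition _ := isOuterMeasure.Build R Omega m
  (mu_ext0 set_functional0 set_functional_ge0)
  (mu_ext_ge0 set_functional_ge0)
  (le_mu_ext set_functional)
  (mu_ext_sigma_subadditive set_functional_ge0).

(** Finite additivity of [z] splits each member of a cover along [A], so the two covers obtained
    cost together no more than the original one. *)
Lemma measurable_caratheodory (A : set Omega) : measurable A -> m.-caratheodory A.
Proof.
move=> mA; apply: le_caratheodory_measurable => X.
apply: le_ereal_inf_tmp => _ [G [mG XG] <-].
apply: (@le_trans _ _ (\sum_(k <oo) nu (G k `&` A) + \sum_(k <oo) nu (G k `&` ~` A))%E).
  apply: leeD; apply: ereal_inf_lbound.
    exists (fun k => G k `&` A) => //; split=> [k|w [Xw Aw]]; first exact: measurableI.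
    by have [k _ Gk] := XG w Xw; exists k.
  exists (fun k => G k `&` ~` A) => //; split=> [k|w [Xw Aw]].
    by apply: measurableI => //; exact: measurableC.
  by have [k _ Gk] := XG w Xw; exists k.
rewrite -nneseriesD; last 2 first.
- by move=> k _ _; exact: set_functional_ge0.
- by move=> k _ _; exact: set_functional_ge0.
apply: lee_nneseries => [k _ _|k _].
  by rewrite adde_ge0// set_functional_ge0.
have mI : measurable (G k `&` A) by exact: measurableI.
have mI' : measurable (G k `&` ~` A) by apply: measurableI => //; exact: measurableC.
rewrite !set_functionalE//.
by rewrite -EFinD lee_fin -z_indicI.
Qed.

Lemma ca_sigma_additive : semi_sigma_additive (m : set Omega -> \bar R).
Proof.
move=> G mG tG mUG.
apply: (@caratheodory_measure_sigma_additive R Omega m G) => //.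
  by move=> k; exact: measurable_caratheodory.
exact: measurable_caratheodory.
Qed.

HB.instance Definition _ := isMeasure.Build dd Omega R m
  (mu_ext0 set_functional0 set_functional_ge0) (mu_ext_ge0 set_functional_ge0) ca_sigma_additive.

Lemma ca_le (A : set Omega) : measurable A -> (m A <= (z \1_A)%:E)%E.
Proof.
move=> mA; rewrite -set_functionalE//; apply: ereal_inf_lbound.
exists (fun k => if k is 0%N then A else set0).
  by split=> [[|k]//|w Aw]; exists 0%N.
rewrite (nneseriesD1 (n := 0%N))//; last first.
  by move=> k _; exact: set_functional_ge0.
rewrite eseries0 ?adde0// => k _ /andP[_ k0]; case: k k0 => // k _; exact: set_functional0.
Qed.

Lemma ca_setT_fin : (m setT < +oo)%E.
Proof. by rewrite (le_lt_trans (ca_le measurableT))// ltry. Qed.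

Lemma ca_fin_num : fin_num_fun m.
Proof.
move=> A mA; rewrite ge0_fin_numE ?measure_ge0// (le_lt_trans _ ca_setT_fin)//.
exact: le_mu_ext.
Qed.

HB.instance Definition _ := @Measure_isFinite.Build _ Omega R m ca_fin_num.

Lemma ca_dominated : m `<< P.
Proof.
apply/null_content_dominatesP => A mA PA0.
apply/eqP; rewrite eq_le mu_ext_ge0//; last exact: set_functional_ge0.
rewrite andbT (le_trans (ca_le mA))// lee_fin.
have A0 : {ae P, forall w, (\1_A : Omega -> R) w = 0}.
  exists A; split=> // w /= nA; apply: contrapT => Aw; apply: nA.
  by rewrite indicE memNset.
by rewrite (dual_ae hu hA1 dz (o1 mA) (ocst 0) A0) (dual_cst0 hu dz).
Qed.

Lemma vanish_finite (mu : {finite_measure set Omega -> \bar R}) (C : nat -> set Omega) (e : R) :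
  (forall n, measurable (C n)) -> nonincreasing_seq C -> \bigcap_n C n = set0 ->
  0 < e -> exists N, forall n, (N <= n)%N -> (mu (C n) < e%:E)%E.
Proof.
move=> mC dC C0 e0.
have := @nonincreasing_cvg_mu _ _ _ mu C.
rewrite C0 measure0 => /(_ _ mC measurable0 dC) H.
have {}H : mu \o C @ \oo --> 0%E by apply: H; rewrite -ge0_fin_numE ?measure_ge0// fin_num_measure.
move: H => /fine_cvgP[_ /cvgrPdist_lt/(_ e e0)[N _ HN]].
exists N => n Nn; have := HN n Nn.
rewrite sub0r normrN /= ger0_norm ?fine_ge0 ?measure_ge0//.
by rewrite -lte_fin fineK// fin_num_measure.
Qed.

Lemma z_indic_cover (G : nat -> set Omega) N : (forall n, measurable (G n)) ->
  ((z \1_(\big[setU/set0]_(k < N) G k))%:E <= \sum_(0 <= k < N) nu (G k))%E.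
Proof.
move=> mG; elim: N => [|N IH].
  rewrite !big_ord0 big_geq//; have := set_functional0.
  by rewrite set_functionalE// => ->.
have mB : measurable (\big[setU/set0]_(k < N) G k) by exact: bigsetU_measurable.
rewrite big_ord_recr big_nat_recr//=; apply: le_trans (leeD IH (lexx _)).
rewrite set_functionalE// -EFinD lee_fin -(dual_D hu dz (o1 mB) (o1 (mG N))).
apply: (pos_mono hu hA1 dz pz (o1 (measurableU _ _ mB (mG N))) (oD (o1 mB) (o1 (mG N)))).
apply: ae_all => w; rewrite !indicE in_setU.
by case: (w \in _); case: (w \in _); rewrite /= ?addr0 ?add0r ?lexx// lerDl.
Qed.

(** Take a cover of the whole space whose total is within [e / 2] of the outer measure. Its finite
    unions [B n] satisfy [z \1_(B n) <= m setT + e / 2], and their complements shrink to the empty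
    set, so that both [P] and [m] of these become small. *)
Lemma ca_concentrated (e : R) : 0 < e -> exists B, [/\ measurable B,
  (P (~` B) <= e%:E)%E & ((z \1_B)%:E <= m B + e%:E)%E].
Proof.
move=> e0; have e20 : 0 < e / 2 by rewrite divr_gt0.
have mfin : ca_part setT \is a fin_num by exact: ca_fin_num.
have [_ [G [mG TG] <-] Gm] := lb_ereal_inf_adherent e20 mfin.
pose B n := \big[setU/set0]_(k < n) G k.
have mB n : measurable (B n) by exact: bigsetU_measurable.
have mCB n : measurable (~` B n) by exact: measurableC.
have dC : nonincreasing_seq (fun n => ~` B n).
  move=> p q pq; apply/subsetPset; apply: subsetC => w.
  rewrite /B -!bigcup_mkord => -[k /= kp Gk]; exists k => //=; exact: leq_trans kp pq.
have C0 : \bigcap_n ~` B n = set0.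
  apply/seteqP; split => // w /= H; have [k _ Gk] := TG w I.
  by apply: (H k.+1 I); rewrite /B -bigcup_mkord; exists k => /=.
have [N1 H1] := vanish_finite m mCB dC C0 e20.
have [N2 H2] := vanish_finite P mCB dC C0 e0.
set N := maxn N1 N2; exists (B N); split => //.
  by rewrite ltW// H2// leq_maxr.
apply: (le_trans (z_indic_cover N mG)).
apply: (@le_trans _ _ (\sum_(k <oo) nu (G k))%E).
  by apply: nneseries_lim_ge => // k _ _; exact: set_functional_ge0.
apply: (le_trans (ltW Gm)).
rewrite -[X in (X + _ <= _)%E]/(ca_part setT).
have -> : ca_part setT = (m (B N) + m (~` B N))%E.
  by rewrite -measureU ?setICr// setUv.
by rewrite -addeA leeD2l// [in leRHS](splitr e) EFinD leeD2r// ltW// H1// leq_maxl.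
Qed.

Lemma ca_density : exists g : Omega -> R, [/\ measurable_fun setT g, forall w, 0 <= g w,
  LI g, (forall A, measurable A -> m A = \int[P]_(w in A) (g w)%:E)%E &
  forall h : Omega -> R, measurable_fun setT h -> (forall w, 0 <= h w) ->
    (\int[P]_w (h w * g w)%:E = \int[m]_w (h w)%:E)%E].
Proof.
pose g0 := Radon_Nikodym_SigmaFinite.f m P.
have g0fin w : g0 w \is a fin_num := Radon_Nikodym_SigmaFinite.f_fin_num ca_dominated w.
have g0E : EFin \o (fun w => fine (g0 w)) = g0 by apply/funext => w /=; rewrite fineK.
exists (fun w => fine (g0 w)); rewrite g0E.
have ig := Radon_Nikodym_SigmaFinite.f_integrable ca_dominated.
split=> //.
- by apply/measurable_EFinP; rewrite g0E; exact: measurable_int ig.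
- by move=> w; rewrite fine_ge0// (Radon_Nikodym_SigmaFinite.f_ge0 ca_dominated).
- move=> A mA; rewrite (Radon_Nikodym_SigmaFinite.f_integral ca_dominated mA).
  by apply: eq_integral => w _; rewrite fineK.
- move=> h mh h0.
  rewrite -(Radon_Nikodym_SigmaFinite.change_of_variables ca_dominated (f := EFin \o h))//.
  + by apply: eq_integral => w _; rewrite EFinM fineK.
  + exact/measurable_EFinP.
Qed.

Lemma z_indic_sum (s : seq R) (A : R -> set Omega) :
  (forall r, measurable (A r)) -> L (fun w => \sum_(r <- s) r * \1_(A r) w) /\
  z (fun w => \sum_(r <- s) r * \1_(A r) w) = \sum_(r <- s) r * z \1_(A r).
Proof.
move=> mA; elim: s => [|r s [lS zS]].
  rewrite big_nil (_ : (fun w => \sum_(r <- [::]) r * \1_(A r) w) = fun=> 0); first by split; [exact: ocst|exact: (dual_cst0 hu dz)].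
  by apply/funext => w; rewrite big_nil.
rewrite big_cons -zS (_ : (fun w => _) = fun w => (r * \1_(A r) w + \sum_(r <- s) r * \1_(A r) w)).
  have l1 : L (fun w => r * \1_(A r) w) by apply: oZ; exact: o1.
  by split; [exact: oD|rewrite (dual_D hu dz l1 lS) (dual_Z hu _ dz)//; exact: o1].
by apply/funext => w; rewrite big_cons.
Qed.

Import HBNNSimple.

(** The inequality [m <= z] on events sums up to simple functions below [h], and positivity of [z]
    carries it to [h]. *)
Lemma ca_integral_le (h : Omega -> R) : L h -> (forall w, 0 <= h w) ->
  (\int[m]_w (h w)%:E <= (z h)%:E)%E.
Proof.
move=> lh h0; rewrite ge0_integralTE//; apply: ge_ereal_sup => _ [s sh <-].
pose A r := s @^-1` [set r].
have mA r : measurable (A r) by exact: measurable_sfunP.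
have fr : finite_set (range s) by exact: fimfunP.
have [lS zS] := z_indic_sum (finmap.enum_fset (fset_set (range s))) mA.
rewrite sintegralE.
apply: (@le_trans _ _ (\sum_(r \in range s) (r * z \1_(A r))%:E)%E).
  apply: lee_fsum => // r [w _ <-]; rewrite EFinM; apply: lee_wpmul2l.
    by rewrite lee_fin.
  exact: ca_le.
rewrite fsbig_finite// sumEFin -zS lee_fin.
apply: (pos_mono hu hA1 dz pz lS lh); apply: ae_all => w.
have := sh w; rewrite lee_fin; apply: le_trans.
by rewrite [leRHS]fimfunE fsbig_finite.
Qed.

(** Borel-Cantelli: events [B k] of probability close to 1, on which [z] exceeds [m] by at most
    [1 / 2 ^+ k.+1], are combined into the tail unions [A n] of their complements. The excess of [z]
    over [m] is additive and nonnegative, and the complement of [A n] lies inside [B k] for all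
    [k >= n], so the excess is zero there. *)
Lemma pos_structure : exists (g : Omega -> R) (A : nat -> set Omega),
  [/\ measurable_fun setT g, forall w, 0 <= g w, vanishing P A,
      forall h, L h -> (forall w, 0 <= h w) ->
        LI (fun w => h w * g w) /\ \int[P]_w (h w * g w) <= z h &
      forall n, z \1_(~` A n) = \int[P]_w (\1_(~` A n) w * g w)].
Proof.
have [g [mg g0 ig gm gI]] := ca_density.
have gh h : L h -> (forall w, 0 <= h w) ->
    LI (fun w => h w * g w) /\ \int[P]_w (h w * g w) <= z h.
  move=> lh h0.
  have mhg : measurable_fun setT (fun w => h w * g w).
    by apply: measurable_funM => //; exact: omeas lh.
  have H : (\int[P]_w (h w * g w)%:E <= (z h)%:E)%E.
    by rewrite gI//; [exact: ca_integral_le|exact: omeas lh].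
  have i : LI (fun w => h w * g w).
    apply/integrableP; split; first exact/measurable_EFinP.
    apply: le_lt_trans (ltry (z h)); apply: le_trans H.
    rewrite le_eqVlt; apply/orP; left; apply/eqP; apply: eq_integral => w _ /=.
    by rewrite ger0_norm// mulr_ge0.
  by split=> //; rewrite -lee_fin -(exp_fin i).
have ch k : exists B, [/\ measurable B, (P (~` B) <= (1 / 2 ^+ k.+1)%:E)%E &
    ((z \1_B)%:E <= m B + (1 / 2 ^+ k.+1)%:E)%E].
  by apply: ca_concentrated; rewrite divr_gt0// exprn_gt0.
have [B HB] := choice ch.
have mB k : measurable (B k) by have [] := HB k.
have mCB k : measurable (~` B k) by exact: measurableC.
pose A n := \bigcup_(k >= n) ~` B k.
have mA n : measurable (A n) by exact: bigcup_measurable.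
have P0 : P (lim_sup_set (fun k => ~` B k)) = 0%E.
  apply: lim_sup_set_cvg0 => //.
  have h : \sum_(0 <= n < k) (1 / 2 ^+ n.+1)%:E @[k --> \oo] --> (1%E : \bar R).
    apply/fine_cvgP; split.
      apply: nearW => /= n; rewrite sum_fin_num//.
      by apply/allP => /= r /mapP[/= k _] ->.
    have := @cvg_geometric_series_half R 1 0; rewrite {1}/series/= expr0 divr1.
    under [in X in _ -> X]eq_fun do rewrite sumEFin.
    by under eq_fun do under eq_bigr do rewrite addn1 natrX.
  apply: (@le_lt_trans _ _ (\sum_(0 <= n <oo) (1 / 2 ^+ n.+1)%:E)%E).
    by apply: lee_nneseries => [i _ _|i _] //; have [] := HB i.
  by move/cvg_lim : h => ->//; rewrite ltry.
have vA : vanishing P A.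
  split=> [//|p q pq w [k /= qk Bk]|]; first by exists k => //=; exact: leq_trans pq qk.
  exists (lim_sup_set (fun k => ~` B k)); split => //.
    by apply: bigcapT_measurable => n; exact: mA.
  by move=> w /= H n _; apply: contrapT => nA; apply: H; exists n.
exists g, A; split => // n.
have mCA : measurable (~` A n) by exact: measurableC.
have igA D : measurable D -> LI (fun w => \1_D w * g w).
  by move=> mD; have [] := gh \1_D (o1 mD) ltac:(by move=> w; rewrite indicE).
have mE D : measurable D -> m D = (\int[P]_w (\1_D w * g w))%:E.
  move=> mD; rewrite gm// -(exp_fin (igA _ mD)) [LHS]integral_mkcond.
  apply: eq_integral => w _; rewrite patchE indicE.
  by case: (w \in D); rewrite ?mul1r ?mul0r.
apply/eqP; rewrite eq_le; apply/andP; split; last first.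
  by have [] := gh \1_(~` A n) (o1 mCA) ltac:(by move=> w; rewrite indicE).
apply/ler_addgt0Pr => e e0.
have [N HN] : exists N, 1 / 2 ^+ N.+1 <= e.
  have := cvg_geometric (1 : R) (z := 2^-1); rewrite ger0_norm ?invr_ge0// invf_lt1// ltr1n.
  move=> /(_ isT) /cvgrPdist_le/(_ e e0)[N _ HN]; exists N.
  have := HN N.+1 (leqnSn N); rewrite sub0r normrN ger0_norm /= ?mul1r ?exprn_ge0 ?invr_ge0//.
  by rewrite exprVn.
set k := maxn n N.
have kN : 1 / 2 ^+ k.+1 <= e.
  apply: le_trans HN; rewrite !div1r lef_pV2 ?posrE ?exprn_gt0//.
  by rewrite ler_eXn2l ?ltr1n// ltnS leq_maxr.
have [_ _ H] := HB k.
have AB : ~` A n `<=` B k.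
  by move=> w nA; apply: contrapT => nB; apply: nA; exists k => //=; exact: leq_maxl.
have mD : measurable (B k `&` ~` (~` A n)) by apply: measurableI => //; rewrite setCK.
have E1 := z_indicI (mB k) mCA; rewrite (setIidr AB) in E1.
have := gh _ (o1 mD) ltac:(by move=> w; rewrite indicE) => -[_ H2].
move: H; rewrite mE// -EFinD lee_fin E1 => H.
have E2 : \int[P]_w (\1_(B k) w * g w) = \int[P]_w (\1_(~` A n) w * g w) +
    \int[P]_w (\1_(B k `&` ~` (~` A n)) w * g w).
  rewrite -exp_D; [|exact: igA|exact: igA].
  congr fine; apply: eq_integral => w _; rewrite -mulrDl; congr (_ * _)%:E.
  rewrite !indicE; case: (boolP (w \in ~` A n)) => [wA|wA].
    rewrite (mem_set (AB _ (set_mem wA))) memNset ?addr0//.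
    by move=> [_]; apply; exact: set_mem wA.
  by rewrite add0r in_setI in_setC wA andbT.
lra.
Qed.

End CountablyAdditivePart.

(** * Order continuity of density functionals and uniqueness of the regular part *)

Section RegularSingular.
Context {R : realType} {dd : measure_display} {Omega : measurableType dd}.
Variables (P : probability Omega R) (u : R -> \bar R) (a : \bar R).
Hypotheses (hu : utility u a) (hA1 : A1 u a).

Local Notation L := (orlicz P (hatu u)).
Local Notation N := (luxemburg P u).
Local Notation LI f := (P.-integrable setT (EFin \o f)).
Local Notation oD := (orlicz_D hu hA1).
Local Notation oB := (orlicz_B hu hA1).
Local Notation oint := (orlicz_int hu hA1).
Local Notation oZ := (orlicz_Z hu).
Local Notation oabs := (orlicz_abs hu).
Local Notation obd := (orlicz_bounded hu).
Local Notation oind := (orlicz_ind hu).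
Local Notation o1 := (orlicz_indic P hu).
Local Notation odom := (orlicz_dom hu).
Local Notation omeas := (@orlicz_meas _ _ _ P u).
Local Notation dual := (@dual R dd Omega P u).
Local Notation positive := (@positive R dd Omega P u).
Local Notation le0 f := (le_as P (cst 0) f).
Local Notation order_continuous := (@order_continuous R dd Omega P u).
Local Notation singular := (@singular R dd Omega P u).
Implicit Types (f g h : Omega -> R) (z s : @functional R dd Omega).

Lemma ereal_cvg_ge (x : nat -> R) (l : \bar R) (M : R) :
  (x n)%:E @[n --> \oo] --> l -> (M%:E < l)%E -> exists n0, forall n, (n0 <= n)%N -> M <= x n.
Proof.
move=> xl Ml.
have [n0 _ H] := xl _ (open_nbhs_nbhs (conj (@open_ereal_gt_ereal R M%:E) Ml)).
by exists n0 => n nn; rewrite -lee_fin ltW//; exact: H.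
Qed.

Lemma vanishingU (A B : nat -> set Omega) : vanishing P A -> vanishing P B ->
  vanishing P (fun n => A n `|` B n).
Proof.
move=> [mA dA A0] [mB dB B0]; split.
- by move=> n; exact: measurableU.
- by move=> p q pq w [/(dA _ _ pq)|/(dB _ _ pq)]; [left|right].
- apply: ae_mono2 A0 B0 => w [n nA] [k nB]; exists (maxn n k) => -[].
    by move=> /(dA _ _ (leq_maxl n k)).
  by move=> /(dB _ _ (leq_maxr n k)).
Qed.

Lemma vanishing_level f : measurable_fun setT f ->
  vanishing P (fun n => [set w | n%:R < `|f w|]).
Proof.
move=> mf; split.
- move=> n; rewrite -[X in measurable X]setTI; apply: measurable_fun_ltr => //.
  exact: measurableT_comp.
- by move=> p q pq w /=; apply: le_lt_trans; rewrite ler_nat.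
- apply: ae_all => w; exists (Num.truncn `|f w|).+1 => /=; apply/negP; rewrite -leNgt ltW//.
  exact: truncnS_gt.
Qed.

Lemma indic_setC (A : set Omega) w : (\1_(~` A) w : R) = 1 - \1_A w.
Proof. by rewrite !indicE in_setC; case: (w \in A); rewrite ?subrr ?subr0. Qed.

Lemma indic_split f (A : set Omega) : f = fun w => f w * \1_(~` A) w + f w * \1_A w.
Proof. by apply/funext => w; rewrite indic_setC; ring. Qed.

Lemma dual_split z f (A : set Omega) : dual z -> L f -> measurable A ->
  z f = z (fun w => f w * \1_(~` A) w) + z (fun w => f w * \1_A w).
Proof.
move=> dz lf mA; rewrite {1}(indic_split f A) (dual_D hu dz)//; apply: oind => //.
exact: measurableC.
Qed.

(** ** Functionals given by a density *)

Definition is_density g := [/\ measurable_fun setT g, forall w, 0 <= g w,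
  forall f, L f -> LI (fun w => f w * g w) &
  exists C : R, forall f, L f -> \int[P]_w (`|f w| * g w) <= C * N f].

Definition density_functional g : functional := fun f => \int[P]_w (f w * g w).

Lemma density_dual g : is_density g -> dual (density_functional g).
Proof.
move=> [mg g0 ig [C HC]]; split.
  move=> c f h lf lh; rewrite /density_functional -exp_Z; last exact: ig.
  rewrite -exp_D; [|exact: int_Z (ig _ lf)|exact: ig].
  by congr fine; apply: eq_integral => w _; congr EFin; ring.
exists C => f lf; apply: le_trans (HC f lf).
rewrite /density_functional; apply: (le_trans (le_normr_Rintegral measurableT (ig _ lf))).
apply: exp_le; [exact: int_abs (ig _ lf)|exact: ig (oabs lf)|].
by apply: ae_all => w; rewrite normrM (ger0_norm (g0 w)).
Qed.

Lemma exp_dominated_cvg0 (h : nat -> Omega -> R) G : LI G ->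
  (forall n, measurable_fun setT (h n)) ->
  {ae P, forall w, h ^~ w @ \oo --> 0} ->
  {ae P, forall w, forall n, `|h n w| <= G w} -> forall e : R, 0 < e ->
  exists n, \int[P]_w h n w < e.
Proof.
move=> iG mh h0 hG e e0.
have [_ _ H] := @dominated_convergence _ _ _ P setT measurableT
  (fun n w => (h n w)%:E) (cst 0%E) (fun w => (G w)%:E)
  ltac:(by move=> n; exact/measurable_EFinP)
  ltac:(exact: measurable_cst)
  ltac:(by apply: ae_mono h0 => w h0 _; exact: (cvg_EFin (nearW _ _) h0) || by apply: cvg_EFin => //; exact: nearW)
  iG
  ltac:(by apply: ae_mono hG => w hG n _; rewrite lee_fin).
move: H; rewrite integral0 => /fine_cvgP[_ /cvgrPdist_lt/(_ e e0)[n _ HN]].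
exists n; have := HN n (leqnn n).
by rewrite sub0r normrN => /(le_lt_trans (ler_norm _)).
Qed.

(** Order continuity concerns directed families, dominated convergence only sequences. A decreasing
    sequence is extracted from [D] along which [J] tends to its infimum over [D]; directedness makes
    its limit [k] an almost sure lower bound of each member of [D], so [k <= 0] and dominated
    convergence applies. *)
Lemma density_order_continuous g : is_density g ->
  order_continuous (density_functional g).
Proof.
move=> /[dup] dg [mg g0 ig _]; split; first exact: density_dual.
move=> D [[d0 Dd0] DL Ddir Dge Dinf] e e0.
(* The weight [g + 1], unlike [g], is positive everywhere, so [J r <= 0] forces a nonnegative [r] to
   vanish also where [g] does. *)
pose J f := \int[P]_w (f w * (g w + 1)).
have iJ f : L f -> LI (fun w => f w * (g w + 1)).
  move=> lf; have := int_D (ig _ lf) (oint lf).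
  by congr (_.-integrable _ _); apply/funext => w /=; rewrite mulrDr mulr1.
have J0 f : D f -> 0 <= J f.
  move=> Df; apply: exp_ge0; first exact/iJ/DL.
  by apply: ae_mono (Dge f Df) => w /= h; rewrite mulr_ge0// addr_ge0.
have Jle f h : L f -> L h -> le_as P f h -> J f <= J h.
  move=> lf lh fh; apply: exp_le; [exact: iJ|exact: iJ|].
  by apply: ae_mono fh => w fh; rewrite ler_wpM2r// addr_ge0.
set S := [set J f | f in D].
have S0 : S !=set0 by exists (J d0), d0.
have lbS : has_lbound S by exists 0 => _ [f Df <-]; exact: J0.
set c := inf S.
have cJ f : D f -> c <= J f by move=> Df; apply: ge_inf => //; exists f.
have /choice[q Hq] : forall n : nat, exists f, D f /\ J f < c + n.+1%:R^-1.
  move=> n; have [|_ [f Df <-] Jf] := inf_lt S0 (x := c + n.+1%:R^-1); last by exists f.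
  by rewrite ltrDl invr_gt0.
have /choice[lb Hlb] : forall fh : (Omega -> R) * (Omega -> R), exists k,
    D fh.1 -> D fh.2 -> [/\ D k, le_as P k fh.1 & le_as P k fh.2].
  move=> [f h]; have [[/= Df Dh]|nD] := pselect (D f /\ D h).
    by have [k Hk] := Ddir f h Df Dh; exists k.
  by exists d0 => /= Df Dh; exfalso; apply: nD.
pose fs := fix fs n := if n is n'.+1 then lb (fs n', q n) else q 0%N.
have Dfs n : D (fs n).
  elim: n => [|n IH] /=; first by have [] := Hq 0%N.
  by have [//|//=] := Hlb (fs n, q n.+1) IH _; have [] := Hq n.+1.
have fsd n : le_as P (fs n.+1) (fs n).
  by have [] := Hlb (fs n, q n.+1) (Dfs n) ltac:(by have [] := Hq n.+1).
have fsq n : le_as P (fs n) (q n).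
  case: n => [|n]; first exact: ae_all.
  by have [] := Hlb (fs n, q n.+1) (Dfs n) ltac:(by have [] := Hq n.+1).
have Jfs n : J (fs n) < c + n.+1%:R^-1.
  have [Dq Jq] := Hq n; apply: le_lt_trans Jq; apply: Jle; [exact: DL|exact: DL|exact: fsq].
have mfs n : measurable_fun setT (fs n) by exact: omeas (DL _ (Dfs n)).
have ae_fs : {ae P, forall w, (forall n, fs n.+1 w <= fs n w) /\ (forall n, 0 <= fs n w)}.
  have h1 : {ae P, forall w, forall n, fs n.+1 w <= fs n w} by exact/ae_foralln.
  have h2 : {ae P, forall w, forall n, 0 <= fs n w} by apply/ae_foralln => n; exact: Dge.
  exact: ae_mono2 h1 h2.
(* A version of [fs] that decreases at every point and not just almost surely, with a measurable
   infimum [k] defined everywhere. *)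
pose p := fix p n w : R := if n is n'.+1 then Num.min (p n' w) `|fs n w| else `|fs 0%N w|.
have p0E : p 0%N = fun w => `|fs 0%N w| by [].
have pSE k : p k.+1 = fun w => Num.min (p k w) `|fs k.+1 w| by [].
have mp n : measurable_fun setT (p n).
  elim: n => [|n IH]; first by rewrite p0E; exact: measurableT_comp.
  by rewrite pSE; apply: measurable_minr => //; exact: measurableT_comp.
have p0 n w : 0 <= p n w by elim: n => [|n IH] /=; rewrite ?le_min ?IH/=.
have pd w : nonincreasing_seq (p ^~ w).
  by apply/nonincreasing_seqP => n /=; rewrite ge_min lexx.
have pfs : {ae P, forall w, forall n, p n w = fs n w}.
  apply: ae_mono ae_fs => w [h1 h2] n; elim: n => [|n IH]; first by rewrite p0E ger0_norm.
  by rewrite pSE IH ger0_norm// min_r.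
have lp n : L (p n).
  apply: (odom (mp n) _ (DL _ (Dfs n))); apply: ae_mono pfs => w ->//.
pose k w := inf (range (p ^~ w)).
have lbp w : has_lbound (range (p ^~ w)) by exists 0 => _ [n _ <-].
have mk : measurable_fun setT k.
  have -> : k = fun w => infs (p ^~ w) 0%N.
    apply/funext => w; rewrite /k /infs /= /sdrop; congr inf.
    by apply/seteqP; split => _ [n _ <-]; exists n.
  by apply: measurable_fun_infs => // w _; exact: lbp.
have k0 w : 0 <= k w by apply: lb_le_inf; [exists (p 0%N w), 0%N|move=> _ [n _ <-]].
have kp n w : k w <= p n w by apply: ge_inf => //; exists n.
have lk : L k.
  apply: (odom mk _ (lp 0%N)); apply: ae_all => w.
  by rewrite !ger0_norm// ?p0.
have kf f : D f -> le_as P k f.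
  move=> Df; have mf := omeas (DL _ Df).
  pose r w := Num.max 0 (k w - f w).
  have lr : L r.
    apply: (odom _ _ (oB lk (DL _ Df))).
      by apply: measurable_maxr => //; exact: measurable_funB.
    apply: ae_all => w; rewrite /r; case: (lerP 0 (k w - f w)) => // _.
    by rewrite normr0.
  have r0 : J r <= 0.
    apply/ler_addgt0Pl => e' e'0; rewrite addr0.
    have [n Hn] : exists n : nat, n.+1%:R^-1 < e'.
      exists (Num.truncn e'^-1); rewrite invf_plt ?posrE// truncnS_gt//.
    apply: le_trans (ltW Hn).
    pose mn w := Num.min (fs n w) (f w).
    have lmn : L mn.
      apply: (odom _ _ (DL _ (Dfs n))); first exact: measurable_minr.
      apply: ae_mono2 (Dge _ (Dfs n)) (Dge _ Df) => w /= h1 h2.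
      by rewrite !ger0_norm ?ge_min ?lexx// le_min h1.
    (* [mn] need not belong to [D], but some member of [D] lies below it. Hence [J] of [fs n - mn],
       which dominates [r] almost surely, is at most [1 / (n + 1)]. *)
    have cmn : c <= J mn.
      have [f2 [Df2 f2a f2b]] := Ddir _ _ (Dfs n) Df.
      apply: (le_trans (cJ _ Df2)); apply: Jle => //; first exact: DL.
      by apply: ae_mono2 f2a f2b => w h1 h2; rewrite le_min h1.
    have : J r <= J (fun w => fs n w - mn w).
      apply: Jle => //; first exact: oB (DL _ (Dfs n)) lmn.
      apply: ae_mono pfs => w Hp; have := kp n w; rewrite Hp /r /mn.
      by case: (leP (fs n w) (f w)); case: (leP 0 (k w - f w)); lra.
    have -> : J (fun w => fs n w - mn w) = J (fs n) - J mn.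
      rewrite /J -exp_B; [|exact/iJ/DL|exact: iJ].
      by congr fine; apply: eq_integral => w _; rewrite mulrBl.
    move=> Hr; have Hj := Jfs n; apply: (le_trans Hr).
    by rewrite lerBlDr (le_trans (ltW Hj))// addrC lerD2l.
  have rr0 w : 0 <= r w by rewrite le_max lexx.
  have : {ae P, forall w, r w = 0}.
    apply: exp_eq0; [exact: oint|exact: ae_all|].
    apply: le_trans r0; apply: exp_le; [exact: oint|exact: iJ|].
    by apply: ae_all => w; rewrite mulrDr mulr1 lerDr mulr_ge0.
  apply: ae_mono => w; rewrite /r => h; rewrite -subr_le0.
  by rewrite -[leRHS]h le_max lexx orbT.
have kz := Dinf k lk kf.
have [n Hn] : exists n, \int[P]_w (p n w * (g w + 1)) < e.
  apply: (exp_dominated_cvg0 (iJ _ (lp 0%N))) => //.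
  - by move=> n; apply: measurable_funM => //; exact: measurable_funD.
  - apply: ae_mono kz => w /= kw.
    have -> : (0 : R) = k w * (g w + 1) by rewrite (_ : k w = 0) ?mul0r//; apply/eqP; rewrite eq_le kw k0.
    apply: cvgMl; exact: nonincreasing_cvgn.
  - apply: ae_all => w n; rewrite ger0_norm ?mulr_ge0 ?addr_ge0//.
    by rewrite ler_wpM2r ?addr_ge0//; exact: (pd w 0%N n).
exists (fs n); first exact: Dfs.
move=> f Df ffn; rewrite /density_functional.
have f0 := Dge _ Df; have lf := DL _ Df.
rewrite ger0_norm; last first.
  by apply: exp_ge0; [exact: ig|apply: ae_mono f0 => w /= h; rewrite mulr_ge0].
apply: le_lt_trans Hn; apply: exp_le; [exact: ig|exact: iJ|].
have H1 : {ae P, forall w, f w <= p n w} by apply: ae_mono2 pfs ffn => w ->.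
apply: ae_mono2 f0 H1 => w /= fw fp.
by apply: ler_pM => //; rewrite lerDl.
Qed.

Lemma order_continuous_sub z1 z2 : order_continuous z1 -> order_continuous z2 ->
  order_continuous (fun f => z1 f - z2 f).
Proof.
move=> [d1 c1] [d2 c2]; split; first exact: dual_sub.
move=> D Dd e e0; have e20 : 0 < e / 2 by rewrite divr_gt0.
have [f1 Df1 H1] := c1 D Dd _ e20; have [f2 Df2 H2] := c2 D Dd _ e20.
have [_ _ dir _ _] := Dd; have [f0 [Df0 f01 f02]] := dir _ _ Df1 Df2.
exists f0 => // f Df ff0; rewrite (splitr e) (le_lt_trans (ler_normB _ _))// ltrD//.
  by apply: H1 => //; apply: ae_mono2 ff0 f01 => w; exact: le_trans.
by apply: H2 => //; apply: ae_mono2 ff0 f02 => w; exact: le_trans.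
Qed.

(** ** Vanishing events and order continuity *)

Lemma order_continuous_tail0 z f (A : nat -> set Omega) : order_continuous z -> L f ->
  (forall w, 0 <= f w) -> vanishing P A -> forall e : R, 0 < e ->
  exists n0, forall n, (n0 <= n)%N -> `|z (fun w => f w * \1_(A n) w)| < e.
Proof.
move=> [dz cz] lf f0 [mA dA A0] e e0.
pose D : set (Omega -> R) := [set h | exists n, h = fun w => f w * \1_(A n) w].
have dAle m n w : (m <= n)%N -> f w * \1_(A n) w <= f w * \1_(A m) w.
  move=> mn; rewrite ler_wpM2l// !indicE.
  by case: (boolP (w \in A n)) => // /set_mem /(dA _ _ mn) /mem_set ->.
have Dd : decreases_to0 P u D.
  split.
  - by exists (fun w => f w * \1_(A 0%N) w), 0%N.
  - by move=> _ [n ->]; exact: oind.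
  - move=> _ _ [n ->] [k ->]; exists (fun w => f w * \1_(A (maxn n k)) w).
    by split; [exists (maxn n k)|apply: ae_all => w; exact: dAle (leq_maxl _ _)|
      apply: ae_all => w; exact: dAle (leq_maxr _ _)].
  - by move=> _ [n ->]; apply: ae_all => w; rewrite mulr_ge0.
  - move=> g lg H.
    have : {ae P, forall w, forall n, g w <= f w * \1_(A n) w}.
      by apply/ae_foralln => n; apply: H; exists n.
    move=> h; apply: ae_mono2 A0 h => w [n nA] /(_ n).
    by rewrite indicE memNset// mulr0.
have [_ [n0 ->] H] := cz D Dd e e0; exists n0 => n nn.
by apply: H; [exists n|apply: ae_all => w; exact: dAle].
Qed.

Lemma order_continuous_tail z f (A : nat -> set Omega) : order_continuous z -> L f ->
  vanishing P A -> forall e : R, 0 < e ->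
  exists n0, forall n, (n0 <= n)%N -> `|z (fun w => f w * \1_(A n) w)| < e.
Proof.
move=> /[dup] cz [dz _] lf vA e e0; have mf := omeas lf.
have e20 : 0 < e / 2 by rewrite divr_gt0.
have lp : L (fun w => Num.max (f w) 0).
  apply: (odom _ _ lf); first exact: measurable_maxr.
  by apply: ae_all => w; case: (leP (f w) 0) => //; rewrite normr0.
have ln : L (fun w => Num.max (- f w) 0).
  apply: (odom _ _ lf); first by apply: measurable_maxr => //; exact: measurableT_comp.
  by apply: ae_all => w; case: (leP (- f w) 0) => //; rewrite ?normr0// normrN.
have [n1 H1] := order_continuous_tail0 cz lp ltac:(by move=> w; rewrite le_max lexx orbT) vA e20.
have [n2 H2] := order_continuous_tail0 cz ln ltac:(by move=> w; rewrite le_max lexx orbT) vA e20.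
have [mA _ _] := vA.
exists (maxn n1 n2) => n; rewrite geq_max => /andP[/H1 h1 /H2 h2].
rewrite (_ : (fun w => f w * _) = fun w => Num.max (f w) 0 * \1_(A n) w - Num.max (- f w) 0 * \1_(A n) w).
  rewrite (dual_B hu dz); [|exact: oind|exact: oind].
  by rewrite (splitr e) (le_lt_trans (ler_normB _ _))// ltrD.
apply/funext => w; rewrite -mulrBl; congr (_ * _).
by case: (leP (f w) 0); case: (leP (- f w) 0); lra.
Qed.

(* Cutting a nearly maximising [h] off outside [A n] leaves nearly nothing to gain on [A n]. *)
Lemma order_continuous_abs_tail z f (A : nat -> set Omega) : order_continuous z -> L f ->
  le0 f -> vanishing P A -> forall e : R, 0 < e ->
  exists n0, forall n, (n0 <= n)%N -> dual_abs P u z (fun w => f w * \1_(A n) w) < e.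
Proof.
move=> /[dup] cz [dz _] lf f0 vA e e0; have e30 : 0 < e / 3 by rewrite divr_gt0.
have [_ [h [lh hf] <-] zh] := sup_adherent e30 (dual_abs_has_sup hu hA1 dz lf f0).
rewrite -/(dual_abs P u z f) in zh.
have [n0 Hn] := order_continuous_tail cz lh vA e30.
have [mA _ _] := vA.
exists n0 => n nn; apply: (@le_lt_trans _ _ (e / 3 + e / 3)); last by lra.
have lfA : L (fun w => f w * \1_(A n) w) by exact: oind.
apply: (dual_abs_le hu hA1 dz lfA).
  by apply: ae_mono f0 => w /= h0; rewrite mulr_ge0// indicE.
move=> g lg gf.
have lhA : L (fun w => h w * \1_(~` A n) w) by apply: oind => //; exact: measurableC.
have : `|z (fun w => h w * \1_(~` A n) w + g w)| <= dual_abs P u z f.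
  apply: (dual_abs_ub hu hA1 dz lf f0); first exact: oD.
  apply: ae_mono2 hf gf => w; rewrite indic_setC indicE.
  by case: (w \in A n); rewrite ?mulr1 ?mulr0 ?subrr ?subr0 ?mulr0 ?add0r ?mulr1// normr_le0 => h1 /eqP ->; rewrite addr0.
move=> /(le_trans (ler_norm _)); rewrite (dual_D hu dz lhA lg).
have := dual_split dz lh (mA n).
have := Hn n nn; rewrite ltr_norml => /andP[_].
lra.
Qed.

Lemma indic_le1 (A : set Omega) w : 0 <= (\1_A w : R) <= 1.
Proof. by rewrite indicE; case: (w \in A); rewrite /= ?lexx ?ler01. Qed.

Lemma concentrated_bounded s f (A : nat -> set Omega) (c : R) n : dual s -> positive s ->
  vanishing P A -> s \1_(~` A n) = 0 -> L f ->
  (forall w, `|f w| <= c) -> s (fun w => f w * \1_(~` A n) w) = 0.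
Proof.
move=> ds ps [mA _ _] sA lf fc.
have mCA : measurable (~` A n) by exact: measurableC.
apply/eqP; rewrite -normr_le0.
apply: (le_trans (pos_abs hu hA1 ds ps (oind mCA lf))).
apply: (@le_trans _ _ (s (fun w => c * \1_(~` A n) w))); last first.
  by rewrite (dual_Z hu _ ds (o1 mCA)) sA mulr0.
apply: (pos_mono hu hA1 ds ps); [exact/oabs/oind|exact/oZ/o1|].
apply: ae_all => w; have /andP[i0 _] := indic_le1 (~` A n) w.
by rewrite normrM (ger0_norm i0) ler_wpM2r.
Qed.

(** Vanishing on indicators controls bounded functions only. Adding the level sets of [f], which
    vanish as well, to [A n] makes [f] bounded by [n] off [B n]. *)
Lemma concentrated_fun s f (A : nat -> set Omega) : dual s -> positive s ->
  vanishing P A -> (forall n, s \1_(~` A n) = 0) -> L f ->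
  exists B : nat -> set Omega, [/\ vanishing P B, forall n, A n `<=` B n &
    forall n g, L g -> le_as P (fun w => `|g w|) (fun w => `|f w| * \1_(~` B n) w) -> s g = 0].
Proof.
move=> ds ps vA sA lf; pose B n := A n `|` [set w | n%:R < `|f w|].
have vB : vanishing P B.
  by apply: vanishingU => //; apply: vanishing_level; exact: omeas lf.
exists B; split=> // [n w Aw|n g lg gf]; first by left.
have [mA _ _] := vA; have [mB _ _] := vB.
have mCA : measurable (~` A n) by exact: measurableC.
have mCB : measurable (~` B n) by exact: measurableC.
apply/eqP; rewrite -normr_le0; apply: (le_trans (pos_abs hu hA1 ds ps lg)).
apply: (@le_trans _ _ (s (fun w => n%:R * \1_(~` A n) w))); last first.
  by rewrite (dual_Z hu _ ds (o1 mCA)) sA mulr0.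
apply: (pos_mono hu hA1 ds ps); [exact: oabs|exact/oZ/o1|].
apply: ae_mono gf => w /le_trans; apply.
have /andP[i0 _] := indic_le1 (~` A n) w.
rewrite indicE; case: (boolP (w \in ~` B n)) => [/set_mem nB|_]; last by rewrite mulr0 mulr_ge0.
rewrite mulr1 indicE mem_set ?mulr1; last by move=> Aw; apply: nB; left.
by rewrite leNgt; apply/negP => H; apply: nB; right.
Qed.

(** Disjointness is witnessed by cutting at some [B n]: off it [s] is zero, and on it the modulus of
    an order continuous functional is small. *)
Lemma concentrated_singular s (A : nat -> set Omega) : dual s -> positive s ->
  vanishing P A -> (forall n, s \1_(~` A n) = 0) -> singular s.
Proof.
move=> ds ps vA sA; split=> // z' cz'; have [dz' _] := cz'.
apply: (disjointI hu hA1 ds dz') => f lf f0 e e0.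
have [B [vB _ sB]] := concentrated_fun ds ps vA sA lf.
have [n0 /(_ n0 (leqnn _)) Hn] := order_continuous_abs_tail cz' lf f0 vB e0.
have [mB _ _] := vB.
have mCB : measurable (~` B n0) by exact: measurableC.
exists (fun w => f w * \1_(~` B n0) w).
have lg := oind mCB lf.
have g0 : le0 (fun w => f w * \1_(~` B n0) w).
  by apply: ae_mono f0 => w /= h; rewrite mulr_ge0//; case/andP: (indic_le1 (~` B n0) w).
split=> //.
  by apply: ae_mono f0 => w /= h; rewrite ler_piMr//; case/andP: (indic_le1 (~` B n0) w).
have -> : (fun w => f w - f w * \1_(~` B n0) w) = fun w => f w * \1_(B n0) w.
  by apply/funext => w; rewrite indic_setC; ring.
apply: le_lt_trans Hn; rewrite gerDr.
apply: (le_trans (dual_abs_pos hu hA1 ds ps lg g0)).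
rewrite (sB n0)//; apply: ae_mono f0 => w /= h.
by rewrite normrM ler_wpM2l// ger0_norm//; case/andP: (indic_le1 (~` B n0) w).
Qed.

(** The difference [wf] of two candidates is order continuous. Off [B n] it is the negative of the
    singular functional [z - zr], because [s] vanishes there; being also disjoint from that
    functional, it is zero off each [B n], and order continuity disposes of what remains. *)
Lemma reg_unique z g (A : nat -> set Omega) zr : dual z -> is_density g ->
  positive (fun f => z f - density_functional g f) ->
  vanishing P A -> (forall n, z \1_(~` A n) - density_functional g \1_(~` A n) = 0) ->
  order_continuous zr -> singular (fun f => z f - zr f) ->
  forall f, L f -> zr f = density_functional g f.
Proof.
move=> dz dg ps vA sA cr [ds' sg'].
set s := fun f => z f - density_functional g f.
have ds : dual s by apply: dual_sub => //; exact: density_dual.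
pose wf : functional := fun f => zr f - density_functional g f.
have cw : order_continuous wf by apply: order_continuous_sub => //; exact: density_order_continuous.
have [dw _] := cw.
have key f : L f -> (forall w, 0 <= f w) -> wf f = 0.
  move=> lf f0; have [B [vB AB sB]] := concentrated_fun ds ps vA sA lf.
  have [mB _ _] := vB.
  have w0 n : wf (fun w => f w * \1_(~` B n) w) = 0.
    have mCB : measurable (~` B n) by exact: measurableC.
    have lfn := oind mCB lf.
    have fn0 : le0 (fun w => f w * \1_(~` B n) w).
      by apply: ae_all => w; rewrite mulr_ge0//; case/andP: (indic_le1 (~` B n) w).
    apply/eqP; rewrite -normr_le0; apply/ler_addgt0Pl => e e0; rewrite addr0.
    have [h [lh h0 hf he]] := disjoint_approx hu hA1 ds' dw (sg' _ cw) lfn fn0 e0.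
    apply: le_trans (ltW he).
    have lfh := oB lfn lh.
    have fh0 : le0 (fun w => f w * \1_(~` B n) w - h w) by apply: ae_mono hf => w; rewrite subr_ge0.
    have E : wf (fun w => f w * \1_(~` B n) w) =
        wf h + wf (fun w => f w * \1_(~` B n) w - h w).
      rewrite -(dual_D hu dw lh lfh); congr wf; apply/funext => w; ring.
    rewrite E; apply: (le_trans (ler_normD _ _)); apply: lerD; last first.
      by apply: (dual_abs_ub hu hA1 dw lfh fh0 lfh); apply: ae_mono fh0 => w /= ?; rewrite ger0_norm.
    have -> : wf h = - (z h - zr h).
      have : s h = 0.
        apply: (sB n) => //; apply: ae_mono2 h0 hf => w /= h1 h2.
        by rewrite !ger0_norm.
      by rewrite /s /wf; lra.
    rewrite normrN; apply: (dual_abs_ub hu hA1 ds' lh h0 lh).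
    by apply: ae_mono h0 => w /= ?; rewrite ger0_norm.
  apply/eqP; rewrite -normr_le0; apply/ler_addgt0Pl => e e0; rewrite addr0.
  have [n0 /(_ n0 (leqnn _)) H] := order_continuous_tail cw lf vB e0.
  by rewrite (dual_split dw lf (mB n0)) w0 add0r ltW.
move=> f lf; have mf := omeas lf.
have lp : L (fun w => Num.max (f w) 0).
  apply: (odom _ _ lf); first exact: measurable_maxr.
  by apply: ae_all => w; case: (leP (f w) 0) => //; rewrite normr0.
have ln : L (fun w => Num.max (- f w) 0).
  apply: (odom _ _ lf); first by apply: measurable_maxr => //; exact: measurableT_comp.
  by apply: ae_all => w; case: (leP (- f w) 0) => //; rewrite ?normr0// normrN.
have : wf f = 0.
  rewrite (_ : f = fun w => Num.max (f w) 0 - Num.max (- f w) 0); last first.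
    by apply/funext => w; case: (leP (f w) 0); case: (leP (- f w) 0); lra.
  rewrite (dual_B hu dw lp ln) !key ?subrr// => w; rewrite le_max lexx orbT//.
by rewrite /wf; lra.
Qed.

Lemma hatPhi_ge0 (y : R) : (0 <= hatPhi u y)%E.
Proof.
by apply: ereal_sup_ubound; exists 0 => //; rewrite mul0r (hatu0 hu) sube0.
Qed.

(** The norm bound is used at the near maximizers [x n] of the conjugate at [y = g / K]. The
    integral of [h n] is that of [- x n * y] minus the modular of [x n], hence at most [N (x n)]
    minus this modular, and [lux_le_max] bounds the difference by 1 for all [n]. *)
Lemma density_orlicz g : is_density g -> orlicz P (hatPhi u) g.
Proof.
move=> [mg g0 ig [C HC]]; split=> //.
pose K := Num.max C 1; have K0 : 0 < K by rewrite lt_max ltr01 orbT.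
have HK f : L f -> \int[P]_w (`|f w| * g w) <= K * N f.
  by move=> lf; apply: (le_trans (HC _ lf)); rewrite ler_wpM2r ?lux_ge0// le_max lexx.
exists K^-1; first by rewrite invr_gt0.
pose y w := K^-1 * g w.
have y0 w : 0 <= y w by rewrite mulr_ge0// invr_ge0 ltW.
have my : measurable_fun setT y by exact: measurable_funM.
pose x n w := sel u (qhatPhi a) n (y w).
have ax n w : (a < (x n w)%:E)%E by apply: (sel_a hu) => k; exact: (qhatPhi_a hu).
have x0 n w : x n w <= 0 by exact: sel_le0.
have mx n : measurable_fun setT (x n) /\ measurable_fun setT (fun w => ufin u (x n w)).
  have [m1 m2] := measurable_sel u (qhatPhi a) n.
  by split; [exact: measurableT_comp m1 my|exact: measurableT_comp m2 my].
have lx n : L (x n).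
  have [B HB] := sel_bounded u (qhatPhi a) n.
  by apply: (obd (c := B)); [have [] := mx n|apply: ae_all => w; have [] := HB (y w)].
have ivx n : LI (fun w => ufin u (x n w)).
  have [B HB] := sel_bounded u (qhatPhi a) n.
  apply: (int_dom (g := fun=> B)); [by have [] := mx n| |exact: int_cst].
  by apply: ae_all => w; have [] := HB (y w).
pose h n w := ufin u (x n w) - x n w * y w - ufin u 0.
have ixy n : LI (fun w => x n w * y w).
  have := int_Z K^-1 (ig _ (lx n)); congr (_.-integrable _ _).
  by apply/funext => w /=; rewrite /y; congr EFin; ring.
have ih n : LI (h n) by apply: int_B; [exact: int_B|exact: int_cst].
have modE n : modular P u (x n) = (ufin u 0 - \int[P]_w ufin u (x n w))%:E.
  rewrite /modular (eq_integral (fun w => (ufin u 0 - ufin u (x n w))%:E)); last first.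
    by move=> w _; rewrite (hatu_fin hu) ler0_norm// opprK.
  rewrite exp_fin; last by apply: int_B => //; exact: int_cst.
  by rewrite exp_B ?exp_cst//; exact: int_cst.
have hcvg w : (h n w)%:E @[n --> \oo] --> hatPhi u (y w).
  have -> : hatPhi u (y w) = (hatPhi u (y w) + (ufin u 0)%:E - (ufin u 0)%:E)%E by rewrite addeK.
  rewrite (_ : (fun n => (h n w)%:E) =
    (fun n => (ufin u (x n w) - x n w * y w)%:E - (ufin u 0)%:E)%E); last by apply/funext => n; rewrite -EFinB.
  apply: cvgeB; [by rewrite fin_num_adde_defl|exact: hatPhi_sel_cvg|exact: cvg_cst].
apply: (@le_lt_trans _ _ 1%:E); last exact: ltry.
apply: (@exp_fatou _ _ _ P h (fun w => hatPhi u (y w)) 1) => //.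
- move=> n; apply: ae_all => w; rewrite subr_ge0.
  by have := sel_homo_le u (qhatPhi a) (y w) (leq0n n); rewrite /= mul0r subr0.
- apply: (emeasurable_fun_cvg (fun n w => (h n w)%:E)).
    by move=> n; have /measurable_int := ih n.
  by move=> w _; exact: hcvg.
- by move=> w; exact: hatPhi_ge0.
- move=> n; rewrite /h exp_B; [|exact: int_B|exact: int_cst].
  rewrite exp_B// exp_cst.
  have H1 : - (\int[P]_w (x n w * y w)) <= N (x n).
    have ia : LI (fun w => `|x n w| * g w) by exact: ig (oabs (lx n)).
    have : 0 <= \int[P]_w (K^-1 * (`|x n w| * g w) + x n w * y w).
      apply: exp_ge0; first by apply: int_D => //; exact: int_Z.
      by apply: ae_all => w; rewrite (ler0_norm (x0 n w)) /y; lra.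
    rewrite exp_D ?exp_Z//; last exact: int_Z.
    have : K^-1 * \int[P]_w (`|x n w| * g w) <= N (x n) by rewrite ler_pdivrMl//; exact: HK.
    lra.
  have := lux_le_max hu hA1 (lx n); rewrite modE => /(_ (ltry _)) /= H2.
  have M0 : 0 <= ufin u 0 - \int[P]_w ufin u (x n w).
    by rewrite -lee_fin -modE (modular_ge0 P hu).
  move: H1 H2 M0; case: (leP 1 (ufin u 0 - \int[P]_w ufin u (x n w))); lra.
- apply: ae_all => w M MF; exact: ereal_cvg_ge (hcvg w) MF.
Qed.

End RegularSingular.

(** * Decomposition of positive functionals and the norm of the singular part *)

Section Decomposition.
Context {R : realType} {dd : measure_display} {Omega : measurableType dd}.
Variables (P : probability Omega R) (u : R -> \bar R) (a : \bar R).
Hypotheses (hu : utility u a) (hA1 : A1 u a).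

Local Notation L := (orlicz P (hatu u)).
Local Notation N := (luxemburg P u).
Local Notation LI f := (P.-integrable setT (EFin \o f)).
Local Notation oZ := (orlicz_Z hu).
Local Notation ocst := (orlicz_cst P hu).
Local Notation oabs := (orlicz_abs hu).
Local Notation oind := (orlicz_ind hu).
Local Notation o1 := (orlicz_indic P hu).
Local Notation omeas := (@orlicz_meas _ _ _ P u).
Local Notation dual := (@dual R dd Omega P u).
Local Notation positive := (@positive R dd Omega P u).
Local Notation le0 f := (le_as P (cst 0) f).
Local Notation is_density := (@is_density R dd Omega P u).
Local Notation Edens := (density_functional P).
Implicit Types (f g h : Omega -> R) (z s : @functional R dd Omega).

Definition concentrated s (A : nat -> set Omega) :=
  vanishing P A /\ forall n, s \1_(~` A n) = 0.

(** Explicit form of the decomposition, free of the descriptions [reg] and [dens_reg], which are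
    computed through it. *)
Definition decomposed z g A :=
  [/\ is_density g, positive (fun f => z f - Edens g f) &
      concentrated (fun f => z f - Edens g f) A].

Lemma pos_decomposed z : dual z -> positive z -> exists g A, decomposed z g A.
Proof.
move=> dz pz; have [g [A [mg g0 vA Hg HA]]] := pos_structure hu hA1 dz pz.
have iabs f : L f -> LI (fun w => `|f w| * g w) /\ \int[P]_w (`|f w| * g w) <= z (fun w => `|f w|).
  by move=> lf; apply: Hg => //; exact: oabs.
have dg : is_density g.
  split=> // [f lf|].
    apply: (int_dom (g := fun w => `|f w| * g w)); last by have [] := iabs f lf.
      by apply: measurable_funM => //; exact: omeas lf.
    by apply: ae_all => w; rewrite normrM (ger0_norm (g0 w)).
  have [_ [C zC]] := dz; exists `|C| => f lf; have [_ /le_trans] := iabs f lf; apply.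
  apply: (le_trans (ler_norm _)); apply: (le_trans (zC _ (oabs lf))).
  apply: (@le_trans _ _ (`|C| * N (fun w => `|f w|))).
    by apply: ler_wpM2r; [exact: lux_ge0|exact: ler_norm].
  apply: ler_wpM2l => //; apply: (lux_le_dom hu hA1) => //; first exact: omeas (oabs lf).
  by apply: ae_all => w; rewrite normr_id.
exists g, A; split=> //.
  move=> f lf f0; have df := density_dual hu dg.
  have E : {ae P, forall w, f w = `|f w|} by apply: ae_mono f0 => w /= ?; rewrite ger0_norm.
  rewrite (dual_ae hu hA1 dz lf (oabs lf) E) (dual_ae hu hA1 df lf (oabs lf) E) subr_ge0.
  by have [] := iabs f lf.
by split=> // n; rewrite HA subrr.
Qed.

Lemma concentrated_le s A : dual s -> positive s -> concentrated s A ->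
  forall B, vanishing P B -> (forall n, A n `<=` B n) -> concentrated s B.
Proof.
move=> ds ps [[mA _ _] sA] B [mB dB B0] AB; split=> // n.
have mCA : measurable (~` A n) by exact: measurableC.
have mCB : measurable (~` B n) by exact: measurableC.
apply/eqP; rewrite eq_le; apply/andP; split.
  rewrite -(sA n); apply: (pos_mono hu hA1 ds ps (o1 mCB) (o1 mCA)).
  apply: ae_all => w; rewrite !indicE.
  case: (boolP (w \in ~` B n)) => // /set_mem nB.
  by rewrite mem_set// => /AB.
by apply: ps; [exact: o1|apply: ae_all => w; rewrite indicE].
Qed.

(** The explicit pieces meet the specifications behind [reg] and [dens_reg], so the chosen objects
    satisfy these as well; [reg_unique] and a comparison of integrals over events then identify the
    two. *)
Lemma decomposed_reg z g A : dual z -> decomposed z g A ->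
  [/\ order_continuous P u (reg P u z),
      forall f, L f -> reg P u z f = Edens g f &
      orlicz P (hatPhi u) (dens_reg P u z) /\
      {ae P, forall w, dens_reg P u z w = g w}].
Proof.
move=> dz [dg ps [vA sA]]; have df := density_dual hu dg.
have ds : dual (fun f => z f - Edens g f) by exact: dual_sub.
have [oreg sreg] : order_continuous P u (reg P u z) /\ singular P u (fun f => z f - reg P u z f).
  apply: (@getPex _ [set zr : functional | order_continuous P u zr /\
    singular P u (fun f => z f - zr f)]).
  exists (Edens g); split; first exact: (density_order_continuous hu hA1).
  exact: (concentrated_singular hu hA1 ds ps vA sA).
have rE := reg_unique hu hA1 dz dg ps vA sA oreg sreg.
have [odr Hdr] : [set g : Omega -> R | orlicz P (hatPhi u) g /\
    forall f, L f -> P.-integrable setT (fun w => (f w * g w)%:E) /\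
      (reg P u z f)%:E = (\int[P]_w (f w * g w)%R%:E)%E] (dens_reg P u z).
  apply: getPex; exists g; split; first exact: (density_orlicz hu hA1).
  by have [_ _ ig _] := dg => f lf; split; [exact: ig|rewrite rE// exp_fin//; exact: ig].
split=> //; split=> //.
have [mg g0 ig _] := dg; have [mr _] := odr.
have idr : LI (dens_reg P u z).
  have [i _] := Hdr _ (ocst 1); move: i; congr (_.-integrable _ _).
  by apply/funext => w; rewrite mul1r.
have ig1 : LI g.
  have := ig _ (ocst 1); congr (_.-integrable _ _).
  by apply/funext => w /=; rewrite mul1r.
have key (p q : Omega -> R) : LI p -> LI q ->
    (forall D, measurable D -> \int[P]_w (\1_D w * p w) = \int[P]_w (\1_D w * q w)) ->
    {ae P, forall w, p w <= q w}.
  move=> ip iq H; have mp := int_meas ip; have mq := int_meas iq.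
  pose D := [set w | q w < p w].
  have mD : measurable D by rewrite /D -[X in measurable X]setTI; exact: measurable_fun_ltr.
  have iD (r : Omega -> R) : LI r -> LI (fun w => \1_D w * r w).
    move=> ir; have := int_ind mD ir; congr (_.-integrable _ _).
    by apply/funext => w /=; rewrite mulrC.
  have : {ae P, forall w, \1_D w * p w - \1_D w * q w = 0}.
    apply: exp_eq0.
    - by apply: int_B; exact: iD.
    - apply: ae_all => w; rewrite -mulrBr indicE; case: (boolP (w \in D)) => [/set_mem|_].
        by rewrite /D /= mul1r subr_ge0 => /ltW.
      by rewrite mul0r.
    - by rewrite exp_B; [rewrite H// subrr|exact: iD|exact: iD].
  apply: ae_mono => w; rewrite -mulrBr indicE; case: (boolP (w \in D)) => [_|].
    by rewrite mul1r => /subr0_eq ->.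
  by move=> /negP nD _; rewrite leNgt; apply/negP => /mem_set.
have H D : measurable D -> \int[P]_w (\1_D w * dens_reg P u z w) = \int[P]_w (\1_D w * g w).
  move=> mD; have [i1 E1] := Hdr _ (o1 mD).
  by apply: EFin_inj; rewrite -exp_fin// -E1 rE//; exact: o1.
have h1 := key _ _ idr ig1 H.
have h2 := key _ _ ig1 idr (fun D mD => esym (H D mD)).
by apply: ae_mono2 h1 h2 => w l1 l2; apply/eqP; rewrite eq_le l1.
Qed.

Lemma dens_regP z : dual z -> positive z ->
  [/\ measurable_fun setT (dens_reg P u z), le0 (dens_reg P u z) &
      forall f, L f -> LI (fun w => f w * dens_reg P u z w) /\
        reg P u z f = \int[P]_w (f w * dens_reg P u z w)].
Proof.
move=> dz pz; have [g [A dec]] := pos_decomposed dz pz.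
have [oreg rE [[mdr _] drE]] := decomposed_reg dz dec.
have [[mg g0 ig _] _ _] := dec.
split=> // [|f lf]; first by apply: ae_mono drE => w /= ->.
have mf := omeas lf.
have E : {ae P, forall w, f w * g w = f w * dens_reg P u z w} by apply: ae_mono drE => w ->.
split; first by apply: int_ae E (ig _ lf); exact: measurable_funM.
by rewrite rE//; apply: exp_ae => //; exact: measurable_funM.
Qed.

Lemma sing_dual z : dual z -> positive z -> dual (sing P u z).
Proof.
move=> dz pz; have [g [A dec]] := pos_decomposed dz pz.
by have [[dr _] _ _] := decomposed_reg dz dec; exact: dual_sub.
Qed.

Lemma sing_positive z : dual z -> positive z -> positive (sing P u z).
Proof.
move=> dz pz f lf f0; have [g [A dec]] := pos_decomposed dz pz.
have [_ rE _] := decomposed_reg dz dec; have [_ ps _] := dec.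
by rewrite /sing rE//; exact: ps.
Qed.

Lemma sing_concentrated z : dual z -> positive z -> exists A, concentrated (sing P u z) A.
Proof.
move=> dz pz; have [g [A dec]] := pos_decomposed dz pz.
have [_ rE _] := decomposed_reg dz dec; have [_ _ [vA sA]] := dec.
exists A; split=> // n; rewrite /sing rE//; apply: o1; apply: measurableC.
by have [] := vA.
Qed.

Lemma reg_sing z f : z f = reg P u z f + sing P u z f.
Proof. by rewrite /sing addrC subrK. Qed.

(** ** Nonnegative combinations *)

Definition combine (c d : R) z1 z2 : functional := fun f => c * z1 f + d * z2 f.

Lemma positive_combine (c d : R) z1 z2 : 0 <= c -> 0 <= d -> positive z1 -> positive z2 ->
  positive (combine c d z1 z2).
Proof. by move=> c0 d0 p1 p2 f lf f0; rewrite addr_ge0// mulr_ge0// ?p1 ?p2. Qed.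

Lemma decomposed_combine (c d : R) z1 z2 g1 g2 A1 A2 : 0 <= c -> 0 <= d ->
  dual z1 -> dual z2 -> decomposed z1 g1 A1 -> decomposed z2 g2 A2 ->
  exists A, decomposed (combine c d z1 z2) (fun w => c * g1 w + d * g2 w) A.
Proof.
move=> c0 d0 dz1 dz2 [dg1 p1 k1] [dg2 p2 k2].
have [mg1 g10 ig1 [C1 HC1]] := dg1; have [mg2 g20 ig2 [C2 HC2]] := dg2.
have E f : L f -> LI (fun w => f w * (c * g1 w + d * g2 w)) /\
    \int[P]_w (f w * (c * g1 w + d * g2 w)) = c * Edens g1 f + d * Edens g2 f.
  move=> lf; have -> : (fun w => f w * (c * g1 w + d * g2 w)) =
      fun w => c * (f w * g1 w) + d * (f w * g2 w) by apply/funext => w; ring.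
  split; first by apply: int_D; apply: int_Z; [exact: ig1|exact: ig2].
  rewrite exp_D; [|exact/int_Z/ig1|exact/int_Z/ig2].
  by rewrite !exp_Z//; [exact: ig2|exact: ig1].
have dg : is_density (fun w => c * g1 w + d * g2 w).
  split.
  - by apply: measurable_funD; apply: measurable_funM.
  - by move=> w; rewrite addr_ge0// mulr_ge0.
  - by move=> f /E[].
  - exists (c * C1 + d * C2) => f lf; have [_ ->] := E _ (oabs lf).
    by rewrite mulrDl -!mulrA lerD// ler_wpM2l// ?HC1 ?HC2.
pose s1 : functional := fun f => z1 f - Edens g1 f.
pose s2 : functional := fun f => z2 f - Edens g2 f.
have sE f : L f -> combine c d z1 z2 f - Edens (fun w => c * g1 w + d * g2 w) f =
    c * s1 f + d * s2 f.
  by move=> lf; have [_ Ef] := E f lf; rewrite [Edens (fun w => c * g1 w + d * g2 w) f]Ef /combine /s1 /s2; ring.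
have ds1 : dual s1 by apply: dual_sub => //; exact: (density_dual hu).
have ds2 : dual s2 by apply: dual_sub => //; exact: (density_dual hu).
have [v1 _] := k1; have [v2 _] := k2; have vA := vanishingU v1 v2.
have [_ h1] := concentrated_le ds1 p1 k1 vA (fun n w => @or_introl _ _).
have [_ h2] := concentrated_le ds2 p2 k2 vA (fun n w => @or_intror _ _).
exists (fun n => A1 n `|` A2 n); split=> //.
  by move=> f lf f0; rewrite sE// addr_ge0// mulr_ge0// ?p1 ?p2.
split=> // n; have mC : measurable (~` (A1 n `|` A2 n)).
  by apply: measurableC; have [] := vA.
rewrite sE; last exact: o1.
by rewrite [s1 _]h1 [s2 _]h2 !mulr0 addr0.
Qed.

(** As [reg] is chosen for each functional separately, linearity comes from adding explicit
    decompositions over the unions of their vanishing events. *)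
Lemma dens_reg_combine (c d : R) z1 z2 : 0 <= c -> 0 <= d -> dual z1 -> dual z2 ->
  positive z1 -> positive z2 ->
  {ae P, forall w, dens_reg P u (combine c d z1 z2) w =
                   c * dens_reg P u z1 w + d * dens_reg P u z2 w} /\
  (forall f, L f -> sing P u (combine c d z1 z2) f = c * sing P u z1 f + d * sing P u z2 f).
Proof.
move=> c0 d0 dz1 dz2 p1 p2.
have [g1 [A1 dec1]] := pos_decomposed dz1 p1.
have [g2 [A2 dec2]] := pos_decomposed dz2 p2.
have [A dec] := decomposed_combine c0 d0 dz1 dz2 dec1 dec2.
have dc : dual (combine c d z1 z2) by exact: dual_comb.
have [_ r1 [_ E1]] := decomposed_reg dz1 dec1.
have [_ r2 [_ E2]] := decomposed_reg dz2 dec2.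
have [_ r [_ E]] := decomposed_reg dc dec.
have [[_ _ ig1 _] _ _] := dec1; have [[_ _ ig2 _] _ _] := dec2.
split.
  have E12 : {ae P, forall w, c * g1 w + d * g2 w = c * dens_reg P u z1 w + d * dens_reg P u z2 w}.
    by apply: ae_mono2 E1 E2 => w -> ->.
  by apply: ae_mono2 E E12 => w ->.
move=> f lf; rewrite /sing r// r1// r2// /combine /density_functional.
have -> : (fun w => f w * (c * g1 w + d * g2 w)) =
    fun w => c * (f w * g1 w) + d * (f w * g2 w) by apply/funext => w; ring.
rewrite exp_D; [|exact/int_Z/ig1|exact/int_Z/ig2].
by rewrite !exp_Z; [ring|exact: ig2|exact: ig1].
Qed.

Lemma dual_norm_combine (c d : R) z1 z2 : 0 <= c -> 0 <= d -> dual z1 -> dual z2 ->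
  dual_norm P u (combine c d z1 z2) <= c * dual_norm P u z1 + d * dual_norm P u z2.
Proof.
move=> c0 d0 d1 d2; apply: (dual_norm_le hu hA1); first exact: dual_comb.
move=> f lf Nf; apply: (le_trans (ler_normD _ _)); rewrite !normrM (ger0_norm c0) (ger0_norm d0).
by apply: lerD; apply: ler_wpM2l => //; exact: (dual_norm_ub hu hA1).
Qed.

(** ** The norm of a singular functional *)

Lemma hatu_ind f (A : set Omega) w : hatu u (f w * \1_A w) = (hatu u (f w) * (\1_A w)%:E)%E.
Proof.
rewrite indicE; case: (w \in A); rewrite ?mulr1 ?mulr0 ?mule1//.
by rewrite mule0 (hatu0 hu).
Qed.

(** Off [B n] the functional does not see [f], and on [B n] the modular of [f] tends to 0 with [n].
    So [f] may be replaced by a function of modular at most 1, hence in the unit ball, however large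
    its own modular is. *)
Lemma sing_le_norm s f A : dual s -> positive s -> concentrated s A -> L f ->
  (modular P u f < +oo)%E -> s (fun w => `|f w|) <= dual_norm P u s.
Proof.
move=> ds ps [vA sA] lf mf.
have [B [vB _ sB]] := concentrated_fun hu hA1 ds ps vA sA lf.
have mf' := omeas lf; have mhf := measurable_hatu_comp hu mf'.
pose F w := fine (hatu u (f w)).
have ihf : P.-integrable setT (fun w => hatu u (f w)).
  apply/integrableP; split=> //; rewrite (eq_integral (fun w => hatu u (f w)))//.
  by move=> w _; rewrite gee0_abs// (hatu_ge0 hu).
have FE : {ae P, forall w, hatu u (f w) = (F w)%:E}.
  by apply: ae_mono (integrable_ae measurableT ihf) => w /(_ I) ?; rewrite fineK.
have iF : LI F.
  apply/integrableP; split; first by apply/measurable_EFinP; exact: measurableT_comp.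
  move/integrableP : ihf => [_]; apply: le_lt_trans; apply: ae_ge0_le_integral => //.
  - apply: measurableT_comp => //; apply/measurable_EFinP; exact: measurableT_comp.
  - exact: measurableT_comp.
  - by apply: ae_mono FE => w E _; rewrite E.
have [n0 /(_ n0 (leqnn _)) Hn] := vanishing_tail vB iF (ltr01 : 0 < 1 :> R).
have [mB _ _] := vB; have mBn := mB n0.
have mod1 : (modular P u (fun w => f w * \1_(B n0) w)%R <= 1)%E.
  have -> : modular P u (fun w => f w * \1_(B n0) w) = (\int[P]_w (F w * \1_(B n0) w)%:E)%E.
    apply: ae_eq_integral => //.
    - apply: (measurable_hatu_comp hu); apply: measurable_funM => //.
    - by have /measurable_int := int_ind mBn iF.
    - by apply: ae_mono FE => w E _; rewrite hatu_ind E.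
  rewrite exp_fin; last exact: int_ind.
  by rewrite lee_fin ltW// (le_lt_trans (ler_norm _)).
have lfB := oind mBn lf.
rewrite (dual_split hu ds (oabs lf) mBn) [X in X + _](sB n0); last 2 first.
- by apply: oind; [exact: measurableC|exact: oabs].
- by apply: ae_all => w; rewrite normrM normr_id ler_wpM2l// ger0_norm//; case/andP: (@indic_le1 R _ (~` B n0) w).
rewrite add0r (le_trans (ler_norm _))//.
have -> : (fun w => `|f w| * \1_(B n0) w) = fun w => `|f w * \1_(B n0) w|.
  by apply/funext => w; rewrite normrM (ger0_norm (x := \1__ w))//; case/andP: (@indic_le1 R _ (B n0) w).
apply: (dual_norm_ub hu hA1 ds (oabs lfB)); apply: (lux_le1 hu hA1); first exact: omeas (oabs lfB).
rewrite /modular (eq_integral (fun w => hatu u (f w * \1_(B n0) w)))// => w _.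
exact: hatu_norm.
Qed.

(** Partial converse of [sing_le_norm]. The finite modular of [h] is what makes [- h] an admissible
    argument of the utility. *)
Lemma sing_norm_approx s (e : R) : dual s -> positive s -> 0 < e -> exists h,
  [/\ L h, forall w, 0 <= h w, (modular P u h < +oo)%E & dual_norm P u s - e <= s h].
Proof.
move=> ds ps e0; have e20 : 0 < e / 2 by rewrite divr_gt0.
have [_ [f [lf Nf] <-] Hf] := sup_adherent e20 (dual_norm_has_sup hu hA1 ds).
rewrite -/(dual_norm P u s) in Hf.
have dn0 := dual_norm_ge0 hu hA1 ds.
set dn := dual_norm P u s in Hf dn0 *.
have dn1 : 0 < dn + e by rewrite ltr_wpDl.
(* Shrinking by [1 - t] gives the strict margin that [lux_lt] asks for, and the loss is at most
   [t * (dn + e) = e / 2]. *)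
pose t := (e / 2) / (dn + e).
have t0 : 0 < t by rewrite divr_gt0.
have t1 : t < 1 by rewrite /t ltr_pdivrMr// mul1r; lra.
have c1 : 1 < (1 - t)^-1 by rewrite invf_gt1; lra.
exists (fun w => (1 - t) * `|f w|); split.
- exact/oZ/oabs.
- by move=> w; rewrite mulr_ge0//; lra.
- have := lux_lt hu hA1 lf (le_lt_trans Nf c1); rewrite invrK => H.
  apply: (@le_lt_trans _ _ 1%E); last exact: ltry.
  apply: le_trans H; rewrite le_eqVlt; apply/orP; left; apply/eqP.
  apply: eq_integral => w _; rewrite -[RHS](hatu_norm u) normrM mulrC [`|1 - t|]ger0_norm//; lra.
- rewrite (dual_Z hu _ ds (oabs lf)).
  have := pos_abs hu hA1 ds ps lf.
  have E : t * (dn + e) = e / 2 by rewrite /t divfK// gt_eqF.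
  set sf := s _; set sf' := s _ in Hf *; nra.
Qed.

Lemma sing_cst_le s (A : nat -> set Omega) (c : R) : dual s -> positive s -> concentrated s A ->
  0 <= c -> (a < (- c)%:E)%E -> c * s (cst 1) <= dual_norm P u s.
Proof.
move=> ds ps cs c0 ac.
have := @sing_le_norm s (fun=> c) A ds ps cs (ocst c).
rewrite (_ : (fun=> `|c|) = (fun w => c * cst 1 w)); last first.
  by apply/funext => w; rewrite mulr1 ger0_norm.
rewrite (dual_Z hu _ ds (ocst 1)); apply.
rewrite /modular (eq_integral (cst (ufin u 0 - ufin u (- c))%:E)).
  by rewrite integral_cst// [X in (_ * X)%E](_ : _ = 1%E) ?mule1 ?ltry//; exact: probability_setT.
by move=> w _; rewrite (hatu_fin hu) ger0_norm.
Qed.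

(** If the domain ends at a finite [r], [hatu u] is infinite beyond [- r], so members of the unit
    ball are bounded by [- r * c] almost surely for every [c > 1]. *)
Lemma sing_norm_fin s (r : R) : dual s -> positive s -> a = r%:E ->
  dual_norm P u s <= - r * s (cst 1).
Proof.
move=> ds ps ar; have r0 : r < 0 by have := a_lt0 hu; rewrite ar lte_fin.
have s10 : 0 <= s (cst 1) by apply: ps; [exact: ocst|exact: ae_all].
apply: (dual_norm_le hu hA1 ds) => f lf Nf.
apply: (le_trans (pos_abs hu hA1 ds ps lf)).
suff key c : 1 < c -> s (fun w => `|f w|) <= c * (- r * s (cst 1)).
  apply/ler_addgt0Pl => e e0.
  set k := - r * s (cst 1); have k0 : 0 <= k by rewrite mulr_ge0//; lra.
  have := key (1 + e / (k + 1)); rewrite ltrDl divr_gt0 ?ltr_wpDl// => /(_ isT) /le_trans; apply.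
  rewrite mulrDl mul1r addrC lerD2r mulrAC ler_pdivrMr ?ltr_wpDl// ler_wpM2l ?(ltW e0)//.
  by rewrite lerDl.
move=> c1; have c0 : 0 < c by rewrite (lt_trans ltr01).
have := lux_lt hu hA1 lf (le_lt_trans Nf c1) => H.
have mfc : measurable_fun setT (fun w => f w / c) by apply: measurable_funM => //; exact: omeas lf.
have ihf : P.-integrable setT (fun w => hatu u (f w / c)).
  apply/integrableP; split; first exact: (measurable_hatu_comp hu).
  rewrite (eq_integral (fun w => hatu u (f w / c))); last first.
    by move=> w _; rewrite gee0_abs// (hatu_ge0 hu).
  by apply: le_lt_trans H _; exact: ltry.
rewrite mulrA -(dual_Z hu _ ds (ocst 1)).
apply: (pos_mono hu hA1 ds ps (oabs lf)); first exact/oZ/ocst.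
apply: ae_mono (integrable_ae measurableT ihf) => w /(_ I) fin.
have ux : (-oo < u (- `|f w / c|)%R)%E.
  by apply: contraT => H'; move: fin; rewrite (hatuE_y hu H').
have := gtNy_le_a hu ux; rewrite ar lee_fin normrM (ger0_norm (x := c^-1)) ?invr_ge0 ?(ltW c0)//.
rewrite lerNr ler_pdivrMr// mulr1; lra.
Qed.

(** If the domain is the whole line, every constant has finite modular, so all positive multiples of
    the mass stay below the norm. *)
Lemma sing_cst0 s (A : nat -> set Omega) : dual s -> positive s -> concentrated s A ->
  a = -oo%E -> s (cst 1) = 0.
Proof.
move=> ds ps cs aN; apply/eqP; rewrite eq_le; apply/andP; split; last first.
  by apply: ps; [exact: ocst|exact: ae_all].
rewrite leNgt; apply/negP => s0.
have dn0 := dual_norm_ge0 hu hA1 ds.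
have := @sing_cst_le s A ((dual_norm P u s + 1) / s (cst 1)) ds ps cs.
rewrite divr_ge0 ?addr_ge0 ?(ltW s0)// aN ltNyr divfK ?gt_eqF// => /(_ isT isT).
lra.
Qed.

End Decomposition.

(** * The Hahn-Banach theorem *)

(* A sublinear functional that is minimal for the pointwise order is linear. *)
Section HahnBanach.
Context {R : realType} {V : lmodType R}.
Variable X : set V.
Hypothesis X0 : X 0.
Hypothesis XD : forall x y, X x -> X y -> X (x + y).
Hypothesis XZ : forall (c : R) x, X x -> X (c *: x).
Implicit Types (p q r : V -> R) (x y : V).

(** Relative to the subspace [X], so that the Orlicz space can remain a set of functions.
    Homogeneity is stated as an inequality; the reverse one follows by scaling with [c^-1]. *)
Definition sublinear q := (forall x y, X x -> X y -> q (x + y) <= q x + q y) /\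
  (forall (c : R) x, 0 < c -> X x -> q (c *: x) <= c * q x).

Lemma XN x : X x -> X (- x).
Proof. by move=> /(XZ (-1)); rewrite scaleN1r. Qed.

Lemma sublinearZ q (c : R) x : sublinear q -> 0 < c -> X x -> q (c *: x) = c * q x.
Proof.
move=> [_ qZ] c0 Xx; apply/eqP; rewrite eq_le qZ//=.
have := qZ c^-1 (c *: x); rewrite invr_gt0 scalerA mulVf ?gt_eqF// scale1r => /(_ c0 (XZ c Xx)).
by rewrite mulrC ler_pdivlMr// mulrC.
Qed.

Lemma sublinear0 q : sublinear q -> q 0 = 0.
Proof.
by move=> sq; have := sublinearZ sq (ltr0Sn R 1) X0; rewrite scaler0; lra.
Qed.

Lemma sublinearN q x : sublinear q -> X x -> - q (- x) <= q x.
Proof.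
move=> sq Xx; have := sq.1 x (- x) Xx (XN Xx); rewrite subrr sublinear0//; lra.
Qed.

(** Totality of the chain gives subadditivity of the infimum: of two near-optimal members, the
    smaller one serves at both points. The infimum is finite because all members lie above
    [- p (- x)]. *)
Lemma sublinear_chain p (A : set (V -> R)) : sublinear p ->
  (forall q, A q -> sublinear q /\ forall x, X x -> q x <= p x) ->
  A !=set0 ->
  (forall q r, A q -> A r -> (forall x, X x -> q x <= r x) \/ (forall x, X x -> r x <= q x)) ->
  let m x := inf [set q x | q in A] in
  [/\ sublinear m, forall x, X x -> m x <= p x & forall q, A q -> forall x, X x -> m x <= q x].
Proof.
move=> sp HA [q0 Aq0] tot m.
have lbA x : X x -> has_lbound [set q x | q in A].
  move=> Xx; exists (- p (- x)) => _ [q Aq <-]; have [sq qp] := HA q Aq.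
  by apply: le_trans (sublinearN sq Xx); rewrite lerN2 qp//; exact: XN.
have S0 x : [set q x | q in A] !=set0 by exists (q0 x), q0.
have mle q x : A q -> X x -> m x <= q x by move=> Aq Xx; apply: ge_inf; [exact: lbA|exists q].
split=> [|x Xx|q Aq x Xx]; [split=> [x y Xx Xy|c x c0 Xx]| |exact: mle].
- apply/ler_addgt0Pl => e e0; have e20 : 0 < e / 2 by rewrite divr_gt0.
  have [|_ [q Aq <-] Hq] := inf_lt (S0 x) (x := m x + e / 2); first by rewrite ltrDl.
  have [|_ [r Ar <-] Hr] := inf_lt (S0 y) (x := m y + e / 2); first by rewrite ltrDl.
  have XDxy := XD Xx Xy.
  have [H|H] := tot q r Aq Ar.
    have := (HA q Aq).1.1 x y Xx Xy; have := mle q _ Aq XDxy; have := H y Xy; lra.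
  have := (HA r Ar).1.1 x y Xx Xy; have := mle r _ Ar XDxy; have := H x Xx; lra.
- rewrite mulrC -ler_pdivrMr//; apply: lb_le_inf => // _ [q Aq <-].
  rewrite ler_pdivrMr// mulrC; apply: le_trans (mle q _ Aq (XZ c Xx)) _.
  exact: (HA q Aq).1.2.
- by apply: le_trans (mle _ _ Aq0 Xx) _; exact: (HA _ Aq0).2.
Qed.

Lemma minimal_sublinear p : sublinear p -> exists q, [/\ sublinear q,
  forall x, X x -> q x <= p x &
  forall r, sublinear r -> (forall x, X x -> r x <= q x) -> forall x, X x -> q x <= r x].
Proof.
move=> sp; pose T := {q : V -> R | sublinear q /\ forall x, X x -> q x <= p x}.
(* The order is reversed, as Zorn's lemma yields maximal elements. *)
pose le (q r : T) := `[< forall x, X x -> sval r x <= sval q x >].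
have t0 : T by exists p; split.
have [||A tot|[q [sq qp]] Hq] := @ZL_preorder T t0 le.
- by move=> q; apply/asboolP.
- move=> q1 q2 q3 /asboolP h1 /asboolP h2; apply/asboolP => x Xx.
  exact: le_trans (h2 x Xx) (h1 x Xx).
- have [[q0 Aq0]|nA] := pselect (A !=set0); last by exists t0 => s As; exfalso; apply: nA; exists s.
  pose B := [set sval q | q in A].
  have [||q r [q' Aq' <-] [r' Ar' <-]|sm mp mA] := @sublinear_chain p B sp.
  + by move=> _ [[q Hq] Aq <-].
  + by exists (sval q0), q0.
  + by case: (tot _ _ Aq' Ar') => /asboolP H; [right|left].
  + exists (exist (fun q : V -> R => sublinear q /\ forall x, X x -> q x <= p x) _ (conj sm mp)) => s As; apply/asboolP => x Xx /=; apply: mA => //; by exists s.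
- exists q; split=> // r sr rq.
  have rp x : X x -> r x <= p x by move=> Xx; exact: le_trans (rq x Xx) (qp x Xx).
  by have /asboolP := Hq (exist _ r (conj sr rp)) (asboolT rq); exact.
Qed.

Theorem Hahn_Banach p : sublinear p -> exists z : V -> R,
  (forall (c : R) x y, X x -> X y -> z (c *: x + y) = c * z x + z y) /\
  (forall x, X x -> z x <= p x).
Proof.
move=> sp; have [q [sq qp qmin]] := minimal_sublinear sp; exists q; split=> //.
have qD x y : X x -> X y -> q (x + y) = q x + q y.
  move=> Xx Xy; apply/eqP; rewrite eq_le sq.1//=.
  (* Subtracting the slope along [y] gives a sublinear functional below [q], hence equal to it by
     minimality; the term [t = 1] of the infimum is the reverse of subadditivity. *)
  pose S x := [set q (x + t *: y) - t * q y | t in [set t : R | 0 <= t]].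
  pose r x := inf (S x).
  have S0 x' : S x' !=set0 by exists (q (x' + 0 *: y) - 0 * q y); exists 0 => //=.
  have lbS x' : X x' -> has_lbound (S x').
    move=> Xx'; exists (- q (- x')) => _ [t /= t0 <-].
    have Xty := XZ t Xy.
    have : q (t *: y) <= q (x' + t *: y) + q (- x').
      have := sq.1 (x' + t *: y) (- x') (XD Xx' Xty) (XN Xx').
      by rewrite addrAC subrr add0r.
    have /predU1P[<-|{}t0] : (0 == t) || (0 < t) by rewrite -le_eqVlt.
      by rewrite scale0r mul0r sublinear0//; lra.
    by rewrite sublinearZ//; lra.
  have rle x' t : X x' -> 0 <= t -> r x' <= q (x' + t *: y) - t * q y.
    by move=> Xx' t0; apply: ge_inf; [exact: lbS|exists t].
  have sr : sublinear r.
    split=> [x1 x2 X1 X2|c x1 c0 X1].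
      apply/ler_addgt0Pl => e e0; have e20 : 0 < e / 2 by rewrite divr_gt0.
      have [|_ [t1 /= t10 <-] H1] := inf_lt (S0 x1) (x := r x1 + e / 2); first by rewrite ltrDl.
      have [|_ [t2 /= t20 <-] H2] := inf_lt (S0 x2) (x := r x2 + e / 2); first by rewrite ltrDl.
      have := rle _ _ (XD X1 X2) (addr_ge0 t10 t20).
      have := sq.1 _ _ (XD X1 (XZ t1 Xy)) (XD X2 (XZ t2 Xy)).
      by rewrite addrACA -scalerDl mulrDl; lra.
    rewrite mulrC -ler_pdivrMr//; apply: lb_le_inf => // _ [t /= t0 <-].
    rewrite ler_pdivrMr// mulrC.
    have ct0 : 0 <= c * t by rewrite mulr_ge0// ltW.
    apply: le_trans (rle _ _ (XZ c X1) ct0) _.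
    rewrite -scalerA -scalerDr sublinearZ//; first by rewrite mulrBr mulrA.
    exact: XD X1 (XZ t Xy).
  have rq x' : X x' -> r x' <= q x'.
    by move=> Xx'; have := rle _ _ Xx' (lexx 0); rewrite scale0r addr0 mul0r subr0.
  have := qmin r sr rq x Xx; have := rle _ _ Xx ler01.
  by rewrite scale1r mul1r; lra.
have qN x : X x -> q (- x) = - q x.
  by move=> Xx; have := qD x (- x) Xx (XN Xx); rewrite subrr sublinear0//; lra.
move=> c x y Xx Xy; rewrite qD//; last exact: XZ.
congr (_ + _); have [c0|c0|->] := ltrgtP c 0.
- have c0' : 0 < - c by rewrite oppr_gt0.
  rewrite -[c]opprK scaleNr qN ?sublinearZ ?mulNr//; exact: XZ.
- by rewrite sublinearZ.
- by rewrite scale0r mul0r sublinear0.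
Qed.

End HahnBanach.

(** * Expected utility *)

Section ExpectedUtility.
Context {R : realType} {dd : measure_display} {Omega : measurableType dd}.
Variables (P : probability Omega R) (u : R -> \bar R) (a : \bar R).
Hypotheses (hu : utility u a) (hA1 : A1 u a).
Local Notation L := (orlicz P (hatu u)).
Local Notation LI f := (P.-integrable setT (EFin \o f)).
Local Notation olin := (orlicz_lin hu hA1).
Local Notation oint := (orlicz_int hu hA1).
Local Notation ocst := (orlicz_cst P hu).
Local Notation omeas := (@orlicz_meas _ _ _ P u).

Local Notation v := (ufin u).
Local Notation eu := (expected_utility P u).
Local Notation Phi := (Phi u).
Local Notation phi := (phi u).
Implicit Types (f g h : Omega -> R).

Lemma integrable_posneg (G : Omega -> \bar R) : measurable_fun setT G ->
  (\int[P]_w (G ^\+ w) < +oo)%E -> (\int[P]_w (G ^\- w) < +oo)%E ->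
  P.-integrable setT G.
Proof.
move=> mG hp hn; apply/integrableP; split=> //.
have -> : (fun w => `|G w|%E) = (fun w => (G ^\+ w + G ^\- w)%E).
  by rewrite -fune_abse.
rewrite ge0_integralD//; [exact: lte_add_pinfty|exact: measurable_funepos|exact: measurable_funeneg].
Qed.

Lemma int_fine (G : Omega -> \bar R) : P.-integrable setT G ->
  LI (fun w => fine (G w)) /\ {ae P, forall w, G w = (fine (G w))%:E}.
Proof.
move=> iG; have /integrableP[mG hG] := iG; split; last first.
  by have := integrable_ae measurableT iG; apply: ae_mono => w /(_ I) /fineK.
have mf : measurable_fun setT (fun w => fine (G w)) by exact: measurableT_comp (fine_measurable _) mG.
apply/integrableP; split; first exact/measurable_EFinP.
apply: le_lt_trans hG; apply: ge0_le_integral => //.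
- by apply/measurable_EFinP; exact: measurableT_comp.
- exact: measurableT_comp.
- by move=> w _ /=; case: (G w) => [r| |] //=; rewrite normr0 leey.
Qed.

Lemma measurable_uext : measurable_fun setT (uext u).
Proof.
rewrite (_ : uext u = fun x => if x == +oo%E then uinfty u else
  if x == -oo%E then -oo%E else u (fine x)); last by apply/funext => -[r| |].
have me (y : \bar R) : measurable_fun setT (fun x : \bar R => x == y).
  apply: (measurable_fun_bool true) => /=; rewrite setTI.
  rewrite (_ : _ @^-1` _ = [set y]); first exact: emeasurable_set1.
  by apply/seteqP; split => x /= /eqP.
apply: measurable_fun_ifT => //; apply: measurable_fun_ifT => //.
exact: measurableT_comp (measurable_u hu) (fine_measurable _).
Qed.

Lemma eu_eq (f : Omega -> \bar R) h : measurable_fun setT f -> LI h ->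
  {ae P, forall w, uext u (f w) = (h w)%:E} -> eu f = (\int[P]_w h w)%:E.
Proof.
move=> mf ih fh; rewrite /expected_utility.
have mg : measurable_fun setT (fun w => uext u (f w)) by exact: measurableT_comp measurable_uext mf.
have mh := int_meas ih.
have -> : (\int[P]_w (fun w => uext u (f w)) ^\- w = \int[P]_w (EFin \o h) ^\- w)%E.
  apply: ae_eq_integral => //; [exact: measurable_funeneg| |].
    by apply: measurable_funeneg; exact/measurable_EFinP.
  by apply: ae_mono fh => w fh _; rewrite !funenegE /= fh.
have := integrable_neg_fin_num measurableT ih; rewrite fin_numE => /andP[_ /negbTE ->].
rewrite -exp_fin//; apply: ae_eq_integral => //; first exact/measurable_EFinP.
by apply: ae_mono fh => w -> _.
Qed.

(** An integrable upper bound makes the positive part integrable, so the convention for expectations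
    leaves only these two cases. *)
Lemma eu_dom (f : Omega -> \bar R) (H : Omega -> R) : measurable_fun setT f -> LI H ->
  {ae P, forall w, uext u (f w) <= (H w)%:E}%E ->
  eu f = -oo%E \/ exists h, [/\ LI h, {ae P, forall w, uext u (f w) = (h w)%:E} &
    eu f = (\int[P]_w h w)%:E].
Proof.
move=> mf iH fH.
have mg : measurable_fun setT (fun w => uext u (f w)) by exact: measurableT_comp measurable_uext mf.
have [/eqP e|e] := boolP (\int[P]_w (fun w => uext u (f w)) ^\- w == +oo)%E.
  by left; rewrite /expected_utility e eqxx.
right; set g := fun w => uext u (f w).
have ig : P.-integrable setT g.
  apply: integrable_posneg => //; last by rewrite ltey.
  have /integrableP[_] := int_abs iH; apply: le_lt_trans; apply: ae_ge0_le_integral => //.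
  - exact: measurable_funepos.
  - by apply: measurableT_comp => //; have /measurable_int := int_abs iH.
  - apply: ae_mono fH => w fH _; rewrite funeposE /= normr_id ge_max lee_fin normr_ge0 andbT.
    by apply: (le_trans fH); rewrite lee_fin ler_norm.
have [ih fh] := int_fine ig; exists (fun w => fine (g w)); split=> //; exact: eu_eq.
Qed.

Lemma eu_le (f : Omega -> \bar R) (H : Omega -> R) : measurable_fun setT f -> LI H ->
  {ae P, forall w, uext u (f w) <= (H w)%:E}%E -> (eu f <= (\int[P]_w H w)%:E)%E.
Proof.
move=> mf iH fH; have [->|[h [ih fh ->]]] := eu_dom mf iH fH; first exact: leNye.
rewrite lee_fin; apply: exp_le => //; apply: (ae_mono2 _ fH fh) => w + e.
by rewrite e lee_fin.
Qed.

Definition fin_entropy (y : Omega -> R) :=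
  LI (fun w => phi (y w)) /\ {ae P, forall w, Phi (y w) < +oo}%E.

Lemma measurable_Phi_comp (y : Omega -> R) : measurable_fun setT y ->
  measurable_fun setT (fun w => Phi (y w)).
Proof. by move=> my; exact: measurableT_comp (measurable_Phi hu) my. Qed.

Lemma fin_entropyP (y : Omega -> R) : measurable_fun setT y ->
  (\int[P]_w Phi (y w) < +oo)%E ->
  fin_entropy y /\ (\int[P]_w Phi (y w) = (\int[P]_w phi (y w))%:E)%E.
Proof.
move=> my hy; have mP := measurable_Phi_comp my.
have i : P.-integrable setT (fun w => Phi (y w)).
  have hn : (\int[P]_w (fun w => Phi (y w)) ^\- w < +oo)%E.
    have /integrableP[_] := int_cst P `|v 0|; apply: le_lt_trans.
    apply: ge0_le_integral => //; first exact: measurable_funeneg.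
    move=> w _; rewrite funenegE /= normr_id ge_max lee_fin normr_ge0 andbT.
    apply: (@le_trans _ _ (- (v 0)%:E)%E); first by rewrite leeN2 (Phi_ge hu).
    by rewrite lee_fin -normrN ler_norm.
  apply: integrable_posneg => //.
  move: hy; rewrite integralE ltNge leye_eq => /negP hy; rewrite ltey; apply/negP => /eqP e.
  by apply: hy; rewrite e addye// -ltNye lteNr.
have [ih fh] := int_fine i.
split; [split=> //|]; first by apply: ae_mono fh => w ->; rewrite ltry.
rewrite -exp_fin//; apply: ae_eq_integral => //; first by have /measurable_int := ih.
by apply: ae_mono fh => w ->.
Qed.

Lemma fin_entropy_ub (y : Omega -> R) (C : R) : measurable_fun setT y ->
  (\int[P]_w (Phi (y w) - (v 0)%:E) <= C%:E)%E ->
  fin_entropy y /\ \int[P]_w phi (y w) <= C + v 0.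
Proof.
move=> my hy; have mP := measurable_Phi_comp my.
have m1 : measurable_fun setT (fun w => (Phi (y w) - (v 0)%:E)%E).
  by apply: emeasurable_funB.
have p1 w : (0 <= Phi (y w) - (v 0)%:E)%E.
  by rewrite sube_ge0//; exact: (Phi_ge hu).
have E : (\int[P]_w Phi (y w) <= (C + v 0)%:E)%E.
  have -> : (fun w => Phi (y w)) = (fun w => (Phi (y w) - (v 0)%:E) + (v 0)%:E)%E.
    by apply/funext => w; rewrite subeK.
  rewrite integralD//; last 2 first.
  - apply/integrableP; split=> //; rewrite (_ : (fun w => _) = fun w => (Phi (y w) - (v 0)%:E)%E); first exact: le_lt_trans hy (ltry _).
    by apply/funext => w; rewrite gee0_abs.
  - exact: (int_cst P).
  by rewrite integral_cst// [X in (_ * X)%E]probability_setT mule1 EFinD leeD.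
have [fy e] := fin_entropyP my (le_lt_trans E (ltry _)).
by split=> //; rewrite -lee_fin -e.
Qed.

Definition utility_integrable f :=
  [/\ L f, {ae P, forall w, -oo < u (f w)}%E & LI (fun w => v (f w))].
Local Notation Good := utility_integrable.

Lemma v_le_affine (x : R) : (-oo < u x)%E -> v x <= phi 1 + x.
Proof.
by move=> ux; rewrite (phiE hu hA1)// mulr1; have := v_le_tangent hu hA1 ltr01 ux; set t := v (inv_marginal _ _ _); lra.
Qed.

Lemma measurable_v_comp f : measurable_fun setT f -> measurable_fun setT (fun w => v (f w)).
Proof.
move=> mf; apply: (measurableT_comp (fine_measurable measurableT)).
exact: measurableT_comp (measurable_u hu) mf.
Qed.

(** [hatu] controls the utility from below, and the tangent of slope 1 in [v_le_affine] controls it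
    from above. *)
Lemma utility_integrable_modular f : measurable_fun setT f -> (modular P u f < +oo)%E ->
  Good f /\ v 0 - fine (modular P u f) <= \int[P]_w v (f w).
Proof.
move=> mf hf; have Lf := orlicz_modular mf hf.
have mh := measurable_hatu_comp hu mf.
have hn : forall w, (0 <= hatu u (f w))%E by move=> w; exact: (hatu_ge0 hu).
have ih : P.-integrable setT (fun w => hatu u (f w)).
  apply/integrableP; split=> //; apply: le_lt_trans hf.
  by rewrite /modular le_eqVlt; apply/orP; left; apply/eqP; congr integral; apply/funext => w; rewrite gee0_abs.
have [iG fG] := int_fine ih; set G := fun w => fine (hatu u (f w)) in iG *.
have key : {ae P, forall w, (-oo < u (f w))%E /\ v 0 - G w <= v (f w)}.
  apply: ae_mono fG => w e.
  have uN : (-oo < u (- `|f w|))%E.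
    by apply/negPn/negP => /(hatuE_y hu) H; move: e; rewrite H.
  have le : (u (- `|f w|) <= u (f w))%E.
    by apply: (util_homo hu); rewrite lerNl -normrN ler_norm.
  have uf : (-oo < u (f w))%E by exact: lt_le_trans uN le.
  split=> //; move: le; rewrite /G (hatuE_fin hu)//= (ufinE_gtNy hu uN) (ufinE_gtNy hu uf) lee_fin.
  by lra.
have uf : {ae P, forall w, (-oo < u (f w))%E} by apply: ae_mono key => w [].
have iv : LI (fun w => v (f w)).
  apply: (int_dom (g := fun w => (`|v 0| + G w) + (`|phi 1| + `|f w|))); first exact: measurable_v_comp.
    apply: ae_mono key => w [ufw vl].
    have := v_le_affine ufw; have G0 : 0 <= G w by exact/fine_ge0.
    rewrite ler_norml; have := ler_norm (- v 0); have := ler_norm (phi 1); have := ler_norm (f w).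
    have := normr_ge0 (f w); have := normr_ge0 (phi 1); have := normr_ge0 (v 0).
    by rewrite normrN => *; apply/andP; split; lra.
  apply: int_D; first by apply: int_D => //; exact: int_cst.
  by apply: int_D; [exact: int_cst|exact/int_abs/oint].
split; first by split.
have -> : fine (modular P u f) = \int[P]_w G w.
  by rewrite /modular /Rintegral; congr fine; apply: ae_eq_integral => //;
    [have /measurable_int := iG|apply: ae_mono fG => w ->].
rewrite -{1}(exp_cst P (v 0)) -exp_B//; last exact: int_cst.
apply: exp_le => //; last by apply: ae_mono key => w [].
by apply: int_B => //; exact: int_cst.
Qed.

Lemma utility_integrable_cst (x : R) : (a < x%:E)%E -> Good (cst x).
Proof.
move=> ax; split; [exact: ocst|apply: ae_all => w; exact: util_dom hu _ ax|exact: (int_cst P (v x))].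
Qed.

Lemma utility_integrable_conv f g (t : R) : Good f -> Good g -> 0 < t < 1 ->
  Good (fun w => t * f w + (1 - t) * g w) /\
  t * \int[P]_w v (f w) + (1 - t) * \int[P]_w v (g w) <=
    \int[P]_w v (t * f w + (1 - t) * g w).
Proof.
move=> [Lf uf vf] [Lg ug vg] t01; set k := fun w => t * f w + (1 - t) * g w.
have Lk : L k by exact: olin.
have key : {ae P, forall w, (-oo < u (k w))%E /\ t * v (f w) + (1 - t) * v (g w) <= v (k w)}.
  by apply: (ae_mono2 _ uf ug) => w ? ?; exact: (v_conc hu hA1).
have uk : {ae P, forall w, (-oo < u (k w))%E} by apply: ae_mono key => w [].
have il : LI (fun w => t * v (f w) + (1 - t) * v (g w)) by apply: int_D; exact: int_Z.
have ik : LI (fun w => v (k w)).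
  apply: (int_dom (g := fun w => `|t * v (f w) + (1 - t) * v (g w)| + (`|phi 1| + `|k w|))); first exact/measurable_v_comp/(omeas Lk).
    apply: ae_mono key => w [ukw vl]; have := v_le_affine ukw; move: vl.
    set A := t * v _ + _ => *; have := ler_norm (- A); have := ler_norm (phi 1); have := ler_norm (k w).
    have := normr_ge0 (k w); have := normr_ge0 (phi 1); have := normr_ge0 A.
    by rewrite normrN ler_norml => *; apply/andP; split; lra.
  by apply: int_D; [exact: int_abs|apply: int_D; [exact: int_cst|exact/int_abs/oint]].
split=> //; rewrite -!exp_Z// -exp_D; [|exact: int_Z|exact: int_Z].
by apply: exp_le => //; apply: ae_mono key => w [].
Qed.

End ExpectedUtility.

(** * Supergradients of the primal value *)

Section Supergradient.
Context {R : realType} {dd : measure_display} {Omega : measurableType dd}.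
Variables (P : probability Omega R) (u : R -> \bar R) (a : \bar R).
Hypotheses (hu : utility u a) (hA1 : A1 u a).
Local Notation L := (orlicz P (hatu u)).
Local Notation oD := (orlicz_D hu hA1).
Local Notation oB := (orlicz_B hu hA1).
Local Notation oZ := (orlicz_Z hu).
Local Notation oN := (orlicz_N hu).
Local Notation ocst := (orlicz_cst P hu).
Local Notation omeas := (@orlicz_meas _ _ _ P u).

Local Notation v := (ufin u).
Local Notation Good := (utility_integrable P u).
Implicit Types (f g h : Omega -> R).

Lemma eq_expv f g : f = g -> \int[P]_w v (f w) = \int[P]_w v (g w).
Proof. by move->. Qed.

Section Primal.
Variables (C : set (Omega -> R)) (x V : R).
Hypothesis CL : C `<=` L.
Hypothesis C0 : C (fun=> 0).
Hypothesis CD : forall (c d : R) f g, 0 <= c -> 0 <= d -> C f -> C g ->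
  C (fun w => c * f w + d * g w).
Hypothesis ax : (a < x%:E)%E.
Hypothesis HV : forall c, C c -> Good (fun w => x + c w) ->
  \int[P]_w v (x + c w) <= V.

(* The infimum of these values is the directional derivative at [x] of the
   convex function [f |-> - sup_(c in C) E u (f + c)], computed with the
   upper bound [V] in place of the value at [x]. *)
Definition slope h (r : R) := exists (t : R) c,
  [/\ 0 < t, C c, Good (fun w => x + c w + t * h w) &
      r = (V - \int[P]_w v (x + c w + t * h w)) / t].

Lemma slope_ge0 h r : (forall w, h w = 0) -> slope h r -> 0 <= r.
Proof.
move=> h0 [t [c [t0 Cc]]].
have e : (fun w => x + c w + t * h w) = fun w => x + c w.
  by apply/funext => w; rewrite h0 mulr0 addr0.
rewrite (eq_expv e) e => G ->; rewrite divr_ge0 ?(ltW t0)// subr_ge0; exact: HV.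
Qed.

Lemma slope_add h1 h2 r1 r2 : slope h1 r1 -> slope h2 r2 ->
  exists2 r, slope (fun w => h1 w + h2 w) r & r <= r1 + r2.
Proof.
move=> [t1 [c1 [t10 Cc1 G1 ->]]] [t2 [c2 [t20 Cc2 G2 ->]]].
(* Weights proportional to [t2] and [t1] give both directions the same step [t1 * t2 / s]; the
   average of [c1] and [c2] stays in the cone, and the two slopes add up exactly. *)
pose s := t1 + t2; have s0 : 0 < s by rewrite addr_gt0.
have ts : 0 < t2 / s < 1.
  by rewrite divr_gt0//= ltr_pdivrMr// mul1r /s ltrDr.
have e1 : 1 - t2 / s = t1 / s by rewrite /s; field; rewrite gt_eqF.
have [G le] := utility_integrable_conv hu hA1 G1 G2 ts.
have eF : (fun w => t2 / s * (x + c1 w + t1 * h1 w) + (1 - t2 / s) * (x + c2 w + t2 * h2 w)) =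
  fun w => x + (t2 / s * c1 w + t1 / s * c2 w) + (t1 * t2 / s) * (h1 w + h2 w).
  by apply/funext => w; rewrite e1 /s; field; rewrite gt_eqF.
rewrite (eq_expv eF) in le; rewrite eF in G; set T := t1 * t2 / s in G le.
have T0 : 0 < T by rewrite divr_gt0// mulr_gt0.
exists ((V - \int[P]_w v (x + (t2 / s * c1 w + t1 / s * c2 w) + T * (h1 w + h2 w))) / T).
  exists T, (fun w => t2 / s * c1 w + t1 / s * c2 w); split=> //.
  by apply: CD => //; apply: divr_ge0; exact: ltW.
move: le; rewrite e1.
set E1 := (X in _ * X + _); set E2 := (X in _ + _ * X) => le.
have -> : (V - E1) / t1 + (V - E2) / t2 = (V - (t2 / s * E1 + t1 / s * E2)) / T.
  by rewrite /T /s; field; rewrite !gt_eqF.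
by rewrite ler_pM2r ?invr_gt0// lerD2l lerN2.
Qed.

Lemma slope_scale h r (c : R) : 0 < c -> slope h r -> slope (fun w => c * h w) (c * r).
Proof.
move=> c0 [t [c1 [t0 Cc1 G ->]]]; exists (t / c), c1.
have e : (fun w => x + c1 w + t / c * (c * h w)) = fun w => x + c1 w + t * h w.
  by apply/funext => w; field; rewrite gt_eqF.
rewrite (eq_expv e) e; split=> //; first exact: divr_gt0.
by field; rewrite !gt_eqF.
Qed.

(** Writing [x] as [t * 0 + (1 - t) * (x / (1 - t))] turns [x + t * h] into a mixture of [h] and a
    constant of the domain. For [x < 0] that constant is a point [M] of the domain below [x]. *)
Lemma ex_base : exists t : R, 0 < t < 1 /\ (a < (x / (1 - t))%:E)%E.
Proof.
have [x0|x0] := leP 0 x.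
  exists (1 / 2); split; first by apply/andP; split; lra.
  apply: (lt_le_trans (a_lt0 hu)); rewrite lee_fin divr_ge0//; lra.
have [M /andP[aM Mx]] : exists M : R, (a < M%:E < x%:E)%E by exact: ex_lt_between.
rewrite lte_fin in Mx; have M0 : M < 0 by lra.
exists (1 - x / M).
have -> : 1 - (1 - x / M) = x / M by ring.
have xM : x / (x / M) = M by field; rewrite !lt_eqF.
rewrite xM; split=> //.
have q0 : 0 < x / M by rewrite -mulrNN -invrN divr_gt0//; lra.
have q1 : x / M < 1 by rewrite ltr_ndivrMr// mul1r.
by apply/andP; split; lra.
Qed.

(** The step and the bound are uniform in [h]: this makes every set of slopes nonempty and bounds
    the supergradient over functions of modular at most 1. *)
Lemma shift_good : exists (t c : R), 0 < t < 1 /\ forall h, measurable_fun setT h ->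
  (modular P u h < +oo)%E -> Good (fun w => x + t * h w) /\
  c - t * fine (modular P u h) <= \int[P]_w v (x + t * h w).
Proof.
have [t [/andP[t0 t1] xt]] := ex_base.
exists t, ((1 - t) * v (x / (1 - t)) + t * v 0); split; first by rewrite t0.
move=> h mh hh; have [Gh vh] := utility_integrable_modular hu hA1 mh hh.
have Gx := utility_integrable_cst P hu xt.
have [G le] := utility_integrable_conv hu hA1 Gh Gx (t := t) ltac:(by rewrite t0).
have e : (fun w => t * h w + (1 - t) * cst (x / (1 - t)) w) = fun w => x + t * h w.
  by apply/funext => w /=; field; lra.
rewrite (eq_expv e) in le; rewrite e in G; split=> //; apply: le_trans le.
have -> : \int[P]_w v (cst (x / (1 - t)) w) = v (x / (1 - t)) by exact: (exp_cst P (v (x / (1 - t)))).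
have := ler_wpM2l (ltW t0) vh; lra.
Qed.

Lemma slope_nonempty h : L h -> slope h !=set0.
Proof.
move=> Lh; have [mh [al al0 hal]] := Lh.
have [t [c [/andP[t0 t1] H]]] := shift_good.
have [|G _] := H (fun w => al * h w) _ hal; first exact: measurable_funM.
exists ((V - \int[P]_w v (x + 0 + (t * al) * h w)) / (t * al)).
exists (t * al), (fun=> 0); split=> //; first exact: mulr_gt0.
by rewrite (_ : (fun w => _) = fun w => x + t * (al * h w))//; apply/funext => w; rewrite addr0 mulrA.
Qed.

Definition directional h : R := inf (slope h).

Lemma slope_lbound h : L h -> has_lbound (slope h).
Proof.
move=> Lh; have [r' sr'] := slope_nonempty (oN Lh); exists (- r') => r sr.
have [q sq le] := slope_add sr sr'.
by have := slope_ge0 (fun w => subrr (h w)) sq; lra.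
Qed.

Lemma supergradient : exists z, [/\ dual P u z, forall c, C c -> z c <= 0 &
  forall f, Good f -> \int[P]_w v (f w) <= V + z f - x * z (cst 1)].
Proof.
have Lsub f g : L f -> L g -> L (f + g :> (Omega -> R^o)) by exact: oD.
have LZ (c : R) f : L f -> L (c *: (f : Omega -> R^o)) by exact: oZ.
have L0 : L (0 : Omega -> R^o) by exact: (ocst 0).
have sub : @sublinear R (Omega -> R^o) L directional.
  split=> [h1 h2 L1 L2|c h c0 Lh].
    apply/ler_addgt0Pl => e e0; have e20 : 0 < e / 2 by rewrite divr_gt0.
    have [|r1 s1 H1] := inf_lt (slope_nonempty L1) (x := directional h1 + e / 2); first by rewrite ltrDl.
    have [|r2 s2 H2] := inf_lt (slope_nonempty L2) (x := directional h2 + e / 2); first by rewrite ltrDl.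
    have [r sr le] := slope_add s1 s2.
    have := ge_inf (slope_lbound (oD L1 L2)) sr; rewrite -/(directional _) /=.
    by move=> H; apply: (le_trans H); lra.
  rewrite mulrC -ler_pdivrMr//; apply: lb_le_inf; first exact: slope_nonempty.
  move=> r sr; rewrite ler_pdivrMr// mulrC.
  by apply: ge_inf; [exact: slope_lbound (oZ c Lh)|exact: slope_scale].
have [y [ylin yle]] := Hahn_Banach L0 Lsub LZ sub.
have ylin' (c : R) f g : L f -> L g -> y (fun w => c * f w + g w) = c * y f + y g.
  by move=> Lf Lg; exact: (ylin c f g Lf Lg).
(* The linear [y] minorizes directional derivatives of the negative of the value function, whence
   the sign. *)
pose z : functional := fun f => - y f.
have main (t : R) c h : 0 < t -> C c -> L h -> Good (fun w => x + c w + t * h w) ->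
    \int[P]_w v (x + c w + t * h w) <= V + t * z h.
  move=> t0 Cc Lh G; rewrite /z mulrN.
  have : y h <= (V - \int[P]_w v (x + c w + t * h w)) / t.
    by apply: (le_trans (yle _ Lh)); apply: (ge_inf (slope_lbound Lh)); exists t, c.
  by rewrite ler_pdivlMr// mulrC; lra.
have y0 : y (fun=> 0) = 0.
  have := ylin' 1 _ _ (ocst 0) (ocst 0); rewrite (_ : (fun w => _) = fun=> 0); first by lra.
  by apply/funext => w; rewrite mulr0 addr0.
have yZ (c : R) f : L f -> y (fun w => c * f w) = c * y f.
  move=> Lf; have := ylin' c _ _ Lf (ocst 0).
  by rewrite y0 addr0 => <-; congr y; apply/funext => w; rewrite addr0.
have dz : dual P u z.
  split; first by move=> c f g Lf Lg; rewrite /z ylin'//; ring.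
  have [t [c [/andP[t0 t1] H]]] := shift_good.
  exists ((V - c + t) / t) => f Lf; rewrite normrN.
  apply: (bounded_by_modular hu hA1) => // h Lh h1.
  have [|G le] := H h (omeas Lh); first exact: le_lt_trans h1 (ltry _).
  rewrite ler_pdivlMr// mulrC.
  have e : (fun w => x + 0 + t * h w) = fun w => x + t * h w by apply/funext => w; rewrite addr0.
  have := main t (fun=> 0) h t0 C0 Lh; rewrite (eq_expv e) e /z mulrN => /(_ G) => le'.
  have m1 : fine (modular P u h) <= 1.
    by rewrite -lee_fin fineK// ge0_fin_numE ?(modular_ge0 P hu)//; exact: (le_lt_trans h1 (ltry _)).
  have := ler_wpM2l (ltW t0) m1; lra.
exists z; split=> //.
  move=> c Cc; rewrite leNgt; apply/negP => zc.
  (* Adding the gain [t * c] and moving by [t] in the direction [- c] leads back to the constant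
     [x], so [v x <= V - t * z c] for all [t > 0]; this [t] violates it. *)
  pose t := (`|V - v x| + 1) / z c.
  have t0 : 0 < t by rewrite divr_gt0// ltr_wpDl.
  have Ctc : C (fun w => t * c w).
    have := CD (ltW t0) (lexx 0) Cc C0; congr (C _); apply/funext => w; by rewrite mul0r addr0.
  have e : (fun w => x + t * c w + t * - c w) = cst x.
    by apply/funext => w /=; ring.
  have := main t _ _ t0 Ctc (oN (CL Cc)); rewrite (eq_expv e) e => /(_ (utility_integrable_cst P hu ax)).
  rewrite (dual_N hu dz (CL Cc)).
  rewrite [X in X <= _](exp_cst P (v x)) /= mulrN /t divfK ?gt_eqF//.
  by have := ler_norm (V - v x); lra.
move=> f Gf; have Lf : L f by case: Gf.
have e : (fun w => x + 0 + 1 * (f w - x)) = f by apply/funext => w; ring.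
have := main 1 (fun=> 0) (fun w => f w - x) ltr01 C0 (oB Lf (ocst x)); rewrite (eq_expv e) e => /(_ Gf).
rewrite mul1r (dual_B hu dz Lf (ocst x)).
have -> : (fun=> x) = (fun w : Omega => x * cst 1 w) by apply/funext => w /=; rewrite mulr1.
by rewrite (dual_Z hu _ dz (ocst 1)); lra.
Qed.

End Primal.
End Supergradient.

(** * The entropy bound for supergradients and directional derivatives of the entropy *)

Section DualBound.
Context {R : realType} {dd : measure_display} {Omega : measurableType dd}.
Variables (P : probability Omega R) (u : R -> \bar R) (a : \bar R).
Hypotheses (hu : utility u a) (hA1 : A1 u a).
Local Notation L := (orlicz P (hatu u)).
Local Notation N := (luxemburg P u).
Local Notation LI f := (P.-integrable setT (EFin \o f)).
Local Notation oD := (orlicz_D hu hA1).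
Local Notation oN := (orlicz_N hu).
Local Notation obd := (orlicz_bounded hu).
Local Notation oind := (orlicz_ind hu).
Local Notation omeas := (@orlicz_meas _ _ _ P u).

Local Notation v := (ufin u).
Local Notation phi := (phi u).
Local Notation Good := (utility_integrable P u).
Implicit Types (f g h : Omega -> R).

(* The supergradient inequality at [f1] on most of the space, where [f1]
   approximates the maximizer in [Phi (dens_reg z)], and at [- h] on the small
   sets [B j] carrying the singular part, where [h] nearly attains its norm. *)
Lemma dual_bound_approx z (x V : R) (n : nat) (e : R) :
  dual P u z -> positive P u z -> 0 < e ->
  (forall f, Good f -> \int[P]_w v (f w) <= V + z f - x * z (cst 1)) ->
  let f1 := fun w => sel u (qPhi a) n (dens_reg P u z w) in
  LI (fun w => v (f1 w) - f1 w * dens_reg P u z w) /\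
  \int[P]_w (v (f1 w) - f1 w * dens_reg P u z w) <=
    V - x * z (cst 1) - dual_norm P u (sing P u z) + e + e.
Proof.
move=> dz pz e0 Hz f1; set g := dens_reg P u z.
have ds := sing_dual hu hA1 dz pz; have ps := sing_positive hu hA1 dz pz.
set s := sing P u z in ds ps *.
have [mg g0 gP] := dens_regP hu hA1 dz pz; rewrite -/g in mg g0 gP.
have [h [Lh h0 mh sh]] := sing_norm_approx hu hA1 ds ps e0.
have [A [vA sA]] := sing_concentrated hu hA1 dz pz.
have [B [vB AB sB]] := concentrated_fun hu hA1 ds ps vA sA Lh.
have [_ sB1] := concentrated_le hu hA1 ds ps (conj vA sA) vB AB.
have [msel mvsel] := measurable_sel u (qPhi a) n.
have [Bd HBd] := sel_bounded u (qPhi a) n.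
have mf1 : measurable_fun setT f1 by exact: measurableT_comp msel mg.
have mvf1 : measurable_fun setT (fun w => v (f1 w)) by exact: measurableT_comp mvsel mg.
have Lf1 : L f1 by apply: (obd (c := Bd)) => //; apply: ae_all => w; case: (HBd (g w)).
have iv1 : LI (fun w => v (f1 w)).
  by apply: (int_dom (g := fun=> Bd)) => //; [apply: ae_all => w; case: (HBd (g w))|exact: int_cst].
have Lh' := oN Lh.
have mh' : (modular P u (fun w => - h w)%R < +oo)%E.
  by rewrite (_ : modular _ _ _ = modular P u h)//; congr integral; apply/funext => w; exact: hatuN.
have [[_ uh ivh] _] := utility_integrable_modular hu hA1 (omeas Lh') mh'.
have [i1 _] := gP _ Lf1; have [ih _] := gP _ Lh.
(* Utility minus price under the density, for [f1] and for [- h]. Replacing one by the other on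
   [B N] changes the integral by less than [e]. *)
pose F1 w : R := v (f1 w) - f1 w * g w; pose F2 w : R := v (- h w) + h w * g w.
have iF1 : LI F1 by exact: int_B.
have iF2 : LI F2 by exact: int_D.
split=> //; have [N HN] := vanishing_tail vB (int_B iF1 iF2) e0.
have {HN} := HN N (leqnn N); set BN := B N.
have mB : measurable BN by have [mB _ _] := vB; exact: mB.
pose f w : R := f1 w * \1_(~` BN) w + (- h w) * \1_BN w.
have La := oind (measurableC mB) Lf1; have Lb := oind mB Lh'.
have Lf : L f by exact: oD.
have caseB w : (\1_BN w = 0 :> R /\ \1_(~` BN) w = 1 :> R) \/ (\1_BN w = 1 :> R /\ \1_(~` BN) w = 0 :> R).
  by rewrite indic_setC indicE; case: (_ \in _); [right|left]; split=> /=; lra.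
have vf w : v (f w) = v (f1 w) * \1_(~` BN) w + v (- h w) * \1_BN w.
  by rewrite /f; have [[-> ->]|[-> ->]] := caseB w; rewrite ?mulr0 ?mulr1 ?addr0 ?add0r.
have ivf : LI (fun w => v (f w)).
  rewrite (_ : (fun w => v (f w)) = fun w => v (f1 w) * \1_(~` BN) w + v (- h w) * \1_BN w); last exact/funext.
  by apply: int_D; apply: int_ind => //; exact: measurableC.
have Gf : Good f.
  split=> //; apply: ae_mono uh => w uhw; rewrite /f; have [[-> ->]|[-> ->]] := caseB w.
    by rewrite mulr1 mulr0 addr0; apply: (util_dom hu); exact: (sel_a hu (fun k => qPhi_a hu k)).
  by rewrite mulr0 add0r mulr1.
have sf : s f = - s h.
  have Lhb := oind mB Lh; have Lhc := oind (measurableC mB) Lh.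
  rewrite /f (dual_D hu ds La Lb).
  have -> : s (fun w => f1 w * \1_(~` BN) w) = 0.
    by apply: (concentrated_bounded hu hA1 ds ps vB (c := Bd)) => // w; case: (HBd (g w)).
  rewrite add0r (dual_split hu ds Lh mB).
  have -> : s (fun w => h w * \1_(~` BN) w) = 0.
    apply: (sB N) => //; by apply: ae_all => w; rewrite normrM (@ger0_norm _ (\1__ _)).
  by rewrite add0r -(dual_N hu ds Lhb); congr s; apply/funext => w; rewrite mulNr.
have [ifg rf] := gP f Lf.
have := Hz f Gf; rewrite (reg_sing P u z f) -/s sf rf => H.
have HE : \int[P]_w v (f w) - \int[P]_w (f w * g w) =
    \int[P]_w F1 w - \int[P]_w ((F1 w - F2 w) * \1_BN w).
  rewrite -!exp_B//; last by apply: int_ind => //; exact: int_B.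
  congr Rintegral; apply/funext => w; rewrite vf /f /F1 /F2.
  by have [[-> ->]|[-> ->]] := caseB w; ring.
rewrite ltr_norml => /andP[H1 H2]; move: H HE sh; rewrite /F1; lra.
Qed.

(** The near maximizers increase to the supremum that defines [Phi], so finite entropy is itself a
    conclusion of Fatou's lemma. Subtracting [v 0], the value reached by [sel 0], makes the
    integrands nonnegative. *)
Lemma dual_bound z (x V : R) : dual P u z -> positive P u z ->
  (forall f, Good f -> \int[P]_w v (f w) <= V + z f - x * z (cst 1)) ->
  fin_entropy P u (dens_reg P u z) /\
  \int[P]_w phi (dens_reg P u z w) <= V - x * z (cst 1) - dual_norm P u (sing P u z).
Proof.
move=> dz pz Hz; set g := dens_reg P u z; set D := _ - dual_norm _ _ _.
have [mg _ _] := dens_regP hu hA1 dz pz; rewrite -/g in mg.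
have [H1 H2] : fin_entropy P u g /\ \int[P]_w phi (g w) <= (D - v 0) + v 0.
  apply: (fin_entropy_ub hu mg).
  pose f1 n w := sel u (qPhi a) n (g w).
  have Hn n (e : R) (e0 : 0 < e) := @dual_bound_approx z x V n e dz pz e0 Hz.
  have i1 n : LI (fun w => v (f1 n w) - f1 n w * g w) by case: (Hn n 1 ltr01).
  apply: (exp_fatou (h := fun n w => (v (f1 n w) - f1 n w * g w) - v 0)).
  - by move=> n; apply: int_B => //; exact: int_cst.
  - move=> n; apply: ae_all => w; rewrite subr_ge0.
    by have := sel_homo_le u (qPhi a) (g w) (leq0n n); rewrite /= mul0r subr0.
  - by apply: emeasurable_funB => //; exact: (measurable_Phi_comp hu mg).
  - by move=> w; rewrite sube_ge0//; exact: (Phi_ge hu).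
  - move=> n; rewrite exp_B//; last exact: int_cst.
    rewrite exp_cst lerD2r; apply/ler_addgt0Pl => e e0.
    have := (Hn n (e / 2) ltac:(by rewrite divr_gt0)).2; rewrite -/g -/(f1 n) /D; lra.
  - apply: ae_all => w M HM.
    have [|n0 Hn0] := ereal_cvg_ge (M := M + v 0) (Phi_sel_cvg hu (y := g w)).
      by rewrite EFinD -lteBrDr.
    by exists n0 => n /Hn0; rewrite /f1; lra.
by split=> //; move: H2; rewrite subrK.
Qed.

(** By convexity the difference quotients [q t] stay above the integrable [q1], the quotient at
    [t = 1], which licenses Fatou's lemma along [t = 1 / (n + 1)]. As the limit [F] comes out
    integrable, and is [+oo] where [y = 0 < y'], almost surely [y'] vanishes wherever [y] does. *)
Lemma slope_fatou (y y' : Omega -> R) (B : R) : measurable_fun setT y -> measurable_fun setT y' ->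
  le_as P (cst 0) y -> le_as P (cst 0) y' -> fin_entropy P u y -> fin_entropy P u y' ->
  (forall t : R, 0 < t <= 1 -> \int[P]_w phi (y w) -
     \int[P]_w phi (y w + t * (y' w - y w)) <= t * B) ->
  let F := fun w => (- dPhi u (y w) * (y' w - y w)%:E)%E in
  [/\ P.-integrable setT F, {ae P, forall w, F w = (fine (F w))%:E} &
      \int[P]_w fine (F w) <= B].
Proof.
move=> my my' y0 y'0 [iy fy] [iy' fy'] HB F.
pose q (t : R) w : R := (phi (y w) - phi (y w + t * (y' w - y w))) / t.
have mD : measurable_fun setT (fun w => y' w - y w) by exact: measurable_funB.
have conv (t : R) : 0 < t <= 1 -> {ae P, forall w, (Phi u (y w + t * (y' w - y w)) < +oo)%E /\
    phi (y w) - phi (y' w) <= q t w}.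
  move=> /andP[t0 t1]; apply: (ae_mono2 _ fy fy') => w fw fw'.
  have := phi_conv hu (y1 := y' w) (y2 := y w) (t := t) ltac:(by rewrite ltW) fw' fw.
  have -> : t * y' w + (1 - t) * y w = y w + t * (y' w - y w) by ring.
  move=> le; have lt := le_lt_trans le (ltry _); split=> //.
  rewrite /q ler_pdivlMr//; move: le; rewrite (PhiEfin hu lt) lee_fin -/phi.
  by set A := phi (_ + _); lra.
have iphi (t : R) : 0 < t <= 1 -> LI (fun w => phi (y w + t * (y' w - y w))).
  move=> t01; have [t0 t1] := andP t01.
  have mt : measurable_fun setT (fun w => y w + t * (y' w - y w)).
    by apply: measurable_funD => //; exact: measurable_funM.
  apply: (int_dom (g := fun w => `|v 0| + ((1 - t) * `|phi (y w)| + t * `|phi (y' w)|))).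
  - apply: (measurableT_comp (fine_measurable measurableT)).
    exact: (measurable_Phi_comp hu mt).
  - apply: ae_mono (conv t t01) => w [fw]; rewrite /q ler_pdivlMr//.
    have := Phi_ge hu (y w + t * (y' w - y w)); rewrite (PhiEfin hu fw) lee_fin -/phi.
    set A := phi (_ + _) => l1 l2.
    have k1 := ler_norm (- v 0); rewrite normrN in k1.
    have k2 := ler_wpM2l (ltW t0) (ler_norm (phi (y' w))).
    have k3 := ler_wpM2l (_ : 0 <= 1 - t) (ler_norm (phi (y w))).
    have {}k3 : (1 - t) * phi (y w) <= (1 - t) * `|phi (y w)| by apply: k3; lra.
    have k4 : 0 <= t * `|phi (y' w)| by rewrite mulr_ge0// ltW.
    have k5 : 0 <= (1 - t) * `|phi (y w)| by rewrite mulr_ge0//; lra.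
    have k6 := normr_ge0 (v 0).
    by rewrite ler_norml; apply/andP; split; lra.
  - by apply: int_D; [exact: int_cst|apply: int_D; apply: int_Z; exact: int_abs].
have iq (t : R) : 0 < t <= 1 -> LI (q t).
  move=> t01; rewrite (_ : q t = fun w => t^-1 * (phi (y w) - phi (y w + t * (y' w - y w)))); last first.
    by apply/funext => w; rewrite mulrC.
  by apply: int_Z; apply: int_B => //; exact: iphi.
have Eq (t : R) : 0 < t <= 1 -> \int[P]_w q t w <= B.
  move=> t01; have [t0 _] := andP t01.
  rewrite (_ : \int[P]_w q t w = t^-1 * \int[P]_w (phi (y w) - phi (y w + t * (y' w - y w)))); last first.
    rewrite -exp_Z; last by apply: int_B => //; exact: iphi.
    by congr Rintegral; apply/funext => w; rewrite /q mulrC.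
  by rewrite mulrC ler_pdivrMr// exp_B// ?(mulrC B); [exact: HB|exact: iphi].
pose q1 w : R := phi (y w) - phi (y' w); have iq1 : LI q1 by exact: int_B.
have mF : measurable_fun setT F.
  apply: emeasurable_funM; last exact/measurable_EFinP.
  exact: measurableT_comp (measurable_dPhi hu hA1) my.
have tn n : 0 < (n.+1%:R^-1 : R) <= 1.
  by rewrite invr_gt0 ltr0n/= invf_le1// ler1n.
have small (d : R) : 0 < d -> exists N, forall n, (N <= n)%N -> (n.+1%:R^-1 : R) < d.
  move=> d0; exists (Num.truncn d^-1) => n Nn.
  rewrite invf_plt ?posrE ?ltr0n//; apply: (lt_le_trans (truncnS_gt _)).
  by rewrite ler_nat.
have Fquot : {ae P, forall w (M : R), (M%:E < F w)%E -> exists2 d : R, 0 < d & forall t : R, 0 < t -> t < d -> M <= q t w}.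
  have yy : {ae P, forall w, 0 <= y w /\ 0 <= y' w} by apply: (ae_mono2 _ y0 y'0).
  have ff : {ae P, forall w, (Phi u (y w) < +oo)%E /\ (Phi u (y' w) < +oo)%E} by apply: (ae_mono2 _ fy fy').
  apply: (ae_mono2 _ yy ff) => w [a1 a2] [a3 a4] M HM.
  apply: (phi_quotient hu hA1) => //; by rewrite subrKC.
have Fq1 : {ae P, forall w, ((q1 w)%:E <= F w)%E}.
  have y01 : {ae P, forall w, 0 <= y w /\ 0 <= y' w} by apply: (ae_mono2 _ y0 y'0).
  apply: (ae_mono2 _ y01 fy') => w [yw y'w] fw'.
  have [yw0|yw0] := leP (y w) 0; last first.
    rewrite /F (dPhiE hu hA1 yw0) -EFinM lee_fin /q1.
    by have := phi_subgrad hu hA1 yw0 fw'; rewrite -/phi; lra.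
  have yw' : y w = 0 by apply/eqP; rewrite eq_le yw0.
  rewrite /F (dPhiE0 _ yw0) /q1 yw' subr0.
  move: y'w; rewrite le_eqVlt => /predU1P[<-|y'w]; first by rewrite mule0 subrr.
  by rewrite gt0_mulye ?lte_fin// leey.
have HF : (\int[P]_w (`|F w - (q1 w)%:E|) <= (B - \int[P]_w q1 w)%:E)%E.
  apply: (exp_fatou (h := fun n w => q n.+1%:R^-1 w - q1 w)).
  - by move=> n; apply: int_B => //; exact: iq.
  - by move=> n; apply: ae_mono (conv _ (tn n)) => w [_]; rewrite subr_ge0.
  - apply: measurableT_comp => //; apply: emeasurable_funB => //; exact/measurable_EFinP/(int_meas iq1).
  - by move=> w; exact: abse_ge0.
  - by move=> n; rewrite exp_B// ?lerD2r; [exact: Eq|exact: iq].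
  - apply: (ae_mono2 _ Fquot Fq1) => w Hq Hq1 M.
    rewrite gee0_abs ?sube_ge0// lteBrDr// -EFinD => /Hq[d d0 Hd].
    have [N HN] := small d d0; exists N => n /HN nd.
    by have := Hd _ (proj1 (andP (tn n))) nd; lra.
have iFq : P.-integrable setT (fun w => F w - (q1 w)%:E)%E.
  apply/integrableP; split; last exact: le_lt_trans HF (ltry _).
  by apply: emeasurable_funB => //; exact/measurable_EFinP/(int_meas iq1).
have [i1 e1] := int_fine iFq.
have Ffin : {ae P, forall w, F w = (fine (F w))%:E}.
  by apply: ae_mono e1 => w; case: (F w).
have iF : P.-integrable setT F.
  have -> : F = (fun w => (F w - (q1 w)%:E) + (q1 w)%:E)%E by apply/funext => w; rewrite subeK.
  exact: integrableD.
split=> //; have [iF' _] := int_fine iF.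
rewrite -(lerD2r (- \int[P]_w q1 w)) -exp_B// -lee_fin -exp_fin; last exact: int_B.
apply: le_trans HF; rewrite le_eqVlt; apply/orP; left; apply/eqP.
apply: ae_eq_integral => //.
- by have /measurable_int := int_B iF' iq1.
- by apply: measurableT_comp => //; apply: emeasurable_funB => //; exact/measurable_EFinP/(int_meas iq1).
- by apply: (ae_mono2 _ Ffin Fq1) => w e le _; rewrite gee0_abs ?sube_ge0// {2}e.
Qed.

End DualBound.

(** * Probabilities with a given density *)

Section DensityProbability.
Context {R : realType} {dd : measure_display} {Omega : measurableType dd}.
Variable P : probability Omega R.
Local Notation LI f := (P.-integrable setT (EFin \o f)).
Variable g : Omega -> R.
Hypotheses (ig : LI g) (g0 : forall w, 0 <= g w) (g1 : \int[P]_w g w = 1).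

Definition density_prob (A : set Omega) : \bar R := (\int[P]_(w in A) (g w)%:E)%E.

Let density_prob0 : density_prob set0 = 0%E.
Proof. exact: integral_set0. Qed.

Let density_prob_ge0 A : (0 <= density_prob A)%E.
Proof. by apply: integral_ge0 => w _; rewrite lee_fin. Qed.

Let density_prob_additive : semi_sigma_additive density_prob.
Proof.
move=> /= A mA tA mUA; rewrite /density_prob integral_bigcup//; last exact: (integrableS measurableT).
by apply: is_cvg_ereal_nneg_natsum_cond => n _ _; exact: density_prob_ge0.
Qed.

HB.instance Definition _ := isMeasure.Build _ _ _
  density_prob density_prob0 density_prob_ge0 density_prob_additive.

Let density_prob_setT : density_prob setT = 1%E.
Proof. by rewrite /density_prob exp_fin// g1. Qed.

HB.instance Definition _ := @Measure_isProbability.Build _ _ R density_prob density_prob_setT.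

Lemma density_prob_dominated : density_prob `<< P.
Proof.
apply/null_content_dominatesP => A mA PA0; rewrite /density_prob.
apply: null_set_integral => //; apply: measurable_funTS; exact/measurable_EFinP/(int_meas ig).
Qed.

(** (A2) speaks of probabilities and of chosen versions of their Radon-Nikodym derivatives, so a
    normalized density must first be recovered in this form. *)
Lemma density_probability : exists Q : probability Omega R, Q `<< P /\
  {ae P, forall w, fine (Radon_Nikodym (charge_of_finite_measure Q) P w) = g w}.
Proof.
exists density_prob; split; first exact: density_prob_dominated.
have dom := density_prob_dominated.
have H := @integral_ae_eq _ _ _ P setT measurableT (EFin \o g)
  (Radon_Nikodym (charge_of_finite_measure density_prob) P).
apply: ae_mono (H _ _ _) => [w /= ->//||| A _ mA].
- exact: (@Radon_Nikodym_integrable _ _ _ (charge_of_finite_measure density_prob) P dom).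
- exact/measurable_EFinP/(int_meas ig).
- by rewrite -(@Radon_Nikodym_integral _ _ _ (charge_of_finite_measure density_prob) P A dom mA).
Qed.

End DensityProbability.

(** * Scaling densities of finite entropy *)

Section EntropyScaling.
Context {R : realType} {dd : measure_display} {Omega : measurableType dd}.
Variables (P : probability Omega R) (u : R -> \bar R) (a : \bar R).
Hypotheses (hu : utility u a) (hA1 : A1 u a) (hA2 : A2 P u).
Local Notation LI f := (P.-integrable setT (EFin \o f)).

Lemma int_Phi_ae (f g : Omega -> R) : measurable_fun setT f -> measurable_fun setT g ->
  {ae P, forall w, f w = g w} -> (\int[P]_w Phi u (f w) = \int[P]_w Phi u (g w))%E.
Proof.
move=> mf mg fg; apply: ae_eq_integral => //.
- exact: (measurable_Phi_comp hu).
- exact: (measurable_Phi_comp hu).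
- by apply: ae_mono fg => w ->.
Qed.

(** Normalizing by the mass [m] turns [g] into [m] times a probability density [h]. Two uses of
    (A2), from the factor [m] to 1 and from 1 to [m * c], give the claim. *)
Lemma entropy_scale (g : Omega -> R) (c : R) : LI g -> le_as P (cst 0) g ->
  0 < \int[P]_w g w -> (\int[P]_w Phi u (g w) < +oo)%E -> 0 < c ->
  (\int[P]_w Phi u (c * g w)%R < +oo)%E.
Proof.
move=> ig g0 m0 hg c0; set m := \int[P]_w g w in m0.
pose h w : R := Num.max (g w) 0 / m.
have mg := int_meas ig.
have mh : measurable_fun setT h by apply: measurable_funM => //; exact: measurable_maxr.
have hE : {ae P, forall w, h w = m^-1 * g w}.
  by apply: ae_mono g0 => w gw; rewrite /h max_l// mulrC.
have ih : LI h.
  by apply: (int_ae (f := fun w => m^-1 * g w)) => //; [apply: ae_mono hE => w|exact: int_Z].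
have h0 w : 0 <= h w by rewrite divr_ge0 ?(ltW m0)// le_max lexx orbT.
have h1 : \int[P]_w h w = 1.
  rewrite (exp_ae (g := fun w => m^-1 * g w))//; last exact: measurable_funM.
  by rewrite exp_Z// mulVf// gt_eqF.
have [Q [QP RN]] := density_probability ih h0 h1.
have mRN : measurable_fun setT (fun w => fine (Radon_Nikodym (charge_of_finite_measure Q) P w)).
  apply: (measurableT_comp (fine_measurable measurableT)).
  by have /measurable_int := @Radon_Nikodym_integrable _ _ _ (charge_of_finite_measure Q) P QP.
have key (k : R) : finite_entropy P (fun y => Phi u (k * y)%R) Q <->
    (\int[P]_w Phi u (k * (m^-1 * g w))%R < +oo)%E.
  rewrite /finite_entropy /= (int_Phi_ae (g := fun w => k * (m^-1 * g w))).
  - by split=> [[]|].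
  - exact: measurable_funM.
  - by apply: measurable_funM => //; exact: measurable_funM.
  - by apply: (ae_mono2 _ RN hE) => w -> ->.
have H1 : finite_entropy P (fun y => Phi u (m * y)%R) Q.
  apply/key; rewrite (int_Phi_ae (g := g))//.
  - by apply: measurable_funM => //; exact: measurable_funM.
  - by apply: ae_all => w; rewrite mulrA mulfV ?mul1r// gt_eqF.
have H2 : finite_entropy P (fun y => Phi u ((m * c) * y)%R) Q.
  by rewrite -hA2 ?mulr_gt0// (hA2 m0).
move/key: H2; rewrite (int_Phi_ae (g := fun w => c * g w))//.
- by apply: measurable_funM => //; exact: measurable_funM.
- exact: measurable_funM.
- by apply: ae_all => w; rewrite (mulrC m) -mulrA (mulrA m) mulfV ?mul1r// gt_eqF.
Qed.

End EntropyScaling.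

(** * Duality for a cone of terminal gains *)

Section Duality.
Context {R : realType} {dd : measure_display} {Omega : measurableType dd}.
Variables (P : probability Omega R) (u : R -> \bar R) (a : \bar R).
Hypotheses (hu : utility u a) (hA1 : A1 u a) (hA2 : A2 P u).
Variables (K : set (Omega -> R)) (W : Omega -> R).
Hypotheses (K0 : K (fun=> 0)).
Hypothesis KD : forall (c d : R) k1 k2, 0 <= c -> 0 <= d -> K k1 -> K k2 ->
  K (fun w => c * k1 w + d * k2 w).
Hypothesis Km : forall k, K k -> measurable_fun setT k.
Hypothesis KbW : forall k, K k -> exists c : R, {ae P, forall w, - (c * W w) <= k w}.
Local Notation L := (orlicz P (hatu u)).
Local Notation N := (luxemburg P u).
Local Notation LI f := (P.-integrable setT (EFin \o f)).
Local Notation oD := (orlicz_D hu hA1).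
Local Notation olin := (orlicz_lin hu hA1).
Local Notation oZ := (orlicz_Z hu).
Local Notation oN := (orlicz_N hu).
Local Notation ocst := (orlicz_cst P hu).
Local Notation oabs := (orlicz_abs hu).
Local Notation odom := (orlicz_dom hu).
Local Notation omeas := (@orlicz_meas _ _ _ P u).

Hypothesis LW : L W.
Local Notation v := (ufin u).
Local Notation phi := (phi u).
Local Notation eu := (expected_utility P u).
Local Notation dens := (dens_reg P u).
Local Notation snorm Q := (dual_norm P u (sing P u Q)).
Implicit Types (f g h k : Omega -> R) (Q : @functional R dd Omega).

Lemma ae_ex (A : Omega -> Prop) : {ae P, forall w, A w} -> exists w, A w.
Proof.
move=> [B [mB PB sB]]; apply: contrapT => nA.
suff : P setT = 0%E by rewrite probability_setT => /eqP; rewrite onee_eq0.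
apply/eqP; rewrite eq_le measure_ge0 andbT -PB; apply: le_measure; rewrite ?inE//.
by move=> w _; apply: sB => Aw; apply: nA; exists w.
Qed.

Lemma ae_and (A B : Omega -> Prop) : {ae P, forall w, A w} -> {ae P, forall w, B w} ->
  {ae P, forall w, A w /\ B w}.
Proof. exact: ae_mono2. Qed.

Lemma measurable_phi_comp (y : Omega -> R) : measurable_fun setT y ->
  measurable_fun setT (fun w => phi (y w)).
Proof.
move=> my; apply: (measurableT_comp (fine_measurable measurableT)).
exact: (measurable_Phi_comp hu my).
Qed.

Lemma fin_entropy_int (y : Omega -> R) : measurable_fun setT y -> fin_entropy P u y ->
  (\int[P]_w Phi u (y w) = (\int[P]_w phi (y w))%:E)%E.
Proof.
move=> my [iy fy]; rewrite -exp_fin//; apply: ae_eq_integral => //.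
- exact: (measurable_Phi_comp hu).
- by have /measurable_int := iy.
- by apply: ae_mono fy => w fw _; rewrite (PhiEfin hu).
Qed.

Lemma fin_entropy_dom (y : Omega -> R) G : measurable_fun setT y -> LI G ->
  {ae P, forall w, Phi u (y w) <= (G w)%:E}%E -> fin_entropy P u y.
Proof.
move=> my iG yG; have fy : {ae P, forall w, Phi u (y w) < +oo}%E.
  by apply: ae_mono yG => w /le_lt_trans; apply; rewrite ltry.
split=> //; apply: (int_dom (g := fun w => `|v 0| + `|G w|)); first exact: measurable_phi_comp.
  apply: (ae_mono2 _ yG fy) => w + fw; rewrite (PhiEfin hu fw) lee_fin => le.
  have := Phi_ge hu (y w); rewrite (PhiEfin hu fw) lee_fin -/phi => ge.
  have := ler_norm (- v 0); rewrite normrN => ?; have := ler_norm (G w) => ?.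
  have := normr_ge0 (v 0) => ?; have := normr_ge0 (G w) => ?.
  by rewrite ler_norml; apply/andP; split; lra.
by apply: int_D; [exact: int_cst|exact: int_abs].
Qed.

Lemma eu_ge (f : Omega -> \bar R) h : measurable_fun setT f -> LI h ->
  {ae P, forall w, (h w)%:E <= uext u (f w)}%E -> ((\int[P]_w h w)%:E <= eu f)%E.
Proof.
move=> mf ih hf; set g := fun w => uext u (f w).
have mg : measurable_fun setT g by exact: measurableT_comp (measurable_uext hu) mf.
have mh : measurable_fun setT (EFin \o h) by exact/measurable_EFinP/(int_meas ih).
have hn : (\int[P]_w g^\- w <= \int[P]_w (EFin \o h)^\- w)%E.
  apply: ae_ge0_le_integral => //; [exact: measurable_funeneg|exact: measurable_funeneg|].
  apply: ae_mono hf => w le _; rewrite !funenegE ge_max le_max le_max lexx orbT andbT.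
  by rewrite leeN2 le.
have fh := integrable_neg_fin_num measurableT ih.
rewrite /expected_utility -/g ifF; last first.
  apply/negbTE; rewrite -ltey; apply: (le_lt_trans hn).
  by move: fh; rewrite fin_numElt => /andP[].
rewrite -exp_fin// integralE [leRHS]integralE; apply: leeB => //.
apply: ae_ge0_le_integral => //; [exact: measurable_funepos|exact: measurable_funepos|].
apply: ae_mono hf => w le _; rewrite !funeposE ge_max le_max le_max lexx orbT andbT.
by rewrite le.
Qed.

Lemma CW_conv (c d : R) f g : 0 <= c -> 0 <= d -> CW P u K f -> CW P u K g ->
  CW P u K (fun w => c * f w + d * g w).
Proof.
move=> c0 d0 [Lf [k1 [g1 [K1 m1 p1 e1]]]] [Lg [k2 [g2 [K2 m2 p2 e2]]]].
split; first exact: olin.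
exists (fun w => c * k1 w + d * k2 w), (fun w => c * g1 w + d * g2 w); split.
- exact: KD.
- by apply: measurable_funD; exact: measurable_funM.
- by apply: (ae_mono2 _ p1 p2) => w /= *; rewrite addr_ge0// mulr_ge0.
- by apply: (ae_mono2 _ e1 e2) => w -> ->; ring.
Qed.

Lemma CW_neg f : L f -> le_as P (cst 0) f -> CW P u K (fun w => - f w).
Proof.
move=> Lf f0; split; first exact: oN.
exists (fun=> 0), f; split=> //; first exact: omeas Lf.
by apply: ae_all => w; rewrite sub0r.
Qed.

Lemma CW0 : CW P u K (fun=> 0).
Proof.
have := CW_neg (ocst 0) (ae_all P (fun w => lexx 0)).
by congr (CW _ _ _ _); apply/funext => w; rewrite oppr0.
Qed.

(** A gain is bounded below by a multiple of [W] but not above, so it need not lie in the Orlicz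
    space. Its truncations do, and they are obtained from it by discarding a nonnegative amount. *)
Lemma CW_min k (n : R) : K k -> CW P u K (fun w => Num.min (k w) n).
Proof.
move=> Kk; have mk := Km Kk; have [c hc] := KbW Kk.
have mm : measurable_fun setT (fun w => Num.min (k w) n) by exact: measurable_minr.
split.
  apply: (odom (g := fun w => `|c * W w| + `|n|)) => //; last first.
    by apply: oD; [exact/oabs/oZ|exact: ocst].
  apply: ae_mono hc => w hw; rewrite [leRHS]ger0_norm ?addr_ge0//.
  have := ler_norm (c * W w); have := ler_norm n; have := ler_norm (- n); rewrite normrN.
  have := normr_ge0 (c * W w); have := normr_ge0 n; rewrite /Num.min.
  by case: ltP => *; rewrite ler_norml; apply/andP; split; lra.
exists k, (fun w => k w - Num.min (k w) n); split=> //.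
- exact: measurable_funB.
- by apply: ae_all => w /=; rewrite subr_ge0 ge_min lexx.
- by apply: ae_all => w; rewrite subKr.
Qed.

Lemma polar_positive z : dual P u z -> (forall f, CW P u K f -> z f <= 0) -> positive P u z.
Proof.
move=> dz hz f Lf f0; have := hz _ (CW_neg Lf f0).
by rewrite (dual_N hu dz Lf) oppr_le0.
Qed.

Lemma NW_dual Q : NW P u K Q -> dual P u Q /\ positive P u Q.
Proof. by move=> [[dQ cQ _] _ _]; split=> //; exact: polar_positive. Qed.

Lemma NW_dens Q : NW P u K Q ->
  [/\ measurable_fun setT (dens Q), le_as P (cst 0) (dens Q), LI (dens Q),
      0 < \int[P]_w dens Q w & \int[P]_w dens Q w + sing P u Q (cst 1) = 1].
Proof.
move=> NQ; have [dQ pQ] := NW_dual NQ; have [[_ _ Q1] [f0 Lf0 rf0] _] := NQ.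
have [mg g0 gP] := dens_regP hu hA1 dQ pQ.
have [i1 r1] := gP _ (ocst 1).
have e1 : (fun w => 1 * dens Q w) = dens Q by apply/funext => w; rewrite mul1r.
have ig : LI (dens Q) by move: i1; rewrite e1.
have {}r1 : reg P u Q (cst 1) = \int[P]_w dens Q w.
  by rewrite r1; congr Rintegral; apply/funext => w; rewrite mul1r.
split=> //; last by rewrite -r1 -reg_sing.
rewrite lt_neqAle exp_ge0// andbT; apply/eqP => E0.
have g00 : {ae P, forall w, dens Q w = 0} by apply: exp_eq0 => //; rewrite -E0.
move/eqP: rf0; apply; have [i ->] := gP _ Lf0.
rewrite -[RHS](exp_cst P 0); apply: exp_ae => //; first exact: int_meas i.
by apply: ae_mono g00 => w ->; rewrite mulr0.
Qed.

Lemma NW_entropy Q (lam : R) : NW P u K Q -> 0 < lam ->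
  fin_entropy P u (fun w => lam * dens Q w) /\
  forall x, dual_value P u x lam Q =
    (lam * (x + snorm Q) + \int[P]_w phi (lam * dens Q w))%:E.
Proof.
move=> NQ l0; have [mg g0 ig m0 _] := NW_dens NQ; have [_ _ [_ _ hg]] := NQ.
have [|fe e] := fin_entropyP hu (y := fun w => lam * dens Q w) _ (entropy_scale hu hA2 ig g0 m0 hg l0).
  exact: measurable_funM.
by split=> // x; rewrite /dual_value e EFinD.
Qed.

Lemma NW_sing Q : NW P u K Q -> [/\ dual P u (sing P u Q), positive P u (sing P u Q) &
  exists A, concentrated P (sing P u Q) A].
Proof.
move=> NQ; have [dQ pQ] := NW_dual NQ; split.
- exact: (sing_dual hu hA1).
- exact: (sing_positive hu hA1).
- exact: (sing_concentrated hu hA1).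
Qed.

(** Fenchel's inequality at each point. Almost surely [f w = +oo] only where the density is 0, and
    there the inequality reads [u(oo) <= Phi 0]. *)
Lemma KPhi_bound x Q (lam : R) (f : Omega -> \bar R) : KPhi P u K x f -> NW P u K Q -> 0 < lam ->
  let H := fun w => phi (lam * dens Q w) + lam * fine (f w * (dens Q w)%:E)%E in
  [/\ LI H, {ae P, forall w, uext u (f w) <= (H w)%:E}%E &
    \int[P]_w H w <= lam * (x + snorm Q) + \int[P]_w phi (lam * dens Q w)].
Proof.
move=> [mf fNy hf] NQ l0 H; have [ifg hfg] := hf Q NQ.
have [[ie fe] _] := NW_entropy NQ l0; have [mg g0 ig _ _] := NW_dens NQ.
have [ih fh] := int_fine ifg.
split.
- by apply: int_D => //; exact: int_Z.
- have g0f : {ae P, forall w, 0 <= dens Q w /\ (Phi u (lam * dens Q w) < +oo)%E} by apply: (ae_mono2 _ g0 fe).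
  apply: (ae_mono2 _ g0f fh) => w [gw Pw] e; rewrite /H EFinD EFinM -e -(PhiEfin hu Pw).
  move: (fNy w) e; case: (f w) => [r| |] //= _ e.
    have := Phi_ub u r (lam * dens Q w); rewrite leeBlDr//.
    by rewrite mulrCA.
  move: gw; rewrite le_eqVlt => /predU1P[gw|gw].
    by rewrite -gw mulr0 (Phi0 hu) !mule0 adde0.
  by move: e; rewrite gt0_mulye.
- rewrite exp_D//; last exact: int_Z.
  rewrite exp_Z// addrC lerD2r ler_pM2l// -lee_fin -exp_fin//.
  apply: le_trans hfg; rewrite le_eqVlt; apply/orP; left; apply/eqP.
  apply: ae_eq_integral => //; [by have /measurable_int := ih|by have /measurable_int := ifg|].
  by apply: ae_mono fh => w <-.
Qed.

Lemma weak_duality x Q (lam : R) (f : Omega -> \bar R) : KPhi P u K x f -> NW P u K Q -> 0 < lam ->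
  (eu f <= dual_value P u x lam Q)%E.
Proof.
move=> Kf NQ l0; have [iH fH EH] := KPhi_bound Kf NQ l0.
have [_ ->] := NW_entropy NQ l0; have [mf _ _] := Kf.
by apply: (le_trans (eu_le hu mf iH fH)); rewrite lee_fin.
Qed.

Lemma shift_min_ge (x y n : R) : `|x| <= n ->
  - Num.max (- (x + y)) 0 <= x + Num.min y n.
Proof.
move=> xn; have := ler_norm (- x); rewrite normrN /Num.max /Num.min => xx.
by case: ltP => ?; case: ltP => ?; lra.
Qed.

(** The constraint is first obtained for truncated gains, at which [Q] can be evaluated. Finite
    expected utility gives the losses [m] a finite modular, so the singular part charges at most its
    norm for them. Fatou's lemma removes the truncation. *)
Lemma gains_KPhi x k : K k -> (-oo < eu (fun w => (x + k w)%:E))%E ->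
  KPhi P u K x (fun w => (x + k w)%:E).
Proof.
move=> Kk euk; have mk := Km Kk.
have mxk : measurable_fun setT (fun w => x + k w) by exact: measurable_funD.
split=> //; first exact/measurable_EFinP.
move=> Q NQ; have [dQ pQ] := NW_dual NQ; have [[_ cQ Q1] _ _] := NQ.
have [ds ps [A cA]] := NW_sing NQ; have [mg g0 ig _ _] := NW_dens NQ.
have [_ _ gP] := dens_regP hu hA1 dQ pQ.
pose m w : R := Num.max (- (x + k w)) 0.
have mm : measurable_fun setT m by apply: measurable_maxr => //; exact: measurableT_comp.
have m0 w : 0 <= m w by rewrite /m le_max lexx orbT.
have hm : (modular P u m < +oo)%E.
  move: euk; rewrite /expected_utility /=; case: ifPn => // /negP hn _.
  have {}hn : (\int[P]_w (fun w => u (x + k w)) ^\- w < +oo)%E by rewrite ltey; exact/negP.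
  have mu_ : measurable_fun setT (fun w => u (x + k w)) by exact: measurableT_comp (measurable_u hu) mxk.
  apply: (@le_lt_trans _ _ (\int[P]_w (`|v 0|%:E + (fun w => u (x + k w))^\- w))%E).
    apply: ge0_le_integral => //.
    - by move=> w _; exact: (hatu_ge0 hu).
    - exact: (measurable_hatu_comp hu mm).
    - by apply: emeasurable_funD => //; exact: measurable_funeneg.
    move=> w _; rewrite /m /Num.max; case: ltP => xk.
      by rewrite (hatu0 hu) adde_ge0 ?lee_fin.
    rewrite (hatuN u) /hatu ler0_norm ?oppr_le0 ?opprK; last by rewrite -oppr_ge0.
    rewrite (u0E hu); apply: leeD; first by rewrite lee_fin ler_norm.
    by rewrite funenegE le_max lexx.
  rewrite ge0_integralD//; [|exact: measurable_funeneg].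
  by rewrite lte_add_pinfty//; have /integrableP[_] := int_cst P `|v 0|; rewrite /= normr_id.
have Lm : L m by exact: orlicz_modular hm.
have [imG _] := gP _ Lm.
have sm : sing P u Q m <= snorm Q.
  have := sing_le_norm hu hA1 ds ps cA Lm hm; congr (_ <= _).
  by congr (sing P u Q _); apply/funext => w; rewrite ger0_norm.
(* The level is at least [|x|], so truncation does not push [x + c n] below [- m]. *)
pose c n w : R := Num.min (k w) (`|x| + n%:R).
have Cc n : CW P u K (c n) by exact: CW_min.
have Lxc n : L (fun w => x + c n w) by apply: oD; [exact: ocst|case: (Cc n)].
have bound n : LI (fun w => (x + c n w) * dens Q w) /\
    \int[P]_w ((x + c n w) * dens Q w) <= x + snorm Q.
  have [i rE] := gP _ (Lxc n); split=> //; rewrite -rE.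
  have Lc : L (c n) by case: (Cc n).
  have : Q (fun w => x + c n w) <= x.
    rewrite (dual_D hu dQ (ocst x) Lc).
    have -> : (fun=> x) = (fun w : Omega => x * cst 1 w) by apply/funext => w /=; rewrite mulr1.
    by rewrite (dual_Z hu _ dQ (ocst 1)) Q1 mulr1 gerDl; exact: cQ.
  have : - sing P u Q m <= sing P u Q (fun w => x + c n w).
    rewrite -(dual_N hu ds Lm); apply: (pos_mono hu hA1 ds ps) => //; first exact: oN.
    by apply: ae_all => w; apply: shift_min_ge; rewrite lerDl.
  rewrite (reg_sing P u Q (fun w => x + c n w)); lra.
have HF : (\int[P]_w (`|x + k w + m w| * `|dens Q w|)%:E <= (x + snorm Q + \int[P]_w (m w * dens Q w))%:E)%E.
  apply: (exp_fatou (h := fun n w => (x + c n w) * dens Q w + m w * dens Q w)).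
  - by move=> n; apply: int_D => //; case: (bound n).
  - move=> n; apply: ae_mono g0 => w gw; rewrite -mulrDl mulr_ge0//.
    by rewrite -lerBlDr sub0r; apply: shift_min_ge; rewrite lerDl.
  - apply/measurable_EFinP; apply: measurable_funM; apply: measurableT_comp => //.
    exact: measurable_funD.
  - by move=> w; rewrite lee_fin mulr_ge0.
  - by move=> n; rewrite exp_D ?lerD2r//; case: (bound n).
  - apply: ae_mono g0 => w gw M; rewrite lte_fin => HM.
    have [N kN] : exists N, k w <= N%:R.
      by exists (Num.truncn `|k w|).+1; rewrite (le_trans (ler_norm _))// ltW// truncnS_gt.
    exists N => n Nn; have -> : c n w = k w.
      rewrite /c; apply/min_idPl; rewrite (le_trans kN)// -[leLHS]add0r lerD// ler_nat//.
    rewrite -mulrDl; apply: ltW; apply: (lt_le_trans HM).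
    rewrite (ger0_norm gw) ger0_norm// /m /Num.max; case: ltP; lra.
have iS : LI (fun w => (x + k w + m w) * dens Q w).
  apply/integrableP; split.
    by apply/measurable_EFinP; apply: measurable_funM => //; exact: measurable_funD.
  by apply: le_lt_trans (ltry _) => /=; under eq_integral do rewrite normrM; exact: HF.
have iS' : LI (fun w => (x + k w) * dens Q w).
  have := int_B iS imG; congr (P.-integrable _ _); apply/funext => w /=; congr EFin; ring.
split; first by rewrite (_ : (fun w => _) = EFin \o (fun w => (x + k w) * dens Q w)).
rewrite (_ : (\int[P]_w _)%E = (\int[P]_w ((x + k w) * dens Q w)%:E)%E)//.
rewrite exp_fin// lee_fin.
rewrite -(lerD2r (\int[P]_w (m w * dens Q w))) -exp_D//.
rewrite -lee_fin; apply: le_trans HF; rewrite -exp_fin; last exact: int_D.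
rewrite le_eqVlt; apply/orP; left; apply/eqP; apply: ae_eq_integral => //.
- by have /measurable_int := int_D iS' imG.
- apply/measurable_EFinP; apply: measurable_funM; apply: measurableT_comp => //.
  exact: measurable_funD.
- apply: ae_mono g0 => w gw _; congr EFin; rewrite -mulrDl (ger0_norm gw) ger0_norm//.
  by rewrite /m /Num.max; case: ltP; lra.
Qed.

Lemma UW_le_UPhi x : (UW P u K x <= UPhi P u K x)%E.
Proof.
apply: ge_ereal_sup => _ [k Kk <-].
have [->|euk] := eqVneq (eu (fun w => (x + k w)%:E)) -oo%E; first exact: leNye.
apply: ereal_sup_ubound; exists (fun w => (x + k w)%:E) => //.
by apply: gains_KPhi => //; rewrite ltNye.
Qed.

(** For [x < 0] the constant [- x] has finite modular, so [- x * s (cst 1)] is at most the norm.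
    This rules out a vanishing regular part in [strong_duality]. *)
Lemma sing_shift_ge0 (s : functional) x (A : nat -> set Omega) : dual P u s -> positive P u s ->
  concentrated P s A -> (a < x%:E)%E -> 0 <= dual_norm P u s + x * s (cst 1).
Proof.
move=> ds ps cA ax; have s1 : 0 <= s (cst 1) by apply: ps; [exact: ocst|exact: ae_all].
have [x0|x0] := leP 0 x; first by rewrite addr_ge0 ?(dual_norm_ge0 hu hA1)// mulr_ge0.
have := sing_cst_le hu hA1 (c := - x) ds ps cA; rewrite opprK oppr_ge0 => /(_ (ltW x0) ax).
by rewrite mulNr; lra.
Qed.

Lemma strong_duality x (V : R) : (a < x%:E)%E -> (V%:E < uinfty u)%E ->
  (forall k, K k -> (eu (fun w => (x + k w)%:E) <= V%:E)%E) ->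
  exists lam Q, [/\ 0 < lam, NW P u K Q & (dual_value P u x lam Q <= V%:E)%E].
Proof.
move=> ax Vu HV.
have [||z [dz cz Hz]] := @supergradient R dd Omega P u a hu hA1 (CW P u K) x V _ CW0 CW_conv ax.
- by move=> f [].
- move=> c [Lc [k [g [Kk mg g0 e]]]] G; rewrite -lee_fin; apply: le_trans (HV k Kk).
  have [Lxc uxc ixc] := G; apply: eu_ge => //.
    by apply/measurable_EFinP; apply: measurable_funD => //; exact: Km.
  have g0e : {ae P, forall w, 0 <= g w /\ c w = k w - g w} by apply: (ae_mono2 _ g0 e).
  apply: (ae_mono2 _ g0e uxc) => w [gw cw] uw /=.
  rewrite -(ufinE_gtNy hu uw); apply: (util_homo hu); rewrite cw; lra.
have pz := polar_positive dz cz.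
have [fe le] := dual_bound hu hA1 dz pz Hz.
have [mg g0 gP] := dens_regP hu hA1 dz pz; set g := dens z in fe le mg g0 gP.
have ds := sing_dual hu hA1 dz pz; have ps := sing_positive hu hA1 dz pz.
have [A cA] := sing_concentrated hu hA1 dz pz.
have [i1 r1] := gP _ (ocst 1).
have e1 : (fun w => 1 * g w) = g by apply/funext => w; rewrite mul1r.
have ig : LI g by move: i1; rewrite e1.
have z1 : z (cst 1) = \int[P]_w g w + sing P u z (cst 1).
  by rewrite (reg_sing P u z) r1; congr (Rintegral _ _ _ + _); apply/funext => w; rewrite mul1r.
have s1 : 0 <= sing P u z (cst 1) by apply: ps; [exact: ocst|exact: ae_all].
(* With [g = 0] the bound [le] would read [Phi 0 + ||z_s|| + x * z_s(1) <= V], against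
   [V < u(oo) = Phi 0]. *)
have m0 : 0 < \int[P]_w g w.
  rewrite lt_neqAle exp_ge0// andbT; apply/eqP => E0.
  have g00 : {ae P, forall w, g w = 0} by apply: exp_eq0 => //; rewrite -E0.
  have P0 : Phi u 0 = (phi 0)%:E.
    apply: (PhiEfin hu); have [_ fPhi] := fe.
    have [|w [-> //]] := ae_ex (A := fun w => g w = 0 /\ (Phi u (g w) < +oo)%E).
    by apply: (ae_mono2 _ g00 fPhi).
  have Ephi : \int[P]_w phi (g w) = phi 0.
    rewrite -[RHS](exp_cst P); apply: exp_ae => //; first by case: fe => /int_meas.
    by apply: ae_mono g00 => w ->.
  move: Vu; rewrite -(Phi0 hu) P0 lte_fin.
  have := sing_shift_ge0 ds ps cA ax; move: le; rewrite Ephi z1 -E0 add0r; lra.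
pose lam := z (cst 1); have l0 : 0 < lam by rewrite /lam z1 ltr_wpDr.
(* The normalization of [z], written as a combination so that [dens_reg_combine] and
   [dual_norm_combine] apply; the multiplier is the mass of [z]. *)
pose Q := combine lam^-1 0 z z.
have li0 : 0 <= lam^-1 by rewrite invr_ge0 ltW.
have [densQ singQ] := dens_reg_combine hu hA1 li0 (lexx 0) dz dz pz pz.
rewrite -/Q in densQ singQ.
have dQ : dual P u Q by exact: dual_comb.
have pQ : positive P u Q by exact: positive_combine.
have [mgQ g0Q gPQ] := dens_regP hu hA1 dQ pQ.
have {}densQ : {ae P, forall w, dens Q w = lam^-1 * g w}.
  by apply: ae_mono densQ => w ->; rewrite mul0r addr0.
have pos (A' : R) : 0 < A' -> lam^-1 * A' != 0.
  by move=> A0; rewrite mulf_neq0 ?invr_eq0 ?lt0r_neq0.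
have NQ : NW P u K Q.
  split; first split=> //.
  - by move=> f Cf; rewrite /Q /combine mul0r addr0; apply: mulr_ge0_le0 => //; exact: cz.
  - by rewrite /Q /combine mul0r addr0 mulVf// gt_eqF.
  - exists (cst 1); first exact: ocst.
    have [iQ1 ->] := gPQ _ (ocst 1).
    have -> : \int[P]_w (1 * dens Q w) = lam^-1 * \int[P]_w g w.
      transitivity (\int[P]_w dens Q w).
        by congr Rintegral; apply/funext => w; rewrite mul1r.
      rewrite (exp_ae mgQ (g := fun w => lam^-1 * g w)) ?exp_Z//; exact: measurable_funM.
    exact (pos _ m0).
  - split=> //; rewrite (int_Phi_ae hu (g := fun w => lam^-1 * g w))//; last exact: measurable_funM.
    apply: (entropy_scale hu hA2 ig g0 m0); last by rewrite invr_gt0.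
    by rewrite (fin_entropy_int mg fe) ltry.
exists lam, Q; split=> //; have [[_ _] ->] := NW_entropy NQ l0; rewrite lee_fin.
have -> : \int[P]_w phi (lam * dens Q w) = \int[P]_w phi (g w).
  apply: exp_ae; [exact/measurable_phi_comp/measurable_funM|exact: measurable_phi_comp|].
  by apply: ae_mono densQ => w ->; rewrite mulrA mulfV ?mul1r// gt_eqF.
have : lam * snorm Q <= snorm z.
  rewrite (dual_norm_ext (z2 := combine lam^-1 0 (sing P u z) (sing P u z)))//.
  have := dual_norm_combine hu hA1 li0 (lexx 0) ds ds; rewrite mul0r addr0.
  by rewrite -(ler_pM2l l0) mulrA mulfV ?mul1r// gt_eqF.
by move: le; rewrite -/lam; lra.
Qed.

(** Otherwise the entropy of [t * dens Q] would stay above [Phi 0 - t * (x + ||Q_s||)], a finite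
    slope at 0. As [- Phi' 0 = +oo], [slope_fatou] started at [y = 0] forces the density to vanish,
    which membership in [NW] excludes. *)
Lemma dual_value_lt x Q : NW P u K Q -> exists lam : R,
  0 < lam /\ (dual_value P u x lam Q < uinfty u)%E.
Proof.
move=> NQ; apply: contrapT => H.
have {}H (lam : R) : 0 < lam -> (uinfty u <= dual_value P u x lam Q)%E.
  by move=> l0; rewrite leNgt; apply/negP => lt; apply: H; exists lam.
have [mg g0 ig m0 _] := NW_dens NQ.
have fP0 : (Phi u 0 < +oo)%E.
  rewrite (Phi0 hu); apply: le_lt_trans (H 1 ltr01) _.
  by have [_ ->] := NW_entropy NQ ltr01; rewrite ltry.
have [fe1 _] := NW_entropy NQ ltr01.
have e1 : (fun w => 1 * dens Q w) = dens Q by apply/funext => w; rewrite mul1r.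
have fe : fin_entropy P u (dens Q) by move: fe1; rewrite e1.
have fe0 : fin_entropy P u (fun=> 0) by split; [exact: int_cst|exact: ae_all].
have HB (t : R) : 0 < t <= 1 -> \int[P]_w phi 0 - \int[P]_w phi (0 + t * (dens Q w - 0)) <= t * (x + snorm Q).
  move=> /andP[t0 t1]; rewrite exp_cst.
  have := H t t0; have [_ ->] := NW_entropy NQ t0.
  rewrite -(Phi0 hu) (PhiEfin hu fP0) lee_fin.
  have -> : \int[P]_w phi (0 + t * (dens Q w - 0)) = \int[P]_w phi (t * dens Q w).
    by congr Rintegral; apply/funext => w; rewrite add0r subr0.
  lra.
have mz : measurable_fun setT (fun _ : Omega => 0 : R) by exact: measurable_cst.
have z0 : le_as P (cst 0) (fun=> 0) by exact: ae_all.
have [iF Ffin _] := slope_fatou hu hA1 mz mg z0 g0 fe0 fe HB.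
have gz : {ae P, forall w, dens Q w = 0}.
  apply: (ae_mono2 _ g0 Ffin) => w /= + e.
  rewrite le_eqVlt => /predU1P[<-//|gw]; move: e.
  by rewrite (dPhiE0 _ (lexx 0)) subr0 gt0_mulye.
have := exp_ae mg (measurable_cst _) gz; rewrite exp_cst => E.
by move: m0; rewrite E ltxx.
Qed.

Lemma v_le_UW x : (a < x%:E)%E -> ((v x)%:E <= UW P u K x)%E.
Proof.
move=> ax; apply: ereal_sup_ubound; exists (fun=> 0) => //.
rewrite (eu_eq hu (h := fun=> v x)) ?exp_cst//; last 2 first.
- exact: int_cst.
- by apply: ae_all => w /=; rewrite addr0; exact: (ufinE hu ax).
Qed.

Lemma UW_fin x Q (lam : R) : (a < x%:E)%E -> NW P u K Q -> 0 < lam ->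
  UW P u K x = (fine (UW P u K x))%:E.
Proof.
move=> ax NQ l0; rewrite fineK// fin_numElt; apply/andP; split.
  by apply: lt_le_trans (v_le_UW ax); rewrite ltNyr.
apply: (le_lt_trans (UW_le_UPhi x)); have [_ e] := NW_entropy NQ l0.
apply: (@le_lt_trans _ _ (dual_value P u x lam Q)); last by rewrite e ltry.
by apply: ge_ereal_sup => _ [f Kf <-]; exact: weak_duality.
Qed.

Lemma UPhi_le_dual x Q (lam : R) : NW P u K Q -> 0 < lam ->
  (UPhi P u K x <= dual_value P u x lam Q)%E.
Proof. by move=> NQ l0; apply: ge_ereal_sup => _ [f Kf <-]; exact: weak_duality. Qed.

(* Strong duality at one point makes [NW] nonempty, and then, by
   [dual_value_lt], its hypothesis holds at every point. *)
Lemma NW_nonempty : (exists2 x : R, (a < x%:E)%E & (UW P u K x < uinfty u)%E) ->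
  NW P u K !=set0.
Proof.
move=> [x ax Ux].
have fU : UW P u K x = (fine (UW P u K x))%:E.
  rewrite fineK// fin_numElt; apply/andP; split.
    by apply: lt_le_trans (v_le_UW ax); rewrite ltNyr.
  by apply: (lt_le_trans Ux); rewrite leey.
have [||lam [Q [_ NQ _]]] := @strong_duality x (fine (UW P u K x)) ax.
- by rewrite -fU.
- by move=> k Kk; rewrite -fU; apply: ereal_sup_ubound; exists k.
by exists Q.
Qed.

(** The minimum is attained because [strong_duality] accepts the primal value itself as [V]; weak
    duality and [dual_value_lt] show that this value is below [u(oo)]. *)
Lemma dual_attained x : NW P u K !=set0 -> (a < x%:E)%E ->
  exists lam Q, [/\ 0 < lam, NW P u K Q & (dual_value P u x lam Q <= UW P u K x)%E].
Proof.
move=> [Q0 NQ0] ax; have [lam0 [l0 lt]] := dual_value_lt x NQ0.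
have fU := UW_fin ax NQ0 l0; rewrite fU; apply: strong_duality => //.
  rewrite -fU; apply: le_lt_trans lt.
  by apply: (le_trans (UW_le_UPhi x)); exact: UPhi_le_dual.
by move=> k Kk; rewrite -fU; apply: ereal_sup_ubound; exists k.
Qed.

Lemma NW_combine Q Q' (c d : R) : NW P u K Q -> NW P u K Q' -> 0 < c -> 0 < d -> c + d = 1 ->
  NW P u K (combine c d Q Q') /\
  {ae P, forall w, dens (combine c d Q Q') w = c * dens Q w + d * dens Q' w} /\
  snorm (combine c d Q Q') <= c * snorm Q + d * snorm Q'.
Proof.
move=> NQ NQ' c0 d0 cd; set q := combine c d Q Q'.
have c01 : 0 <= c <= 1 by rewrite ltW//= -cd lerDl ltW.
have [dQ pQ] := NW_dual NQ; have [dQ' pQ'] := NW_dual NQ'.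
have [[_ cQ Q1] _ _] := NQ; have [[_ cQ' Q'1] _ _] := NQ'.
have [mg g0 ig m0 _] := NW_dens NQ; have [mg' g'0 ig' m'0 _] := NW_dens NQ'.
have [ds ps _] := NW_sing NQ; have [ds' ps' _] := NW_sing NQ'.
have [dq sq] := dens_reg_combine hu hA1 (ltW c0) (ltW d0) dQ dQ' pQ pQ'; rewrite -/q in dq sq.
have dualq : dual P u q by exact: dual_comb.
have posq : positive P u q by apply: positive_combine => //; exact: ltW.
have [mq q0 qP] := dens_regP hu hA1 dualq posq.
have ndq : {ae P, forall w, 0 <= dens Q w /\ 0 <= dens Q' w} by apply: (ae_mono2 _ g0 g'0).
have pos (A B : R) : 0 < A -> 0 < B -> c * A + d * B != 0.
  by move=> A0 B0; apply: lt0r_neq0; apply: addr_gt0; exact: mulr_gt0.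
split; last split=> //; last first.
  rewrite (dual_norm_ext (z2 := combine c d (sing P u Q) (sing P u Q')))//.
  by apply: (dual_norm_combine hu hA1) => //; exact: ltW.
have mcd : measurable_fun setT (fun w => c * dens Q w + d * dens Q' w).
  by apply: measurable_funD; exact: measurable_funM.
split; first split=> //.
- move=> f Cf; rewrite /q /combine; have := cQ f Cf; have := cQ' f Cf => H1 H2.
  by rewrite -oppr_ge0 opprD addr_ge0// -mulrN mulr_ge0 ?oppr_ge0// ltW.
- by rewrite /q /combine Q1 Q'1 !mulr1.
- exists (cst 1); first exact: ocst.
  have [_ ->] := qP _ (ocst 1).
  have -> : \int[P]_w (1 * dens q w) = c * \int[P]_w dens Q w + d * \int[P]_w dens Q' w.
    transitivity (\int[P]_w dens q w).
      by congr Rintegral; apply/funext => w; rewrite mul1r.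
    rewrite (exp_ae mq mcd dq) exp_D ?exp_Z//; exact: int_Z.
  exact (pos _ _ m0 m'0).
- split=> //; rewrite (int_Phi_ae hu mq mcd dq).
  have [_ _ [_ _ h1]] := NQ; have [_ _ [_ _ h2]] := NQ'.
  have [[i1 f1] _] := fin_entropyP hu mg h1; have [[i2 f2] _] := fin_entropyP hu mg' h2.
  have ff : {ae P, forall w, (Phi u (dens Q w) < +oo)%E /\ (Phi u (dens Q' w) < +oo)%E} by apply: (ae_mono2 _ f1 f2).
  have dE : d = 1 - c by rewrite -cd addrC addKr.
  rewrite (fin_entropy_int mcd) ?ltry//.
  apply: (fin_entropy_dom (G := fun w => c * phi (dens Q w) + d * phi (dens Q' w))) => //.
    by apply: int_D; exact: int_Z.
  apply: ae_mono ff => w [h h']; rewrite dE; exact: (phi_conv hu).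
Qed.

Lemma ereal_le_anti (p q : \bar R) : (p <= q)%E -> (q <= p)%E -> p = q.
Proof. by move=> pq qp; apply: le_anti; rewrite pq. Qed.

Lemma perturbation_arith (lam mu t x s s1 s2 A B B' : R) :
  ((1 - t) * lam + t * mu) * s <= (1 - t) * lam * s1 + t * mu * s2 ->
  lam * (x + s1) + A <= ((1 - t) * lam + t * mu) * (x + s) + B -> B = B' ->
  A - B' <= t * (mu * (x + s2) - lam * (x + s1)).
Proof. by move=> H1 H2 <-; lra. Qed.

(* [M] and [s] stand for the norm and the mass of the singular part, [G] for
   the mass of the regular part. *)
Lemma multiplier_arith (x lam lam' s s' M M' G G' A A' : R) : (a < x%:E)%E ->
  G + s = 1 -> G' + s' = 1 -> lam' * G' = lam * G ->
  (a = -oo%E -> s = 0) -> (forall r : R, a = r%:E -> M = - r * s) ->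
  (a = -oo%E -> s' = 0) -> (forall r : R, a = r%:E -> M' = - r * s') ->
  A' = A -> lam * (x + M) + A = lam' * (x + M') + A' -> lam' = lam.
Proof.
move=> ax E1 E1' Elg aNy ar aNy' ar' -> /addIr H; case: a ax aNy ar aNy' ar' => [r| |] //.
  rewrite lte_fin => rx _ /(_ r erefl) MM _ /(_ r erefl) MM'.
  have : (lam' - lam) * (x - r) = 0.
    move: H; rewrite MM MM'; have -> : s = 1 - G by rewrite -E1 addrC addKr.
    have -> : s' = 1 - G' by rewrite -E1' addrC addKr.
    by have /= := congr1 (fun y => r * y) Elg; lra.
  move=> /eqP; rewrite mulf_eq0 !subr_eq0 => /orP[/eqP//|/eqP xr].
  by move: rx; rewrite xr ltxx.
move=> _ /(_ erefl) s0 _ /(_ erefl) s'0 _.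
by move: E1 E1' Elg; rewrite s0 s'0 !addr0 => -> ->; rewrite !mulr1.
Qed.

(** * The optimizer attached to a dual solution *)

Section Optimal.
Variables (x lam : R) (Q : @functional R dd Omega).
Hypothesis sol : dual_solution P u K x lam Q.
Local Notation II := (inv_marginal u a).
Let l0 : 0 < lam. Proof. by case: sol. Qed.
Let NQ : NW P u K Q. Proof. by case: sol. Qed.
Let fx w := (- dPhi u (lam * dens Q w))%E.

Lemma optimizer_cases w : 0 <= dens Q w ->
  (dens Q w = 0 /\ fx w = +oo%E) \/
  (0 < dens Q w /\ fx w = (II (lam * dens Q w))%:E).
Proof.
rewrite le_eqVlt => /predU1P[/esym e|gw]; [left|right]; split=> //; rewrite /fx.
  by apply: dPhiE0; rewrite e mulr0.
by apply: (dPhiE hu hA1); exact: mulr_gt0.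
Qed.

(** The dual objective is convex in the unnormalized functional [lam * Q] rather than in the pair.
    The segment towards [mu * Q'] is taken there, with mass [l] and weights divided by [l], and
    [slope_fatou] turns minimality into a first-order inequality. *)
Lemma optimal_slope Q' (mu : R) : NW P u K Q' -> 0 < mu ->
  let F := fun w => (fx w * (mu * dens Q' w - lam * dens Q w)%:E)%E in
  [/\ P.-integrable setT F, {ae P, forall w, F w = (fine (F w))%:E} &
    \int[P]_w fine (F w) <= mu * (x + snorm Q') - lam * (x + snorm Q)].
Proof.
move=> NQ' mu0; have [_ _ opt] := sol.
have [mg g0 _ _ _] := NW_dens NQ; have [mg' g'0 _ _ _] := NW_dens NQ'.
have [fe e] := NW_entropy NQ l0; have [fe' e'] := NW_entropy NQ' mu0.
have my : measurable_fun setT (fun w => lam * dens Q w) by exact: measurable_funM.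
have my' : measurable_fun setT (fun w => mu * dens Q' w) by exact: measurable_funM.
have y0 : le_as P (cst 0) (fun w => lam * dens Q w).
  by apply: ae_mono g0 => w gw; rewrite mulr_ge0// ltW.
have y'0 : le_as P (cst 0) (fun w => mu * dens Q' w).
  by apply: ae_mono g'0 => w gw; rewrite mulr_ge0// ltW.
apply: (slope_fatou hu hA1 my my' y0 y'0 fe fe') => t /andP[t0].
rewrite le_eqVlt => /predU1P[->|t1].
  have := opt mu Q' mu0 NQ'; rewrite e e' lee_fin mul1r.
  rewrite (_ : \int[P]_w phi (lam * dens Q w + 1 * (mu * dens Q' w - lam * dens Q w)) =
    \int[P]_w phi (mu * dens Q' w)); last first.
    by congr Rintegral; apply/funext => w; congr phi; rewrite mul1r addrC subrK.
  have arith (A B p q : R) : A + p <= B + q -> p - q <= B - A by lra.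
  exact: arith.
pose l : R := (1 - t) * lam + t * mu.
have c0 : 0 < (1 - t) * lam by rewrite mulr_gt0// subr_gt0.
have d0 : 0 < t * mu by rewrite mulr_gt0.
have lt0 : 0 < l by rewrite addr_gt0.
have cd : (1 - t) * lam / l + t * mu / l = 1 by rewrite -mulrDl mulfV// gt_eqF.
have c0' : 0 < (1 - t) * lam / l by rewrite divr_gt0.
have d0' : 0 < t * mu / l by rewrite divr_gt0.
have [NQt [dQt sQt]] := NW_combine NQ NQ' c0' d0' cd.
have [_ et] := NW_entropy NQt lt0; have [mgt _ _ _ _] := NW_dens NQt.
have O := opt _ _ lt0 NQt; rewrite e et lee_fin in O.
have E3 : \int[P]_w phi (l * dens (combine ((1 - t) * lam / l) (t * mu / l) Q Q') w) =
    \int[P]_w phi (lam * dens Q w + t * (mu * dens Q' w - lam * dens Q w)).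
  apply: exp_ae.
  - by apply: measurable_phi_comp; exact: measurable_funM.
  - apply: measurable_phi_comp; apply: measurable_funD => //.
    by apply: measurable_funM => //; exact: measurable_funB.
  - apply: ae_mono dQt => w ->; congr phi; rewrite /l; field; exact: lt0r_neq0.
have sQt' : l * snorm (combine ((1 - t) * lam / l) (t * mu / l) Q Q') <=
    (1 - t) * lam * snorm Q + t * mu * snorm Q'.
  have arith (s s1 s2 : R) : s <= (1 - t) * lam / l * s1 + t * mu / l * s2 ->
      l * s <= (1 - t) * lam * s1 + t * mu * s2.
    move=> le; rewrite -ler_pdivlMl//; apply: (le_trans le).
    rewrite le_eqVlt; apply/orP; left; apply/eqP; ring.
  exact (arith _ _ _ sQt).
exact (perturbation_arith sQt' O E3).
Qed.

Let p w := fine (fx w * (dens Q w)%:E)%E.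

Lemma optimizer_prod w : 0 <= dens Q w ->
  (fx w * (dens Q w)%:E)%E = (p w)%:E /\
  forall c : R, (fx w * (c * dens Q w)%:E)%E = (c * p w)%:E.
Proof.
move=> gw; rewrite /p; have [[-> ->]|[g1 ->]] := optimizer_cases gw.
  by rewrite mule0; split=> // c; rewrite !mulr0 mule0.
by split=> // c; rewrite -EFinM mulrCA.
Qed.

Lemma measurable_optimizer : measurable_fun setT fx.
Proof.
have [mg _ _ _ _] := NW_dens NQ.
apply: (measurableT_comp (measurable_dPhi hu hA1)); exact: measurable_funM.
Qed.

(** Rescaling is a perturbation with two signs: [Q' = Q] with [mu = 2 * lam] and with [mu = lam / 2]
    gives opposite inequalities. *)
Lemma optimizer_saturates : LI p /\ \int[P]_w p w = x + snorm Q.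
Proof.
have [mg g0 _ _ _] := NW_dens NQ.
have slope (mu : R) : 0 < mu -> LI (fun w => (mu - lam) * p w) /\
    \int[P]_w ((mu - lam) * p w) <= (mu - lam) * (x + snorm Q).
  move=> mu0; have [iF fF EF] := optimal_slope NQ mu0.
  have [iF' _] := int_fine iF.
  have e : {ae P, forall w, fine (fx w * (mu * dens Q w - lam * dens Q w)%:E)%E = (mu - lam) * p w}.
    by apply: ae_mono g0 => w /optimizer_prod[_ H]; rewrite -mulrBl H.
  have mp : measurable_fun setT (fun w => (mu - lam) * p w).
    apply: measurable_funM => //; apply: (measurableT_comp (fine_measurable measurableT)).
    by apply: emeasurable_funM; [exact: measurable_optimizer|exact/measurable_EFinP].
  split; first exact: int_ae mp e iF'.
  by rewrite mulrBl -(exp_ae _ mp e)//; exact: int_meas iF'.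
have [i1 H1] := slope (2 * lam) ltac:(by rewrite mulr_gt0).
have [i2 H2] := slope (lam / 2) ltac:(by rewrite divr_gt0).
have d1 : 2 * lam - lam = lam by ring.
have d2 : lam / 2 - lam = - (lam / 2) by field.
have ip : LI p.
  have := int_Z lam^-1 i1; congr (P.-integrable _ _); apply/funext => w /=.
  by rewrite d1 mulrA mulVf ?mul1r// gt_eqF.
split=> //; move: H1 H2; rewrite !exp_Z// d1 d2 !mulNr lerN2 ler_pM2l// ler_pM2l ?divr_gt0//.
by move=> H1 H2; apply/eqP; rewrite eq_le H1.
Qed.

(** For [mu = 1] the slope inequality bounds the integral of [fx] against [dens Q' - lam * dens Q];
    adding [lam] times the saturated constraint leaves the constraint for [Q']. *)
Lemma optimizer_KPhi : KPhi P u K x fx.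
Proof.
have [mg g0 _ _ _] := NW_dens NQ.
split; first exact: measurable_optimizer.
  by move=> w; rewrite /fx /dPhi; case: ifP.
move=> Q' NQ'; have [mg' g'0 _ _ _] := NW_dens NQ'.
have [iF fF] := optimal_slope NQ' ltr01; set F := fun w => _ in iF fF * => EF.
have [iF' _] := int_fine iF; have [ip Ep] := optimizer_saturates.
have gg : {ae P, forall w, 0 <= dens Q w /\ 0 <= dens Q' w} by exact (ae_and g0 g'0).
have e : {ae P, forall w, (fx w * (dens Q' w)%:E)%E = (fine (F w) + lam * p w)%:E}.
  apply: (ae_mono2 _ gg fF) => w [gw g'w] Fw.
  have [[ge fe]|[g1 fe]] := optimizer_cases gw.
    move: Fw; rewrite /p /F ge mulr0 subr0 mul1r mule0 mulr0 addr0//.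
  by rewrite /F /p fe -!EFinM /= ; congr EFin; ring.
have iS : LI (fun w => fine (F w) + lam * p w) by apply: int_D => //; exact: int_Z.
have mS : measurable_fun setT (fun w => fx w * (dens Q' w)%:E)%E.
  by apply: emeasurable_funM; [exact: measurable_optimizer|exact/measurable_EFinP].
have /measurable_int mS' := iS.
have E : (\int[P]_w (fx w * (dens Q' w)%:E) = \int[P]_w (fine (F w) + lam * p w)%R%:E)%E.
  by apply: ae_eq_integral => //; apply: ae_mono e => w ->.
split.
  apply: integrable_posneg => //.
    have := integrable_pos_fin_num measurableT iS; rewrite fin_numElt => /andP[_]; congr (_ < _)%E.
    apply: ae_eq_integral => //; [exact: measurable_funepos|exact: measurable_funepos|].
    by apply: ae_mono e => w ew _; rewrite !funeposE ew.
  have := integrable_neg_fin_num measurableT iS; rewrite fin_numElt => /andP[_]; congr (_ < _)%E.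
  apply: ae_eq_integral => //; [exact: measurable_funeneg|exact: measurable_funeneg|].
  by apply: ae_mono e => w ew _; rewrite !funenegE ew.
rewrite E exp_fin// lee_fin exp_D//; last exact: int_Z.
rewrite exp_Z// Ep; move: EF; rewrite mul1r.
have arith (A B C : R) : A <= B - C -> A + C <= B by lra.
exact: arith.
Qed.

Lemma optimizer_value : eu fx = dual_value P u x lam Q.
Proof.
have [mg g0 _ _ _] := NW_dens NQ; have [[ie fe] ->] := NW_entropy NQ l0.
have [ip Ep] := optimizer_saturates.
rewrite (eu_eq hu (h := fun w => phi (lam * dens Q w) + lam * p w)).
- by rewrite exp_D ?exp_Z ?Ep ?(addrC (lam * _))//; exact: int_Z.
- exact: measurable_optimizer.
- by apply: int_D => //; exact: int_Z.
- apply: (ae_mono2 _ g0 fe) => w gw fw.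
  have [[ge fE]|[g1 fE]] := optimizer_cases gw; rewrite /p fE.
    by rewrite ge mulr0 mule0 mulr0 addr0 /= -(Phi0 hu) (PhiEfin hu)//; move: fw; rewrite ge mulr0.
  have y0 : 0 < lam * dens Q w by rewrite mulr_gt0.
  rewrite /= (ufinE hu (inv_marginal_a hA1 y0)) (Fenchel_eq hu hA1 y0).
  by rewrite mulrCA.
Qed.

(** Equal expectations make Fenchel's inequality an equality almost surely. Where the density is
    positive this determines [f w]; where it is 0 it says that the utility of [f w] is [u(oo)],
    which no real number attains. *)
Lemma optimizer_unique (f : Omega -> \bar R) : KPhi P u K x f -> eu f = dual_value P u x lam Q ->
  {ae P, forall w, f w = fx w}.
Proof.
move=> Kf euf; have [mf fNy hf] := Kf; have [mg g0 _ _ _] := NW_dens NQ.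
have [iH fH EH] := KPhi_bound Kf NQ l0; set H := fun w => _ in iH fH EH.
have [[ie fe] dv] := NW_entropy NQ l0.
have [ifg _] := hf Q NQ; have [_ fh] := int_fine ifg.
have [e|[h [ih hE eh]]] := eu_dom hu mf iH fH; first by move: euf; rewrite e dv.
have Hh : {ae P, forall w, H w - h w = 0}.
  apply: exp_eq0; first exact: int_B.
    by apply: (ae_mono2 _ fH hE) => w + e; rewrite e lee_fin subr_ge0.
  rewrite exp_B//; move: euf EH; rewrite eh dv => -[->].
  by rewrite subr_le0.
have gf : {ae P, forall w, 0 <= dens Q w /\ (f w * (dens Q w)%:E)%E = (fine (f w * (dens Q w)%:E))%:E} by apply: (ae_mono2 _ g0 fh).
have hH : {ae P, forall w, uext u (f w) = (H w)%:E /\ (Phi u (lam * dens Q w) < +oo)%E}.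
  have hH' : {ae P, forall w, uext u (f w) = (H w)%:E}.
    by apply: (ae_mono2 _ hE Hh) => w -> /eqP; rewrite subr_eq0 => /eqP ->.
  by apply: (ae_mono2 _ hH' fe).
apply: (ae_mono2 _ gf hH) => w [gw fgw] [uw Pw].
have [[ge ->]|[g1 ->]] := optimizer_cases gw.
  move: uw; rewrite /H ge mule0 !mulr0 addr0 /=.
  have -> : (phi 0)%:E = uinfty u.
    by rewrite -(Phi0 hu) (PhiEfin hu)//; move: Pw; rewrite ge mulr0.
  move: (fNy w); case: (f w) => [r| |] //= _ ur.
  by have := u_lt_uinfty hu hA1 r; rewrite ur ltxx.
have y0 : 0 < lam * dens Q w by rewrite mulr_gt0.
move: uw; rewrite /H; move: (fNy w) fgw; case: (f w) => [r| |] //= _; last first.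
  by rewrite gt0_mulye.
move=> _ ur; congr EFin; apply: (Fenchel_eq_unique hu hA1 y0).
by rewrite ur mulrCA.
Qed.

End Optimal.

Lemma dens_eq_of_optimizer (y y' : R) : 0 <= y -> 0 <= y' ->
  (- dPhi u y = - dPhi u y')%E -> y = y'.
Proof.
have key (z : R) : 0 <= z -> (z = 0 /\ (- dPhi u z = +oo)%E) \/
    (0 < z /\ (- dPhi u z = (inv_marginal u a z)%:E)%E).
  rewrite le_eqVlt => /predU1P[<-|z0]; [left|right]; split=> //; first exact: dPhiE0.
  exact: (dPhiE hu hA1).
move=> /key[[-> ->]|[y0 ->]] /key[[-> ->]|[y'0 ->]]// [e].
have [_ <-] := inv_marginalP hA1 y0.
by have [_ <-] := inv_marginalP hA1 y'0; rewrite e.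
Qed.

(** The mass of the singular part determines its norm if [a] is finite and is itself zero otherwise;
    this is what [multiplier_arith] consumes. The lower bound on the norm comes from constants below
    [- r]. *)
Lemma snorm_a Q : NW P u K Q ->
  (a = -oo%E -> sing P u Q (cst 1) = 0) /\
  (forall r : R, a = r%:E -> snorm Q = - r * sing P u Q (cst 1)).
Proof.
move=> NQ; have [ds ps [A cA]] := NW_sing NQ.
split=> [aNy|r ar]; first exact: (sing_cst0 hu hA1 ds ps cA aNy).
apply/eqP; rewrite eq_le (sing_norm_fin hu hA1 ds ps ar)/=.
have s1 : 0 <= sing P u Q (cst 1) by apply: ps; [exact: ocst|exact: ae_all].
have r0 : r < 0 by have := a_lt0 hu; rewrite ar lte_fin.
set s := sing P u Q (cst 1) in s1 *; set M := snorm Q.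
have H (c : R) : 0 <= c -> c < - r -> c * s <= M.
  by move=> c0 cr; apply: (sing_cst_le hu hA1 ds ps cA c0); rewrite ar lte_fin ltrNr.
clearbody s M; rewrite leNgt; apply/negP => lt.
have s0 : 0 < s.
  rewrite lt_neqAle s1 andbT; apply/eqP => s0.
  by have := H 0 (lexx 0) ltac:(by rewrite oppr_gt0); move: lt; rewrite -s0 !mulr0; lra.
have [M0|M0] := leP 0 M; last first.
  by have := H 0 (lexx 0) ltac:(by rewrite oppr_gt0); lra.
(* The midpoint of [M / s] and [- r]. *)
pose c := (M / s - r) / 2.
have q : M / s < - r by rewrite ltr_pdivrMr.
have q0 : 0 <= M / s by rewrite divr_ge0.
have := H c ltac:(by rewrite /c; lra) ltac:(by rewrite /c; lra).
rewrite -ler_pdivlMr// /c; lra.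
Qed.

(** Both solutions produce the same optimizer and [- Phi'] is injective, so the products
    [lam * dens Q] agree. Separating the factors takes the equality of the optimal values and
    [snorm_a]. *)
Lemma dual_solution_unique x lam Q lam' Q' : (a < x%:E)%E ->
  dual_solution P u K x lam Q -> dual_solution P u K x lam' Q' ->
  lam' = lam /\ {ae P, forall w, dens Q' w = dens Q w}.
Proof.
move=> ax sol sol'; have [l0 NQ opt] := sol; have [l'0 NQ' opt'] := sol'.
have ev : dual_value P u x lam Q = dual_value P u x lam' Q'.
  exact (ereal_le_anti (opt _ _ l'0 NQ') (opt' _ _ l0 NQ)).
have [mg g0 ig m0 E1] := NW_dens NQ; have [mg' g'0 ig' m'0 E1'] := NW_dens NQ'.
have K' := optimizer_KPhi sol'.
have eu' : eu (fun w => - dPhi u (lam' * dens Q' w))%E = dual_value P u x lam Q.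
  by rewrite ev; exact: optimizer_value sol'.
have e := optimizer_unique sol K' eu'.
have gg : {ae P, forall w, 0 <= dens Q w /\ 0 <= dens Q' w} by exact (ae_and g0 g'0).
have lg : {ae P, forall w, lam' * dens Q' w = lam * dens Q w}.
  apply: (ae_mono2 _ gg e) => w [gw g'w]; apply: dens_eq_of_optimizer.
    exact (mulr_ge0 (ltW l'0) g'w).
  exact (mulr_ge0 (ltW l0) gw).
have Elg : lam' * \int[P]_w dens Q' w = lam * \int[P]_w dens Q w.
  have m1 : measurable_fun setT (fun w => lam' * dens Q' w) by exact: measurable_funM.
  have m2 : measurable_fun setT (fun w => lam * dens Q w) by exact: measurable_funM.
  exact (etrans (esym (exp_Z lam' ig')) (etrans (exp_ae m1 m2 lg) (exp_Z lam ig))).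
have ll : lam' = lam.
  have [aNy ar] := snorm_a NQ; have [aNy' ar'] := snorm_a NQ'.
  have [_ e1] := NW_entropy NQ l0; have [_ e2] := NW_entropy NQ' l'0.
  have ev2 := EFin_inj (etrans (esym (e1 x)) (etrans ev (e2 x))).
  have Ep : \int[P]_w phi (lam' * dens Q' w) = \int[P]_w phi (lam * dens Q w).
    apply: exp_ae; [exact/measurable_phi_comp/measurable_funM|exact/measurable_phi_comp/measurable_funM|].
    by apply: ae_mono lg => w ->.
  exact (multiplier_arith ax E1 E1' Elg aNy ar aNy' ar' Ep ev2).
have inj (c A B : R) : 0 < c -> c * A = c * B -> A = B.
  by move=> c0; apply: mulfI; exact: lt0r_neq0.
split; [exact ll|rewrite ll in lg; apply: ae_mono lg => w e'].
exact (inj _ _ _ l0 e').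
Qed.

(** Of the market, only the cone structure, measurability and lower bounds of [K] enter; stochastic
    integration is confined to checking these. *)
Theorem utility_duality :
  (exists2 x : R, (a < x%:E)%E & (UW P u K x < uinfty u)%E) ->
  NW P u K !=set0 /\
  forall x : R, (a < x%:E)%E ->
    (exists lam Q, dual_solution P u K x lam Q) /\
    forall (lam : R) (Q : functional), dual_solution P u K x lam Q ->
      let fx := fun w => (- dPhi u (lam * dens_reg P u Q w)%R)%E in
      [/\ [/\ UW P u K x = UPhi P u K x,
              UPhi P u K x = expected_utility P u fx &
              expected_utility P u fx = dual_value P u x lam Q],
          [/\ KPhi P u K x fx,
              expected_utility P u fx = UPhi P u K x,
              forall f : Omega -> \bar R, KPhi P u K x f ->
                expected_utility P u f = UPhi P u K x ->
                {ae P, forall w, f w = fx w} &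
              forall lam' Q', dual_solution P u K x lam' Q' ->
                lam' = lam /\
                forall f, orlicz P (hatu u) f -> reg P u Q' f = reg P u Q f] &
          (\int[P]_w (fx w * (dens_reg P u Q w)%:E) =
             (x + dual_norm P u (sing P u Q))%:E)%E].
Proof.
move=> H; have NW0 := NW_nonempty H; split=> // x ax.
split.
  have [lam [Q [l0 NQ le]]] := dual_attained NW0 ax.
  exists lam, Q; split; [exact l0|exact NQ|] => lam' Q' l'0 NQ'.
  exact (le_trans le (le_trans (UW_le_UPhi x) (UPhi_le_dual x NQ' l'0))).
move=> lam Q sol fx; have [l0 NQ opt] := sol.
have Kfx := optimizer_KPhi sol; have efx := optimizer_value sol; rewrite -/fx in Kfx efx.
have U1 : UPhi P u K x = dual_value P u x lam Q.
  apply: (ereal_le_anti (UPhi_le_dual x NQ l0)); rewrite -efx.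
  by apply: ereal_sup_ubound; exists fx.
have U2 : UW P u K x = UPhi P u K x.
  apply: (ereal_le_anti (UW_le_UPhi x)); rewrite U1.
  have [lam' [Q' [l'0 NQ' le]]] := dual_attained NW0 ax.
  exact (le_trans (opt _ _ l'0 NQ') le).
split; first by split=> //; rewrite U1 efx.
- split=> //; first by rewrite U1 efx.
    by move=> f Kf; rewrite U1; exact: (optimizer_unique sol).
  move=> lam' Q' sol'; have [-> gg] := dual_solution_unique ax sol sol'; split=> // f Lf.
  have [_ NQ' _] := sol'; have [dQ pQ] := NW_dual NQ; have [dQ' pQ'] := NW_dual NQ'.
  have [_ _ gP] := dens_regP hu hA1 dQ pQ; have [_ _ gP'] := dens_regP hu hA1 dQ' pQ'.
  have [i ->] := gP _ Lf; have [i' ->] := gP' _ Lf.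
  apply: exp_ae; [exact: int_meas i'|exact: int_meas i|].
  by apply: ae_mono gg => w ->.
- have [ip <-] := optimizer_saturates sol; have [_ g0 _ _ _] := NW_dens NQ.
  rewrite -exp_fin//; apply: ae_eq_integral => //.
  - apply: emeasurable_funM; first by have [] := Kfx.
    by have [mg _ _ _ _] := NW_dens NQ; exact/measurable_EFinP.
  - by have /measurable_int := ip.
  - by apply: ae_mono g0 => w /(optimizer_prod sol)[-> _] _.
Qed.

End Duality.

(** * Linearity of the stochastic integral *)

Section SigmaAlgebraMaps.
Context {R : realType} {T : Type}.
Variables (D : set T) (Sigma : set (set T)).
Hypothesis hS : sigma_algebra D Sigma.
Implicit Types (f g : T -> R).

Lemma sigma_algebra_fullT : Sigma D.
Proof. by have [h0 hD _] := hS; have := hD _ h0; rewrite setD0. Qed.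

Lemma sigma_algebra_setU (A B : set T) : Sigma A -> Sigma B -> Sigma (A `|` B).
Proof. by move=> SA SB; rewrite -bigcup2E; have [h0 _] := hS; apply => -[|[|]]. Qed.

Lemma sigma_algebra_setI (A B : set T) : A `<=` D -> Sigma A -> Sigma B -> Sigma (A `&` B).
Proof.
move=> AD SA SB; have [_ hD _] := hS.
have -> : A `&` B = D `\` ((D `\` A) `|` (D `\` B)).
  apply/seteqP; split => x /=.
    by move=> [Ax Bx]; split; [exact: AD|move=> [[_ nA]|[_ nB]]].
  by move=> [Dx H]; split; apply: contrapT => n; apply: H; [left|right].
by apply: (hD); apply: sigma_algebra_setU; exact: (hD).
Qed.

(* The sets [C] with [D `&` [set x | C (f x, g x)]] in [Sigma] form a sigma-algebra
   containing the rectangles. *)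
Lemma sigma_algebra_comp2 f g (h : R * R -> R) : measurable_fun setT h ->
  (forall B, measurable B -> Sigma (D `&` f @^-1` B)) ->
  (forall B, measurable B -> Sigma (D `&` g @^-1` B)) ->
  forall B, measurable B -> Sigma (D `&` [set x | B (h (f x, g x))]).
Proof.
move=> mh mf mg B mB.
have : measurable (h @^-1` B) by have := mh measurableT B mB; rewrite setTI.
rewrite measurable_prod_measurableType.
suff H : <<s [set A `*` B' | A in @measurable _ R & B' in @measurable _ R] >> `<=`
  [set C | Sigma (D `&` [set x | C (f x, g x)])] by move=> /H.
apply: smallest_sub; last first.
  move=> _ [A mA [B' mB' <-]] /=.
  rewrite (_ : D `&` _ = (D `&` f @^-1` A) `&` (D `&` g @^-1` B')); last first.
    by apply/seteqP; split => x /=; tauto.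
  apply: sigma_algebra_setI; [by move=> x []|exact: mf|exact: mg].
have [h0 hD hU] := hS; split => [|A /= SA|A /= SA].
- by rewrite /= (_ : D `&` _ = set0)//; apply/seteqP; split => x /=; tauto.
- rewrite (_ : D `&` _ = D `\` (D `&` [set x | A (f x, g x)])); first exact: hD.
  by apply/seteqP; split => x /=; tauto.
- rewrite (_ : D `&` _ = \bigcup_k (D `&` [set x | A k (f x, g x)])); first exact: hU.
  apply/seteqP; split => x /=; first by move=> [Dx [k _ Ak]]; exists k.
  by move=> [k _ [Dx Ak]]; split=> //; exists k.
Qed.

Lemma sigma_algebra_lin (c d : R) f g :
  (forall B, measurable B -> Sigma (D `&` f @^-1` B)) ->
  (forall B, measurable B -> Sigma (D `&` g @^-1` B)) ->
  forall B, measurable B -> Sigma (D `&` (fun x => c * f x + d * g x) @^-1` B).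
Proof.
move=> mf mg; apply: (sigma_algebra_comp2 (h := fun p => c * p.1 + d * p.2)) => //.
by apply: measurable_funD; apply: measurable_funM.
Qed.

Lemma sigma_algebra_cst (c : R) B : Sigma (D `&` (fun=> c) @^-1` B).
Proof.
have [h0 _ _] := hS; have [Bc|nBc] := pselect (B c).
  by rewrite (_ : D `&` _ = D); [exact: sigma_algebra_fullT|apply/seteqP; split => x /=; tauto].
by rewrite (_ : D `&` _ = set0)//; apply/seteqP; split => x /=; tauto.
Qed.

Lemma sigma_algebra_indic (A : set T) (B : set R) : A `<=` D -> Sigma A ->
  Sigma (D `&` (\1_A : T -> R) @^-1` B).
Proof.
move=> AD SA; have [h0 hD _] := hS.
have SDA : Sigma (D `\` A) by exact: hD.
have inA x : A x -> \1_A x = 1 :> R by move=> Ax; rewrite indicE mem_set.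
have ninA x : ~ A x -> \1_A x = 0 :> R by move=> nAx; rewrite indicE memNset.
have -> : D `&` (\1_A : T -> R) @^-1` B = (A `&` [set x | B 1]) `|` ((D `\` A) `&` [set x | B 0]).
  apply/seteqP; split => x /=.
    move=> [Dx]; have [Ax|nAx] := pselect (A x); first by rewrite inA//; left.
    by rewrite ninA//; right.
  by move=> [[Ax B1]|[[Dx nAx] B0]]; [split; [exact: AD|rewrite inA]|split=> //; rewrite ninA].
apply: sigma_algebra_setU.
  have [B1|nB1] := pselect (B 1).
    by rewrite (_ : A `&` _ = A)//; apply/seteqP; split => x /=; tauto.
  by rewrite (_ : A `&` _ = set0)//; apply/seteqP; split => x /=; tauto.
have [B0|nB0] := pselect (B 0).
  by rewrite (_ : _ `&` _ = D `\` A)//; apply/seteqP; split => x /=; tauto.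
by rewrite (_ : _ `&` _ = set0)//; apply/seteqP; split => x /=; tauto.
Qed.

End SigmaAlgebraMaps.

(** * Adapted cadlag processes, their modes of convergence and the integral *)

Section Processes.
Context {R : realType} {dd : measure_display} {Omega : measurableType dd}.
Variables (P : probability Omega R) (T : \bar R) (F : R -> set (set Omega)).
Hypothesis hF : usual_filtration P T F.
Local Notation process := (@process R dd Omega).
Local Notation block := (@block R dd Omega).
Local Notation timeset := (timeset T).
Implicit Types (X Y : process) (K : seq block) (b : block) (w : Omega).

Definition lin (c d : R) X Y : process := fun t w => c * X t w + d * Y t w.

Lemma timeset_le (s t : R) : timeset t -> 0 <= s -> s <= t -> timeset s.
Proof. by move=> [t0 tT] s0 st; split=> //; apply: le_trans tT; rewrite lee_fin. Qed.

Lemma timeset_min (s t : R) : timeset s -> timeset t -> timeset (Order.min s t).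
Proof.
move=> hs ht; apply: (timeset_le hs); last by rewrite ge_min lexx.
by rewrite le_min (proj1 hs) (proj1 ht).
Qed.

Lemma adapted_setT X : adapted T F X <->
  forall t, timeset t -> forall B, measurable B -> F t (setT `&` X t @^-1` B).
Proof. by split=> H t ht B mB; have := H t ht B mB; rewrite setTI. Qed.

Lemma adapted_lin (c d : R) X Y : adapted T F X -> adapted T F Y -> adapted T F (lin c d X Y).
Proof.
move=> /adapted_setT aX /adapted_setT aY; apply/adapted_setT => t ht.
by apply: (sigma_algebra_lin (filt_sigma hF ht)); [exact: aX|exact: aY].
Qed.

Lemma cadlag_lin (c d : R) X Y : cadlag T X -> cadlag T Y -> cadlag T (lin c d X Y).
Proof.
move=> cX cY w t ht; have [X1 X2] := cX w t ht; have [Y1 Y2] := cY w t ht; split.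
  move=> tT; apply: cvgD; apply: cvgM; try exact: cvg_cst; [exact: X1|exact: Y1].
move=> t0; apply: is_cvgD; apply: is_cvgM; try exact: is_cvg_cst; [exact: X2|exact: Y2].
Qed.

Lemma adapted_measurable X t : adapted T F X -> timeset t -> measurable_fun setT (X t).
Proof. by move=> aX ht _ B mB; rewrite setTI; apply: (filt_sub hF ht); exact: aX. Qed.

Definition frozen (b : R) X : process := fun r w => X (Order.min b r) w.

Lemma cadlag_frozen (b : R) X : timeset b -> cadlag T X -> cadlag T (frozen b X).
Proof.
move=> hb cX w t ht; have [H1 H2] := cX w t ht; split=> [tT|t0]; rewrite /frozen.
  have [tb|bt] := ltP t b.
    apply: cvg_trans (H1 tT); apply: near_eq_cvg.
    by apply: filterS (nbhs_right_lt tb) => s sb; rewrite min_r// ltW.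
  apply: cvg_near_cst.
  by apply: filterS (nbhs_right_gt t) => s ts; rewrite min_l// (le_trans bt)// ltW.
have [tb|b_t] := leP t b.
  have /cvg_ex[l Hl] := H2 t0; apply: (cvgP l); apply: cvg_trans Hl; apply: near_eq_cvg.
  by apply: filterS (nbhs_left_lt t) => s st; rewrite min_r// (le_trans _ tb)// ltW.
apply: (cvgP (X b w)); apply: cvg_near_cst.
by apply: filterS (nbhs_left_gt b_t) => s bs; rewrite min_l// ltW.
Qed.

Definition block_int (b : block) X : process := fun r w =>
  bl_c b * \1_(bl_A b) w * (X (Order.min (bl_t b) r) w - X (Order.min (bl_s b) r) w).

Definition good_block (b : block) :=
  [/\ timeset (bl_s b), timeset (bl_t b), bl_s b <= bl_t b & F (bl_s b) (bl_A b)].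

Lemma elementary_cons b K : elementary T F (b :: K) <-> good_block b /\ elementary T F K.
Proof.
split=> [H|[gb H] [|n] b0 nK //=]; last exact: H.
by split=> [|n b0 nK]; [exact: (H 0%N b)|exact: (H n.+1 b0)].
Qed.

Lemma elementary_nil : elementary T F (@nil (block)).
Proof. by []. Qed.

Lemma elementary_cat K1 K2 : elementary T F K1 -> elementary T F K2 -> elementary T F (K1 ++ K2).
Proof. by elim: K1 => //= b K IH /elementary_cons[gb /IH H] /H H2; exact/elementary_cons. Qed.

Lemma elem_int_cons b K X : elem_int (b :: K) X = lin 1 1 (block_int b X) (elem_int K X).
Proof. by apply/funext => r; apply/funext => w; rewrite /lin /elem_int big_cons !mul1r. Qed.

Lemma elem_int_nil X : elem_int [::] X = fun _ _ => 0.
Proof. by apply/funext => r; apply/funext => w; rewrite /elem_int big_nil. Qed.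

Lemma adapted0 : adapted T F (fun _ _ => 0).
Proof. by apply/adapted_setT => t ht B _; exact: (sigma_algebra_cst (filt_sigma hF ht)). Qed.

Lemma cadlag0 : cadlag T (fun (_ : R) (_ : Omega) => 0 : R).
Proof. by move=> w t ht; split=> _; [exact: cvg_cst|exact: is_cvg_cst]. Qed.

Lemma cadlag_block_int b X : good_block b -> cadlag T X -> cadlag T (block_int b X).
Proof.
move=> [hs ht st FA] cX.
have := cadlag_lin 1 (- 1) (cadlag_frozen ht cX) (cadlag_frozen hs cX).
move=> c w r hr; have [c1 c2] := c w r hr.
pose k : R := bl_c b * \1_(bl_A b) w.
have e : block_int b X ^~ w = fun r => k * lin 1 (- 1) (frozen (bl_t b) X) (frozen (bl_s b) X) r w.
  by apply/funext => q; rewrite /block_int /lin /frozen mul1r mulN1r.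
split=> [rT|r0].
  have -> : block_int b X r w = k * lin 1 (- 1) (frozen (bl_t b) X) (frozen (bl_s b) X) r w.
    by rewrite -[LHS]/((block_int b X ^~ w) r) e.
  by rewrite e; apply: cvgM; [exact: cvg_cst|exact: c1].
by rewrite e; apply: is_cvgM; [exact: is_cvg_cst|exact: c2].
Qed.

Lemma adapted_block_int b X : good_block b -> adapted T F X -> adapted T F (block_int b X).
Proof.
move=> [hs ht st FA] /adapted_setT aX; apply/adapted_setT => r hr B mB.
have hS := filt_sigma hF hr.
have aXr (q : R) : timeset q -> forall B, measurable B ->
    F r (setT `&` (fun w => X (Order.min q r) w) @^-1` B).
  move=> hq B' mB'; have hm := timeset_min hq hr.
  by apply: (filt_homo hF hm hr); [rewrite ge_min lexx orbT|exact: aX].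
have [rs|sr] := ltP r (bl_s b).
  have -> : block_int b X r = fun=> 0.
    apply/funext => w; rewrite /block_int !min_r ?subrr ?mulr0//; first exact: ltW.
    exact: ltW (lt_le_trans rs st).
  exact: sigma_algebra_cst.
have FrA : F r (bl_A b) by exact: (filt_homo hF hs hr).
apply: (sigma_algebra_comp2 hS (h := fun p => bl_c b * p.1 * p.2)
  (f := \1_(bl_A b)) (g := fun w => X (Order.min (bl_t b) r) w - X (Order.min (bl_s b) r) w)) => //.
- by apply: measurable_funM => //; apply: measurable_funM.
- by move=> B' _; exact: sigma_algebra_indic.
- apply: (sigma_algebra_comp2 hS (h := fun p => p.1 - p.2)); [exact: measurable_funB|exact: aXr|exact: aXr].
Qed.

Lemma elem_int_regular K X : elementary T F K -> adapted T F X -> cadlag T X ->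
  adapted T F (elem_int K X) /\ cadlag T (elem_int K X).
Proof.
elim: K => [|b K IH] eK aX cX.
  by rewrite elem_int_nil; split; [exact: adapted0|exact: cadlag0].
move: eK => /elementary_cons[gb eK]; have [a1 c1] := IH eK aX cX.
rewrite elem_int_cons; split; first by apply: adapted_lin => //; exact: adapted_block_int.
by apply: cadlag_lin => //; exact: cadlag_block_int.
Qed.

Lemma elem_int_lin K (c d : R) X Y : elem_int K (lin c d X Y) = lin c d (elem_int K X) (elem_int K Y).
Proof.
apply/funext => r; apply/funext => w; rewrite /elem_int /lin !mulr_sumr -big_split /=.
by apply: eq_bigr => b _; ring.
Qed.

Lemma elem_int_cat K1 K2 X r w : elem_int (K1 ++ K2) X r w = elem_int K1 X r w + elem_int K2 X r w.
Proof. by rewrite /elem_int big_cat. Qed.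

Lemma elem_val_cat K1 K2 r w : elem_val (K1 ++ K2) r w = elem_val K1 r w + elem_val K2 r w :> R.
Proof. by rewrite /elem_val big_cat. Qed.

Definition scale_block (c : R) (b : block) := Block (bl_s b) (bl_t b) (bl_A b) (c * bl_c b).

Lemma elementary_scale c K : elementary T F K -> elementary T F (map (scale_block c) K).
Proof. by elim: K => //= b K IH /elementary_cons[gb /IH H]; exact/elementary_cons. Qed.

Lemma elem_int_scale c K X r w : elem_int (map (scale_block c) K) X r w = c * elem_int K X r w.
Proof. by rewrite /elem_int big_map mulr_sumr; apply: eq_bigr => b _ /=; rewrite !mulrA. Qed.

Lemma elem_val_scale c K r w : elem_val (map (scale_block c) K) r w = c * elem_val K r w.
Proof. by rewrite /elem_val big_map mulr_sumr; apply: eq_bigr => b _ /=; rewrite !mulrA. Qed.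

Lemma elem_val_bounded K : exists c : R, forall r w, `|elem_val K r w| <= c.
Proof.
exists (\sum_(b <- K) `|bl_c b|) => r w; rewrite /elem_val; apply: (le_trans (ler_norm_sum _ _ _)).
apply: ler_sum => b _; rewrite !normrM -[leRHS]mulr1 -mulrA ler_wpM2l//.
rewrite indicE; case: (_ \in _); case: (_ < _ <= _) => /=; by rewrite ?normr0 ?normr1 ?mulr0 ?mul0r ?mulr1.
Qed.

Definition exceeds (Y : process) (t eps : R) :=
  [set w | exists s : R, 0 <= s <= t /\ eps < `|Y s w|].

(* By right-continuity, [s] may be taken rational or equal to [t]. *)
Lemma measurable_exceeds Y (t eps : R) : adapted T F Y -> cadlag T Y -> timeset t ->
  measurable (exceeds Y t eps).
Proof.
move=> aY cY ht.
have mY (s : R) : timeset s -> measurable [set w | eps < `|Y s w|].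
  move=> hs; have mYs := adapted_measurable aY hs.
  have := @measurable_fun_ltr _ _ _ setT (fun=> eps) (fun w => `|Y s w|) (measurable_cst _) ltac:(exact: measurableT_comp).
  by move=> /(_ measurableT [set true] I); rewrite setTI.
pose A (n : nat) := if unpickle n is Some q then
  if 0 <= (ratr q : R) <= t then [set w | eps < `|Y (ratr q) w|] else set0 else set0.
have -> : exceeds Y t eps = (\bigcup_n A n) `|` [set w | eps < `|Y t w|].
  apply/seteqP; split => [w [s [/andP[s0 st] H]]|w [[n _]|H]]; last first.
  - by exists t; split=> //; rewrite lexx (proj1 ht).
  - rewrite /A; case: (unpickle n) => [q|//].
    by case: ifP => // hq H; exists (ratr q).
  move: st; rewrite le_eqVlt => /predU1P[<-|st]; first by right.
  left; have hs : timeset s by apply: (timeset_le ht) => //; exact: ltW.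
  have sT : (s%:E < T)%E by apply: lt_le_trans (proj2 ht); rewrite lte_fin.
  have [H1 _] := cY w s hs.
  have : \forall r \near s^'+, eps < `|Y r w|.
    exact: (@cvgr_norm_gt R R^o R (s^'+) _ (fun r => Y r w) (Y s w) (H1 sT) eps H).
  rewrite near_withinE => /nbhs_ballP[e /= e0 He].
  have [q] := @rat_in_itvoo R s (Num.min (s + e) t) ltac:(by rewrite lt_min st andbT ltrDl).
  rewrite in_itv/= lt_min => /andP[sq /andP[qe qt]].
  exists (pickle q); first exact I.
  rewrite /A (pickleK q).
  rewrite (le_trans s0 (ltW sq)) (ltW qt)/=; apply: He => //=.
  by rewrite /ball /= ltr0_norm ?subr_lt0//; lra.
apply: measurableU; last exact: mY.
apply: bigcup_measurable => n _; rewrite /A; case: (unpickle n) => [q|//].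
case: ifP => // /andP[q0 qt]; apply: mY; exact: (timeset_le ht).
Qed.

(** If both processes stay below the reduced threshold, the combination stays below [eps / 2]; the
    summand 1 keeps the divisor positive for [c = d = 0]. *)
Lemma exceeds_lin Y Y' (c d t eps : R) : 0 < eps ->
  exceeds (lin c d Y Y') t eps `<=`
  exceeds Y t (eps / (2 * (1 + `|c| + `|d|))) `|` exceeds Y' t (eps / (2 * (1 + `|c| + `|d|))).
Proof.
move=> e0 w [s [st H]]; apply: contrapT => /not_orP[n1 n2].
have M0 : 0 < 2 * (1 + `|c| + `|d|) by rewrite mulr_gt0// addr_gt0// addr_gt0.
set e := eps / _ in n1 n2.
have l1 : `|Y s w| <= e by rewrite leNgt; apply/negP => lt; apply: n1; exists s.
have l2 : `|Y' s w| <= e by rewrite leNgt; apply/negP => lt; apply: n2; exists s.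
have e'0 : 0 < e by rewrite divr_gt0.
have : eps = e * (2 * (1 + `|c| + `|d|)) by rewrite /e divfK// gt_eqF.
move: H; rewrite /lin => H.
have := ler_normD (c * Y s w) (d * Y' s w); rewrite !normrM.
have := ler_wpM2l (normr_ge0 c) l1; have := ler_wpM2l (normr_ge0 d) l2.
have := normr_ge0 c; have := normr_ge0 d; have k1 := mulr_ge0 (ltW e'0) (normr_ge0 c).
have k2 := mulr_ge0 (ltW e'0) (normr_ge0 d); move: k1 k2 H e'0; clearbody e; nra.
Qed.

Lemma P_exceeds_lin Y Y' (c d t eps : R) : 0 < eps -> timeset t ->
  adapted T F Y -> cadlag T Y -> adapted T F Y' -> cadlag T Y' ->
  (P (exceeds (lin c d Y Y') t eps) <=
    P (exceeds Y t (eps / (2 * (1 + `|c| + `|d|)))) +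
    P (exceeds Y' t (eps / (2 * (1 + `|c| + `|d|)))))%E.
Proof.
move=> e0 ht aY cY aY' cY'.
have m1 := measurable_exceeds (eps / (2 * (1 + `|c| + `|d|))) aY cY ht.
have m2 := measurable_exceeds (eps / (2 * (1 + `|c| + `|d|))) aY' cY' ht.
apply: le_trans (measureU2 _ m1 m2); apply: le_measure; rewrite ?inE.
- by apply: measurable_exceeds => //; [exact: adapted_lin|exact: cadlag_lin].
- exact: measurableU.
- exact: exceeds_lin.
Qed.

Lemma lin_sub (c d : R) X X' Y Y' :
  (fun t w => lin c d X Y t w - lin c d X' Y' t w) =
  lin c d (fun t w => X t w - X' t w) (fun t w => Y t w - Y' t w).
Proof. by apply/funext => t; apply/funext => w; rewrite /lin; ring. Qed.

Lemma sub_regular X Y : adapted T F X -> cadlag T X -> adapted T F Y -> cadlag T Y ->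
  adapted T F (fun t w => X t w - Y t w) /\ cadlag T (fun t w => X t w - Y t w).
Proof.
move=> aX cX aY cY.
have -> : (fun t w => X t w - Y t w) = lin 1 (- 1) X Y.
  by apply/funext => t; apply/funext => w; rewrite /lin mul1r mulN1r.
by split; [exact: adapted_lin|exact: cadlag_lin].
Qed.

Lemma linC (c d : R) X Y : lin c d X Y = lin d c Y X.
Proof. by apply/funext => t; apply/funext => w; rewrite /lin addrC. Qed.

Lemma ucp_lin_l (c d : R) (Xn : nat -> process) X Y : ucp_cvg P T Xn X ->
  ucp_cvg P T (fun n => lin c d (Xn n) Y) (lin c d X Y).
Proof.
move=> H t eps ht e0; rewrite /=.
have e n s w : lin c d (Xn n) Y s w - lin c d X Y s w = c * (Xn n s w - X s w).
  by rewrite /lin; ring.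
have [->|c0] := eqVneq c 0.
  rewrite (_ : (fun n => _) = fun=> 0%E); first exact: cvg_cst.
  apply/funext => n; rewrite (_ : [set w | _] = set0) ?measure0//.
  apply/seteqP; split => // w [s [_]]; rewrite /lin !mul0r !add0r subrr normr0.
  by move=> /(lt_trans e0); rewrite ltxx.
have c0' : 0 < `|c| by rewrite normr_gt0.
have E n : [set w | exists s : R, 0 <= s <= t /\ eps < `|lin c d (Xn n) Y s w - lin c d X Y s w|] =
    [set w | exists s : R, 0 <= s <= t /\ eps / `|c| < `|Xn n s w - X s w|].
  by apply/seteqP; split => w [s [st H']]; exists s; split=> //; move: H';
    rewrite e normrM ltr_pdivrMr// mulrC.
rewrite (_ : (fun n => P _) = fun n =>
    P [set w | exists s : R, 0 <= s <= t /\ eps / `|c| < `|Xn n s w - X s w|]).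
  exact: (H t (eps / `|c|) ht (divr_gt0 e0 c0')).
by apply/funext => n; rewrite E.
Qed.

Lemma ucp_lin_r (c d : R) (Xn : nat -> process) X Y : ucp_cvg P T Xn X ->
  ucp_cvg P T (fun n => lin c d Y (Xn n)) (lin c d Y X).
Proof.
move=> H; rewrite linC (_ : (fun n => _) = fun n => lin d c (Xn n) Y); last first.
  by apply/funext => n; rewrite linC.
exact: ucp_lin_l.
Qed.

(** Elementary integrals are linear in the integrator and both sequences are tested by the same [K],
    so uniformity over [K] is preserved. Regularity of the processes makes the events measurable. *)
Lemma emery_lin (c d : R) (Xn Yn : nat -> process) X Y :
  (forall n, adapted T F (Xn n) /\ cadlag T (Xn n)) ->
  (forall n, adapted T F (Yn n) /\ cadlag T (Yn n)) ->
  adapted T F X -> cadlag T X -> adapted T F Y -> cadlag T Y ->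
  emery_cvg P T F Xn X -> emery_cvg P T F Yn Y ->
  emery_cvg P T F (fun n => lin c d (Xn n) (Yn n)) (lin c d X Y).
Proof.
move=> rX rY aX cX aY cY [uX eX] [uY eY].
pose M := 2 * (1 + `|c| + `|d|).
have M0 : 0 < M by rewrite mulr_gt0// addr_gt0// addr_gt0.
have rdX n := sub_regular (proj1 (rX n)) (proj2 (rX n)) aX cX.
have rdY n := sub_regular (proj1 (rY n)) (proj2 (rY n)) aY cY.
split.
  move=> t eps ht e0.
  have eM : 0 < eps / M by rewrite divr_gt0.
  apply: (@squeeze_cvge _ _ _ _ (fun=> 0%E) _ (fun n =>
      P (exceeds (fun r w => (Xn n r w - X r w)%R) t (eps / M)%R) +
      P (exceeds (fun r w => (Yn n r w - Y r w)%R) t (eps / M)%R))%E).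
  - near=> n; rewrite measure_ge0/=.
    have [? ?] := rdX n; have [? ?] := rdY n.
    have := P_exceeds_lin c d e0 ht (proj1 (rdX n)) (proj2 (rdX n)) (proj1 (rdY n)) (proj2 (rdY n)).
    by rewrite -lin_sub.
  - exact: cvg_cst.
  - rewrite -[X in _ --> X]adde0; apply: cvgeD => //; [exact: uX|exact: uY].
move=> t eps del ht e0 d0.
have eM : 0 < eps / M by rewrite divr_gt0.
have d20 : 0 < del / 2 by rewrite divr_gt0.
near=> n => K eK K1.
have hX : (P (exceeds (elem_int K (fun r v => (Xn n r v - X r v)%R)) t (eps / M)) <= (del / 2)%:E)%E.
  by move: K eK K1; near: n; exact: eX.
have hY : (P (exceeds (elem_int K (fun r v => (Yn n r v - Y r v)%R)) t (eps / M)) <= (del / 2)%:E)%E.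
  by move: K eK K1 {hX}; near: n; exact: eY.
rewrite lin_sub elem_int_lin.
have [aEX cEX] := elem_int_regular eK (proj1 (rdX n)) (proj2 (rdX n)).
have [aEY cEY] := elem_int_regular eK (proj1 (rdY n)) (proj2 (rdY n)).
apply: (le_trans (P_exceeds_lin c d e0 ht aEX cEX aEY cEY)).
by rewrite [leRHS](_ : _ = (del / 2)%:E + (del / 2)%:E)%E ?leeD// -EFinD -splitr.
Unshelve. all: by end_near.
Qed.

Section Integral.
Context {d : nat}.
Local Notation vprocess := (vprocess R Omega d).
Variable S : vprocess.
Hypothesis hS : forall i, adapted T F (coordinate S i) /\ cadlag T (coordinate S i).
Implicit Types (H : vprocess).

Definition vlin (c e : R) H1 H2 : vprocess := fun t w => c *: H1 t w + e *: H2 t w.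

Lemma coordinate_vlin (c e : R) H1 H2 i :
  coordinate (vlin c e H1 H2) i = lin c e (coordinate H1 i) (coordinate H2 i).
Proof. by apply/funext => t; apply/funext => w; rewrite /coordinate /vlin !mxE. Qed.

Lemma pointwise_lin (c e : R) (Hn Hn' : nat -> vprocess) H H' :
  pointwise_cvg T Hn H -> pointwise_cvg T Hn' H' ->
  pointwise_cvg T (fun n => vlin c e (Hn n) (Hn' n)) (vlin c e H H').
Proof.
move=> h h' t w i ht t0; rewrite coordinate_vlin.
rewrite (_ : (fun n => _) = fun n => c * coordinate (Hn n) i t w + e * coordinate (Hn' n) i t w); last first.
  by apply/funext => n; rewrite coordinate_vlin.
by apply: cvgD; apply: cvgM; try exact: cvg_cst; [exact: h|exact: h'].
Qed.

Lemma sum_regular (I : Type) (s : seq I) (Y : I -> process) :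
  (forall i, adapted T F (Y i) /\ cadlag T (Y i)) ->
  adapted T F (fun t w => \sum_(i <- s) Y i t w) /\
  cadlag T (fun t w => \sum_(i <- s) Y i t w).
Proof.
move=> rY; elim: s => [|i s [aI cI]].
  have -> : (fun t w => \sum_(i <- [::]) Y i t w) = fun _ _ => 0.
    by apply/funext => t; apply/funext => w; rewrite big_nil.
  by split; [exact: adapted0|exact: cadlag0].
have -> : (fun t w => \sum_(j <- i :: s) Y j t w) = lin 1 1 (Y i) (fun t w => \sum_(j <- s) Y j t w).
  by apply/funext => t; apply/funext => w; rewrite big_cons /lin !mul1r.
by have [aY cY] := rY i; split; [exact: adapted_lin|exact: cadlag_lin].
Qed.

Lemma bounded_integral_regular H X : bounded_integral P T F S H X ->
  adapted T F X /\ cadlag T X.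
Proof.
case=> // K eK; apply: sum_regular => i; have [aS cS] := hS i; exact: elem_int_regular.
Qed.

Lemma bounded_integral_bounded H X : bounded_integral P T F S H X ->
  exists c : R, forall t w i, timeset t -> 0 < t -> `|coordinate H i t w| <= c.
Proof.
case=> [K eK|Hn Xn H' X' c _ Hc Hcvg _ _ _].
  have [c hc] := choice (fun i => elem_val_bounded (K i)).
  exists (\sum_i `|c i|) => t w i _ _; rewrite /coordinate mxE.
  apply: (le_trans (hc i t w)); apply: (le_trans (ler_norm _)).
  by rewrite (bigD1 i)//= lerDl sumr_ge0.
exists c => t w i ht t0; rewrite leNgt; apply/negP => lt.
have := @cvgr_norm_gt R R^o nat \oo _ (fun n => coordinate (Hn n) i t w) _ (Hcvg t w i ht t0) c lt.
by move=> [N _ /(_ N (leqnn N))] /=; rewrite ltNge Hc.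
Qed.

Lemma vlin_bounded (c e : R) H1 H2 (c1 c2 : R) :
  (forall t w i, timeset t -> 0 < t -> `|coordinate H1 i t w| <= c1) ->
  (forall t w i, timeset t -> 0 < t -> `|coordinate H2 i t w| <= c2) ->
  forall t w i, timeset t -> 0 < t ->
    `|coordinate (vlin c e H1 H2) i t w| <= `|c| * c1 + `|e| * c2.
Proof.
move=> b1 b2 t w i ht t0; rewrite coordinate_vlin /lin.
by apply: (le_trans (ler_normD _ _)); rewrite !normrM lerD// ler_wpM2l//; [exact: b1|exact: b2].
Qed.

(** Linearity in two inductively generated arguments takes one induction inside another; here the
    first integrand is still elementary. In the limit case one argument is constant along the
    sequence, so the ucp limit has a single moving term. *)
Lemma bounded_integral_lin_elem (c e : R) (K : 'I_d -> seq block) H X :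
  (forall i, elementary T F (K i)) -> bounded_integral P T F S H X ->
  bounded_integral P T F S
    (vlin c e (fun t w => \row_i elem_val (K i) t w) H)
    (lin c e (fun t w => \sum_i elem_int (K i) (coordinate S i) t w) X).
Proof.
move=> eK; have B1 := @bounded_integral_elem _ _ _ P T F _ S K eK.
have [aX1 cX1] := bounded_integral_regular B1; have [c1 hc1] := bounded_integral_bounded B1.
elim=> [K' eK'|Hn Xn H' X' c' BI IH Hc Hcvg aX cX uX].
  pose K2 i := map (scale_block c) (K i) ++ map (scale_block e) (K' i).
  have eK2 i : elementary T F (K2 i) by apply: elementary_cat; exact: elementary_scale.
  have := @bounded_integral_elem _ _ _ P T F _ S K2 eK2; congr (bounded_integral _ _ _ _ _ _).
    apply/funext => t; apply/funext => w; apply/rowP => i.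
    by rewrite /vlin !mxE elem_val_cat !elem_val_scale.
  apply/funext => t; apply/funext => w; rewrite /lin !mulr_sumr -big_split/=.
  by apply: eq_bigr => i _; rewrite elem_int_cat !elem_int_scale.
apply: (@bounded_integral_lim _ _ _ P T F _ S _ _ _ _ (`|c| * c1 + `|e| * c') IH).
- by move=> n; apply: vlin_bounded => //; exact: Hc.
- by apply: pointwise_lin => // t w i _ _; exact: cvg_cst.
- exact: adapted_lin.
- exact: cadlag_lin.
- exact: ucp_lin_r.
Qed.

Lemma bounded_integral_lin (c e : R) H1 X1 H2 X2 :
  bounded_integral P T F S H1 X1 -> bounded_integral P T F S H2 X2 ->
  bounded_integral P T F S (vlin c e H1 H2) (lin c e X1 X2).
Proof.
move=> B1 B2; have [aX2 cX2] := bounded_integral_regular B2.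
have [c2 hc2] := bounded_integral_bounded B2.
elim: B1 => [K eK|Hn Xn H' X' c' BI IH Hc Hcvg aX cX uX].
  exact: bounded_integral_lin_elem.
apply: (@bounded_integral_lim _ _ _ P T F _ S _ _ _ _ (`|c| * c' + `|e| * c2) IH).
- by move=> n; apply: vlin_bounded => //; exact: Hc.
- by apply: pointwise_lin => // t w i _ _; exact: cvg_cst.
- exact: adapted_lin.
- exact: cadlag_lin.
- exact: ucp_lin_l.
Qed.

Let predictable_sigma : sigma_algebra (predictable_domain T)
  <<s @predictable_domain R dd Omega T, predictable_rectangles T F >>.
Proof. exact: smallest_sigma_algebra. Qed.

Lemma stochastic_integral_lin (c e : R) H1 X1 H2 X2 :
  stochastic_integral P T F S H1 X1 -> stochastic_integral P T F S H2 X2 ->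
  stochastic_integral P T F S (vlin c e H1 H2) (lin c e X1 X2).
Proof.
move=> [pH1 aX1 cX1 [Hn1 [Xn1 [B1 P1 E1]]]] [pH2 aX2 cX2 [Hn2 [Xn2 [B2 P2 E2]]]].
split.
- move=> i B mB; rewrite coordinate_vlin.
  apply: (@sigma_algebra_lin R _ _ _ predictable_sigma c e
    (fun p => coordinate H1 i p.1 p.2) (fun p => coordinate H2 i p.1 p.2)) => //.
    exact: pH1.
  exact: pH2.
- exact: adapted_lin.
- exact: cadlag_lin.
- exists (fun n => vlin c e (Hn1 n) (Hn2 n)), (fun n => lin c e (Xn1 n) (Xn2 n)); split.
  + by move=> n; exact: bounded_integral_lin.
  + exact: pointwise_lin.
  + by apply: emery_lin => // n; [exact: bounded_integral_regular (B1 n)|exact: bounded_integral_regular (B2 n)].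
Qed.

Lemma stochastic_integral0 : stochastic_integral P T F S (fun _ _ => 0) (fun _ _ => 0).
Proof.
have eN (i : 'I_d) : elementary T F (@nil block) by exact: elementary_nil.
have B0 : bounded_integral P T F S (fun _ _ => 0) (fun _ _ => 0).
  have := @bounded_integral_elem _ _ _ P T F _ S (fun=> [::]) eN; congr (bounded_integral _ _ _ _ _ _).
    by apply/funext => t; apply/funext => w; apply/rowP => i; rewrite !mxE /elem_val big_nil.
  by apply/funext => t; apply/funext => w; rewrite big1// => i _; rewrite elem_int_nil.
have none (Y : process) t (eps : R) : (forall s w, Y s w = 0) -> 0 < eps ->
    [set w | exists s : R, 0 <= s <= t /\ eps < `|Y s w|] = set0.
  move=> Y0 e0; apply/seteqP; split => // w [s [_]]; rewrite Y0 normr0.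
  by move=> /(lt_trans e0); rewrite ltxx.
split.
- move=> i B mB; rewrite (_ : coordinate _ i = fun _ _ => 0); last first.
    by apply/funext => t; apply/funext => w; rewrite /coordinate mxE.
  exact: (sigma_algebra_cst predictable_sigma).
- exact: adapted0.
- exact: cadlag0.
- exists (fun _ _ _ => 0), (fun _ _ _ => 0); split=> //.
  + by move=> t w i _ _; exact: cvg_cst.
  + split=> [t eps ht e0|t eps del ht e0 d0].
      rewrite (_ : (fun n => _) = fun=> 0%E); first exact: cvg_cst.
      by apply/funext => n; rewrite none ?measure0// => s w; rewrite subrr.
    near=> n => K eK _; rewrite none ?measure0 ?lee_fin ?ltW// => s w.
    by rewrite /elem_int big1// => b _; rewrite !subrr mulr0.
Unshelve. all: by end_near.
Qed.

End Integral.

(** * The cone of terminal gains *)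

Section Gains.
Context {d : nat}.
Variables (S : vprocess R Omega d) (W : Omega -> R).
Hypothesis hS : semimartingale P T F S.
Hypothesis hT : (0 < T)%E.
Hypothesis W0 : le_as P (cst 0) W.

Let regS i : adapted T F (coordinate S i) /\ cadlag T (coordinate S i).
Proof. by have [] := hS i. Qed.

Lemma KW0 : KW P T F S W (fun=> 0).
Proof.
split; first exact: measurable_cst.
exists (fun _ _ => 0), (fun _ _ => 0); split; first exact: stochastic_integral0.
  by exists 1 => //; apply: ae_mono W0 => w w0 t _; rewrite mul1r oppr_le0.
rewrite /terminal; case: T => [t| |]; [exact: ae_all| |];
  by apply: ae_all => w; exact: cvg_cst.
Qed.

Lemma KW_lin (c e : R) k1 k2 : 0 <= c -> 0 <= e -> KW P T F S W k1 -> KW P T F S W k2 ->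
  KW P T F S W (fun w => c * k1 w + e * k2 w).
Proof.
move=> c0 e0 [m1 [H1 [X1 [I1 [c1 c10 A1] T1]]]] [m2 [H2 [X2 [I2 [c2 c20 A2] T2]]]].
split; first by apply: measurable_funD; exact: measurable_funM.
exists (vlin c e H1 H2), (lin c e X1 X2); split; first exact: stochastic_integral_lin.
  (* The added 1 makes the constant positive even for [c = e = 0]; it is harmless because [W] is
     nonnegative. *)
  exists (c * c1 + e * c2 + 1); first by rewrite ltr_wpDl// addr_ge0// mulr_ge0// ltW.
  have AA := ae_and W0 (ae_and A1 A2).
  apply: ae_mono AA => w [/= w0 [h1 h2]] t ht; rewrite /lin.
  have := ler_wpM2l c0 (h1 t ht); have := ler_wpM2l e0 (h2 t ht).
  by move: w0; set a1 := X1 t w; set a2 := X2 t w; nra.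
move: T1 T2; rewrite /terminal; case: T => [t| |] T1 T2.
- by apply: (ae_mono2 _ T1 T2) => w -> ->.
- by apply: (ae_mono2 _ T1 T2) => w t1 t2; apply: cvgD; apply: cvgM => //; exact: cvg_cst.
- by apply: (ae_mono2 _ T1 T2) => w t1 t2; apply: cvgD; apply: cvgM => //; exact: cvg_cst.
Qed.

Lemma KW_ge k : KW P T F S W k -> exists c : R, {ae P, forall w, - (c * W w) <= k w}.
Proof.
move=> [mk [H [X [_ [c c0 A] Tk]]]]; exists c.
move: A Tk hT; rewrite /terminal /Defs.timeset; case: T => [t| |] // A Tk t0.
  apply: (ae_mono2 _ A Tk) => w Aw ->; apply: Aw; split=> //.
  by rewrite -lee_fin ltW.
apply: (ae_mono2 _ A Tk) => w Aw Tw; rewrite leNgt; apply/negP => lt.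
have [M [_ HM]] := cvgr_lt _ Tw _ lt.
(* A time beyond [M] that is also nonnegative, so that admissibility applies to it. *)
have := HM (Num.max M 0 + 1) ltac:(by rewrite (le_lt_trans (_ : M <= Num.max M 0)) ?le_max ?lexx// ltrDl).
rewrite ltNge Aw//; split; last exact: leey.
by rewrite addr_ge0// le_max lexx orbT.
Qed.

End Gains.
End Processes.

Theorem theorem29 (R : realType) (dd : measure_display)
  (Omega : measurableType dd) (P : probability Omega R)
  (T : \bar R) (hT : (0 < T)%E)
  (F : R -> set (set Omega)) (hF : usual_filtration P T F)
  (d : nat) (hd : (0 < d)%N)
  (S : vprocess R Omega d)
  (hS : semimartingale P T F S) (hSlim : has_limit_at_infinity P T S)
  (u : R -> \bar R) (a : \bar R) (hu : utility u a)
  (hA1 : A1 u a) (hA2 : A2 P u)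
  (W : Omega -> R) (hW : orlicz P (hatu u) W) (hW0 : le_as P (cst 0) W)
  (hsup : exists2 x : R, (a < x%:E)%E & (UW P u (KW P T F S W) x < uinfty u)%E) :
  let K := KW P T F S W in
  NW P u K !=set0 /\
  forall x : R, (a < x%:E)%E ->
    (exists lam Q, dual_solution P u K x lam Q) /\
    forall (lam : R) (Q : functional),
      dual_solution P u K x lam Q ->
      let fx := fun w => (- dPhi u (lam * dens_reg P u Q w)%R)%E in
      [/\ (* item 1 *)
          [/\ UW P u K x = UPhi P u K x,
              UPhi P u K x = expected_utility P u fx &
              expected_utility P u fx = dual_value P u x lam Q],
          (* item 2 *)
          [/\ KPhi P u K x fx,
              expected_utility P u fx = UPhi P u K x,
              forall f, KPhi P u K x f ->
                expected_utility P u f = UPhi P u K x ->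
                {ae P, forall w, f w = fx w} &
              forall lam' Q', dual_solution P u K x lam' Q' ->
                lam' = lam /\
                forall f, orlicz P (hatu u) f -> reg P u Q' f = reg P u Q f] &
          (* item 3 *)
          (\int[P]_w (fx w * (dens_reg P u Q w)%:E) =
             (x + dual_norm P u (sing P u Q))%:E)%E].
Proof.
have hS' i : adapted T F (coordinate S i) /\ cadlag T (coordinate S i) by have [] := hS i.
apply: (utility_duality hu hA1 hA2 (W := W)) => //.
- exact: (KW0 hF S hW0).
- by move=> c e k1 k2; exact: (KW_lin hF).
- by move=> k [].
- by move=> k; exact: KW_ge.
Qed.
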